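(* Let $d\in\mathbb{N}$, $\sigma\in(0,1]$ with $\sigma<d/2$ if $d\in\{1,2\}$, $\alpha\in(\sigma,d/2)$ and $\alpha_0=\frac{d/2+\sigma}{2}$. The weight $w_{\sigma,\alpha}=\kappa_{\sigma-\alpha}/\kappa_{-\alpha}$ is a positive critical Hardy weight for $\Delta^\sigma$ on $\mathbb{Z}^d$ if and only if $\alpha<\alpha_0$.
   Context: For $f:\mathbb{Z}^d\to\mathbb{R}$ let $\Delta f(x)=\sum_{y:|y-x|=1}(f(x)-f(y))$ ($|\cdot|$ Euclidean norm), with heat semigroup $e^{-t\Delta}$ on $\ell^2(\mathbb{Z}^d)$; $1_0$ is the indicator of $\{0\}$. For $\sigma\in(0,1)$, $\Delta^\sigma$ is defined on $\ell^2$ by the spectral theorem, $\Delta^1=\Delta$. For $\beta\in(-d/2,1]$ the Riesz kernel $\kappa_\beta:\mathbb{Z}^d\to[0,\infty)$ is given by $\kappa_0=1_0$, $\kappa_1(x)=1_{\{|x|=1\}}$, $\kappa_\beta(0)=0$ if $\beta\in(0,1)$, and otherwise $\kappa_\beta(x)=\frac{1}{|\Gamma(-\beta)|}\int_0^\infty e^{-t\Delta}1_0(x)\,\frac{dt}{t^{1+\beta}}$. Let $Q^\sigma(f)=\frac12\sum_{x,y}\kappa_\sigma(x-y)(f(x)-f(y))^2$ (equal to $\langle\Delta^\sigma\varphi,\varphi\rangle$ for finitely supported $\varphi$), and let $\mathcal{D}_0^\sigma$ be the closure of finitely supported functions $C_c(\mathbb{Z}^d)$ under $\|\varphi\|=\sqrt{Q^\sigma(\varphi)+|\varphi(0)|^2}$.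 A function $w:\mathbb{Z}^d\to[0,\infty)$ is a Hardy weight if $Q^\sigma(\varphi)\ge\sum_xw(x)\varphi(x)^2$ for all $\varphi\in C_c(\mathbb{Z}^d)$ (then also for all $\varphi\in\mathcal{D}_0^\sigma$). A Hardy weight $w$ is critical if every Hardy weight $w'\ge w$ equals $w$ (subcritical otherwise). A critical Hardy weight $w$ is positive critical if there is a nonzero $v\in\mathcal{D}_0^\sigma$ with $Q^\sigma(v)=\sum_xw(x)v(x)^2$, and null-critical otherwise. *)

(* Defs.v *)
From HB Require Import structures.
From mathcomp Require Import all_boot all_order all_algebra.
From mathcomp Require Import all_classical all_reals all_analysis.
Unset Printing Implicit Defensive.
Import Order.TTheory GRing.Theory Num.Theory.
Import numFieldNormedType.Exports.
Local Open Scope classical_set_scope.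
Local Open Scope ring_scope.

Definition Zd (d : nat) := 'rV[int]_d.

Definition unitv (d : nat) (i : 'I_d) : Zd d := delta_mx 0 i.

Definition ind0 {R : realType} (d : nat) : Zd d -> R :=
  fun x => if x == 0 then 1 else 0.

(* graph Laplacian on Z^d: Delta f(x) = sum_{|y-x|=1} (f x - f y);
   the y with |y - x| = 1 are exactly x + e_i and x - e_i, i < d. *)
Definition lap {R : realType} (d : nat) (f : Zd d -> R) : Zd d -> R :=
  fun x => \sum_(i < d) ((f x - f (x + unitv d i)) + (f x - f (x - unitv d i))).

(* heat kernel e^{-t Delta} 1_0 (x): Delta is bounded on l^2, so
   e^{-t Delta} = sum_n (-t)^n / n! Delta^n (absolutely convergent). *)
Definition heat {R : realType} (d : nat) (t : R) (x : Zd d) : R :=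
  limn (series (fun n : nat =>
    ((- t) ^+ n / (n`!)%:R) * iter n (@lap R d) (@ind0 R d) x)).

(* Euler Gamma function: integral for s > 0, extended to (-1,0] by
   Gamma(s) = Gamma(s+1)/s (only arguments s > -1 are ever used). *)
Definition Gamma_pos {R : realType} (s : R) : R :=
  fine (\int[@lebesgue_measure R]_(t in `]0, +oo[%classic)
          ((t `^ (s - 1)) * expR (- t))%:E).
Definition Gamma {R : realType} (s : R) : R :=
  if 0 < s then Gamma_pos s else Gamma_pos (s + 1) / s.

Definition sqnorm (d : nat) (x : Zd d) : int := \sum_(i < d) (x 0 i) ^+ 2.

(* Riesz kernel kappa_beta, beta in (-d/2, 1] *)
Definition kappa {R : realType} (d : nat) (beta : R) (x : Zd d) : R :=
  if beta == 0 then (if x == 0 then 1 else 0)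
  else if beta == 1 then (if sqnorm d x == 1 then 1 else 0)
  else if (0 < beta < 1) && (x == 0) then 0
  else (`|Gamma (- beta)|)^-1 *
       fine (\int[@lebesgue_measure R]_(t in `]0, +oo[%classic)
               (heat d t x * t `^ (- 1 - beta))%:E).

Definition Qform {R : realType} (d : nat) (sigma : R) (f : Zd d -> R) : \bar R :=
  (2^-1)%:E * \esum_(p in [set: Zd d * Zd d])
      (kappa d sigma (p.1 - p.2) * (f p.1 - f p.2) ^+ 2)%:E.

Definition wsum {R : realType} (d : nat) (w f : Zd d -> R) : \bar R :=
  \esum_(x in [set: Zd d]) (w x * f x ^+ 2)%:E.

Definition Cc {R : realType} (d : nat) (f : Zd d -> R) : Prop :=
  finite_set [set x | f x != 0].

(* D_0^sigma: closure of C_c under ||phi|| = sqrt(Q^sigma(phi) + |phi(0)|^2) *)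
Definition D0 {R : realType} (d : nat) (sigma : R) (v : Zd d -> R) : Prop :=
  forall eps : R, 0 < eps -> exists phi : Zd d -> R, Cc d phi /\
    (Qform d sigma (fun x => (phi x - v x)%R) + ((phi 0 - v 0) ^+ 2)%R%:E < eps%:E)%E.

Definition hardy_weight {R : realType} (d : nat) (sigma : R) (w : Zd d -> R) : Prop :=
  (forall x, 0 <= w x) /\
  forall phi : Zd d -> R, Cc d phi -> (wsum d w phi <= Qform d sigma phi)%E.

Definition critical {R : realType} (d : nat) (sigma : R) (w : Zd d -> R) : Prop :=
  hardy_weight d sigma w /\
  forall w' : Zd d -> R, hardy_weight d sigma w' -> (forall x, w x <= w' x) -> w' = w.

Definition positive_critical {R : realType} (d : nat) (sigma : R) (w : Zd d -> R) : Prop :=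
  critical d sigma w /\
  exists v : Zd d -> R, D0 d sigma v /\ v <> (fun _ => 0) /\ Qform d sigma v = wsum d w v.

Definition w_sa {R : realType} (d : nat) (sigma alpha : R) : Zd d -> R :=
  fun x => kappa d (sigma - alpha) x / kappa d (- alpha) x.

(* Main.v *)
(* Write [Delta = 4d (1 - P)] with [P] the transition operator of the lazy walk
   and [q_n = P^n 1_0]. Expanding powers of
   [1 - P] in binomial series gives, off the diagonal where needed,
     [kappa_(-s) = (4d)^(-s) sum_n (s)_n / n! q_n]  and
     [kappa_s = (4d)^s sum_n |(-s)_n / n!| q_n],
   the second one being a multiple of the jump kernel [B] of a subordinated
   walk. With [u = (4d)^alpha kappa_(-alpha)], [v = (4d)^(alpha-s)
   kappa_(s-alpha)], Vandermonde's identity becomes [u = B * u + v], and the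
   ground state transform
     [Q(f) - <w f, f> = c/2 sum B(x - y) u_x u_y (f_x / u_x - f_y / u_y)^2]
   shows that [w = c v / u] is a Hardy weight and that every optimiser is
   proportional to [u]. Finally [sum w u^2 = c sum u v] is the series
   [sum_n (2 alpha - s)_n / n! q_n(0)], whose terms are of order
   [n^(2 alpha - s - 1 - d/2)]: it converges iff [alpha < (d/2 + s)/2]. In that
   case the partial sums of [u] are finitely supported and converge to [u] in
   the form domain. *)
Require Import Defs.
From HB Require Import structures.
From mathcomp Require Import all_boot all_order all_algebra.
From mathcomp Require Import all_classical all_reals all_analysis.
From mathcomp Require Import measurable_realfun.
From mathcomp Require Import ring lra.
Set Implicit Arguments.
Unset Strict Implicit.
Unset Printing Implicit Defensive.
Import Order.TTheory GRing.Theory Num.Theory.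
Import numFieldNormedType.Exports.
Local Open Scope classical_set_scope.
Local Open Scope ring_scope.

(** * Sums of nonnegative families *)

Section Esum.
Context {R : realType}.
Local Open Scope ereal_scope.

(** Laziness drives the estimates: a lazy step is a sum of two half-steps, so the one-dimensional
    counts are binomial coefficients [C(2k, k + z)], the walk is most likely at the origin, and
    return probabilities do not increase. The order [n^(-d/2)] comes without a local limit theorem:
    exponential generating functions factor over coordinates, and Cauchy-Schwarz with the binomial
    theorem compares the squared return probability, from both sides and up to constants, with
    [n! / (n + d)!], whose ratio is rational. The obstacle is that [u] is not square summable once
    [alpha >= d / 4], so [Q(u)] is not a difference of two finite sums. The splitting is done for
    finitely supported truncations, and the cancellation is moved to return probabilities: summation
    by parts writes the value of [(1 - P)^s P^j 1_0] at the origin as a nonnegative series. Paired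
    with coefficients of order [2 alpha], these values are controlled by a series of order
    [2 alpha - s], which gives exactly the required threshold. Sums live in the extended reals, so
    that rearrangements need only nonnegativity, and limits are taken by Fatou's lemma. *)

Lemma esumZ (T : choiceType) (c : R) (f : T -> \bar R) :
  (0 <= c)%R -> (forall x, 0 <= f x) ->
  \esum_(x in [set: T]) (c%:E * f x) = c%:E * \esum_(x in [set: T]) f x.
Proof.
have le_half (b : R) (g : T -> \bar R) : (0 <= b)%R -> (forall x, 0 <= g x) ->
  \esum_(x in [set: T]) (b%:E * g x) <= b%:E * \esum_(x in [set: T]) g x.
  move=> b0 g0; apply: ge_ereal_sup => _ [X [finX _] <-].
  rewrite -ge0_mule_fsumr//; apply: lee_wpmul2l; first by rewrite lee_fin.
  by apply: esum_ge; exists X.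
move=> c0 f0; apply/eqP; rewrite eq_le le_half//=.
have [->|cn0] := eqVneq c 0%R.
  by rewrite mul0e; apply: esum_ge0 => x _; rewrite mul0e.
have {cn0}c0 : (0 < c)%R by rewrite lt_def cn0.
rewrite -lee_pdivlMl//.
apply: le_trans (le_half (c^-1)%R (fun x => c%:E * f x) _ _); last 2 first.
- by rewrite invr_ge0 ltW.
- by move=> x; apply: mule_ge0 => //; rewrite lee_fin ltW.
apply: le_esum => x _.
by rewrite muleA -EFinM mulVf ?gt_eqF// mul1e.
Qed.

Lemma esum_pair (T T' : choiceType) (a : T -> T' -> \bar R) :
  (forall x y, 0 <= a x y) ->
  \esum_(p in [set: T * T']) a p.1 p.2 =
  \esum_(x in [set: T]) \esum_(y in [set: T']) a x y.
Proof.
move=> a0; rewrite esum_esum//; congr (esum _ _).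
by apply/seteqP; split.
Qed.

Lemma reindex_esumT (T T' : choiceType) (e : T -> T') (e' : T' -> T)
    (a : T' -> \bar R) : cancel e e' -> cancel e' e ->
  \esum_(y in [set: T']) a y = \esum_(x in [set: T]) a (e x).
Proof.
move=> ee' e'e; apply: reindex_esum; split => //.
- by move=> x y _ _ /(congr1 e'); rewrite !ee'.
- by move=> y _; exists (e' y) => //; rewrite e'e.
Qed.

Lemma exchange_esum (T T' : choiceType) (a : T -> T' -> \bar R) :
  (forall x y, 0 <= a x y) ->
  \esum_(x in [set: T]) \esum_(y in [set: T']) a x y =
  \esum_(y in [set: T']) \esum_(x in [set: T]) a x y.
Proof.
move=> a0; rewrite -!esum_pair//.
by apply: (@reindex_esumT _ _ (fun p => (p.2, p.1)) (fun p => (p.2, p.1))) => -[].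
Qed.

Lemma le_esum_term (T : choiceType) (f : T -> \bar R) (x : T) :
  (forall x, 0 <= f x) -> f x <= \esum_(x in [set: T]) f x.
Proof.
by move=> f0; apply: esum_ge; exists [set x] => //; rewrite fsbig_set1.
Qed.

Lemma esum_eqx (T : choiceType) (f : T -> \bar R) (x : T) :
  (forall y, y != x -> f y = 0) -> (0 <= f x) ->
  \esum_(y in [set: T]) f y = f x.
Proof.
move=> f0 fx; rewrite -[RHS](@esum_set1 _ _ x f)// [RHS]esum_mkcond.
apply: eq_esum => y _; case: ifPn => //; rewrite notin_setE /= => /eqP.
exact: f0.
Qed.

(** Turns a product of two generating functions into a single series; convolutions of coefficients
    enter through it. *)
Lemma esum_antidiag (a : nat -> nat -> \bar R) : (forall n k, 0 <= a n k) ->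
  \esum_(n in [set: nat]) \esum_(k in [set: nat]) a n k =
  \esum_(m in [set: nat]) \sum_(n < m.+1) a n (m - n)%N.
Proof.
move=> a0; rewrite -esum_pair//.
transitivity (\esum_(p in [set: nat] `*`` (fun m => [set n | (n <= m)%N]))
   a p.2 (p.1 - p.2)%N).
  apply: (@reindex_esum _ _ _ _ _
    (fun p : nat * nat => (p.2, (p.1 - p.2)%N)) (fun p => a p.1 p.2)).
  split => //.
  - move=> [m n] [m' n']; rewrite !inE /= => -[_ nm] [_ nm'] [nn'].
    move: nm nm'; rewrite nn' /= => nm nm' /eqP; rewrite -(eqn_add2r n').
    by rewrite !subnK// => /eqP ->.
  - move=> [n k] _ /=; exists ((n + k)%N, n); rewrite /= ?addKn//.
    by split => //=; rewrite leq_addr.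
rewrite -(@esum_esum _ _ _ _ _ (fun m n => a n (m - n)%N))//.
apply: eq_esum => m _.
rewrite (_ : [set n | (n <= m)%N] = `I_m.+1); last first.
  by apply/seteqP; split => n /=; rewrite ltnS.
rewrite esum_fset; [by rewrite (fsbig_ord _ _ (fun n => a n (m - n)%N))|exact: finite_II|by move=> *].
Qed.

Lemma cvg_sumr (T : Type) (s : seq T) (f : nat -> T -> R) (g : T -> R) :
  (forall x, (f ^~ x) @ \oo --> g x) ->
  (\sum_(x <- s) f n x)%R @[n --> \oo] --> (\sum_(x <- s) g x)%R.
Proof.
move=> fg; elim: s => [|x s IH].
  by rewrite big_nil; under eq_fun do rewrite big_nil; exact: cvg_cst.
rewrite big_cons; under eq_fun do rewrite big_cons.
exact: cvgD.
Qed.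

(** Fatou's lemma for the counting measure: each finite partial sum passes to the limit. It carries
    energy bounds from truncations to the ground state. *)
Lemma esum_le_cvg (T : choiceType) (f : nat -> T -> R) (g : T -> R)
    (C : \bar R) :
  (forall n x, (0 <= f n x)%R) ->
  (forall x, (f ^~ x) @ \oo --> g x) ->
  (\forall n \near \oo, \esum_(x in [set: T]) (f n x)%:E <= C) ->
  \esum_(x in [set: T]) (g x)%:E <= C.
Proof.
move=> f0 fg fC; apply: ge_ereal_sup => _ [X [finX _] <-].
rewrite fsbig_finite//= sumEFin.
have cv := @cvg_sumr _ (finmap.enum_fset (fset_set X)) _ _ fg.
case: C fC => [C||] fC.
- rewrite lee_fin; apply: (ler_cvg_to cv (cvg_cst C)).
  apply: filterS fC => n; rewrite -lee_fin; apply: le_trans.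
  by rewrite -sumEFin -fsbig_finite//; apply: esum_ge; exists X.
- by rewrite leey.
- have [n] := filter_ex fC; rewrite leeNy_eq => /eqP h.
  have : 0 <= \esum_(x in [set: T]) (f n x)%:E by apply: esum_ge0 => x _; rewrite lee_fin.
  by rewrite h.
Qed.

Lemma esum_fin_lt (T : choiceType) (f : T -> R) :
  (forall x, (0 <= f x)%R) -> finite_set [set x | f x != 0%R] ->
  \esum_(x in [set: T]) (f x)%:E < +oo.
Proof.
move=> f0 fin; rewrite (_ : \esum_(x in _) _ = \esum_(x in [set x | f x != 0%R]) (f x)%:E).
  rewrite esum_fset//; last by move=> x _; rewrite lee_fin.
  by rewrite fsbig_finite//= sumEFin ltry.
rewrite [RHS]esum_mkcond; apply: eq_esum => x _.
by case: ifPn => //; rewrite notin_setE /= => /negP /negPn /eqP ->.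
Qed.

Lemma esum_nat_tail (f : nat -> \bar R) (e : R) :
  (forall n, 0 <= f n) -> \esum_(n in [set: nat]) f n < +oo -> (0 < e)%R ->
  exists N, \esum_(n in [set: nat]) (if (n < N)%N then 0 else f n) < e%:E.
Proof.
move=> f0; rewrite -nneseries_esumT// => foo e0.
have /fine_cvgP[ff cv] := nneseries_tail_cvg foo (fun n _ => f0 n).
near \oo => N; exists N.
rewrite -nneseries_esumT; last by move=> n; case: ifP.
rewrite (_ : \sum_(i <oo) _ = \sum_(N <= k <oo) f k); last first.
  rewrite [RHS]ereal_series [RHS]eseries_mkcond; apply: eq_eseriesr => i _.
  by case: ltnP.
rewrite -[X in X < _]fineK; last by near: N.
rewrite lte_fin; near: N.
exact: (cvgr_lt _ cv).
Unshelve. all: by end_near. Qed.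


End Esum.

(** * Binomial coefficients *)

Section Binomial_coefficients.
Context {R : realType}.
Implicit Types s t : R.

(* The coefficient of [z ^+ n] in the expansion of [(1 - z) `^ (- s)]. *)
Definition bcoef s n : R := \prod_(i < n) ((s + i%:R) / i.+1%:R).

Lemma bcoef0 s : bcoef s 0 = 1.
Proof. by rewrite /bcoef big_ord0. Qed.

Lemma bcoefS s n : bcoef s n.+1 = bcoef s n * ((s + n%:R) / n.+1%:R).
Proof. by rewrite /bcoef big_ord_recr. Qed.

Lemma bcoefSr s n : n.+1%:R * bcoef s n.+1 = (s + n%:R) * bcoef s n.
Proof. by rewrite bcoefS mulrCA (mulrC n.+1%:R) divfK ?pnatr_eq0// mulrC. Qed.

Lemma bcoef_gt0 s n : 0 < s -> 0 < bcoef s n.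
Proof.
move=> s0; apply: prodr_gt0 => i _; apply: divr_gt0 => //.
by apply: ltr_wpDr.
Qed.

Lemma bcoef_ge0 s n : 0 <= s -> 0 <= bcoef s n.
Proof.
move=> s0; apply: prodr_ge0 => i _; apply: divr_ge0 => //.
by apply: addr_ge0.
Qed.

Lemma bcoef1 n : bcoef 1 n = 1.
Proof. by elim: n => [|n IH]; rewrite ?bcoef0// bcoefS IH mul1r nat1r divff. Qed.

Lemma bcoef00 n : bcoef 0 n = (n == 0%N)%:R.
Proof.
by case: n => [|n]; rewrite ?bcoef0// /bcoef big_ord_recl add0r mul0r mul0r.
Qed.

Lemma le_bcoef s t n : 0 <= s -> s <= t -> bcoef s n <= bcoef t n.
Proof.
move=> s0 st; apply: ler_prod => i _; apply/andP; split.
  by apply: divr_ge0 => //; apply: addr_ge0.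
by rewrite ler_pM2r ?invr_gt0// lerD2r.
Qed.

(** Chu-Vandermonde, that is [(1 - z)^(-s) (1 - z)^(-t) = (1 - z)^(-s-t)]. Multiplying by
    [n.+1 = k + (n.+1 - k)] is the product rule for the derivative, with [bcoefSr] as the
    differential equation of each factor. *)
Lemma bcoefD s t n :
  \sum_(k < n.+1) bcoef s k * bcoef t (n - k) = bcoef (s + t) n.
Proof.
elim: n => [|n IH]; first by rewrite big_ord1 !bcoef0 mulr1.
apply: (@mulfI _ n.+1%:R); first by rewrite pnatr_eq0.
rewrite bcoefSr -IH !mulr_sumr.
transitivity (\sum_(k < n.+2) ((k%:R * bcoef s k) * bcoef t (n.+1 - k) +
    bcoef s k * ((n.+1 - k)%:R * bcoef t (n.+1 - k)))).
  apply: eq_bigr => k _.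
  have kn : (k <= n.+1)%N by rewrite -ltnS.
  have e : n.+1%:R = k%:R + (n.+1 - k)%:R :> R by rewrite -natrD subnKC.
  by rewrite [X in X * _]e; ring.
rewrite big_split /= big_ord_recl /= mul0r mul0r add0r.
rewrite [X in _ + X]big_ord_recr /= subnn mul0r mulr0 addr0 -big_split /=.
apply: eq_bigr => k _; rewrite /bump /= add1n subSS bcoefSr.
have kn : (k <= n)%N by rewrite -ltnS.
by rewrite subSn// bcoefSr natrB//; ring.
Qed.

Lemma bcoef_sum s n : \sum_(k < n.+1) bcoef s k = bcoef (s + 1) n.
Proof.
by rewrite -bcoefD; apply: eq_bigr => k _; rewrite bcoef1 mulr1.
Qed.

Lemma bcoefD1 s n : bcoef (s + 1) n.+1 - bcoef (s + 1) n = bcoef s n.+1.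
Proof. by rewrite -!bcoef_sum big_ord_recr/= addrAC subrr add0r. Qed.

(** The product with [bcoef (1 + s) n] has factors [1 - s^2 / (i + 1)^2], hence is at most 1, while
    [bcoef (1 + s) n] exceeds [1 + s] times a harmonic sum and diverges. *)
Lemma bcoef_cvg0 s : 0 < s -> s <= 1 -> bcoef (1 - s) n @[n --> \oo] --> 0.
Proof.
move=> s0 s1.
have harm n : 1 + s * series harmonic n <= bcoef (1 + s) n.
  elim: n => [|n IH]; first by rewrite bcoef0 /series/= big_geq// mulr0 addr0.
  rewrite bcoefS seriesSr mulrDr addrA.
  have -> : (1 + s + n%:R) / n.+1%:R = 1 + s * harmonic n :> R.
    rewrite /= addrAC nat1r mulrDl divff ?pnatr_eq0//.
  have h0 : 0 <= s * harmonic n :> R by rewrite mulr_ge0 ?harmonic_ge0// ltW.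
  have h1 : 0 <= s * series harmonic n.
    by rewrite mulr_ge0 ?(ltW s0)//; apply: sumr_ge0 => i _; exact: harmonic_ge0.
  by move: (s * harmonic n) (s * _) h0 h1 IH => x y *; nra.
have prod_le n : bcoef (1 - s) n * bcoef (1 + s) n <= 1.
  rewrite /bcoef -big_split /=; apply: Num.Theory.prodr_ile1 => i _.
  have i0 : 0 <= i%:R :> R by [].
  rewrite mulf_div -natr1; apply/andP; split.
    apply: divr_ge0; nra.
  rewrite ler_pdivrMr; nra.
have harm0 : (fun n => (1 + s * series harmonic n)^-1) @ \oo --> (0 : R).
  have pos : \forall n \near \oo, 0 < 1 + s * series harmonic n.
    apply: nearW => n; rewrite ltr_wpDr// mulr_ge0 ?(ltW s0)//.
    by apply: sumr_ge0 => i _; exact: harmonic_ge0.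
  apply/(gtr0_cvgV0 pos).
  apply/cvgryPge => A.
  have : series (@harmonic R) @ \oo --> +oo.
    apply: nondecreasing_dvgn_lt; last exact: dvg_harmonic.
    by apply: nondecreasing_series => n _ _; exact: harmonic_ge0.
  move=> /cvgryPge /(_ (A / s)); apply: filterS => n.
  by rewrite ler_pdivrMr// mulrC => /le_trans; apply; rewrite lerDr.
apply: (squeeze_cvgr _ (cvg_cst 0) harm0); apply: nearW => n.
have b1 : 0 < bcoef (1 + s) n by apply: bcoef_gt0; rewrite ltr_wpDr ?ltW.
have a0 : 0 <= bcoef (1 - s) n by apply: bcoef_ge0; rewrite subr_ge0.
have h1 : 0 <= s * series harmonic n.
  by rewrite mulr_ge0 ?(ltW s0)//; apply: sumr_ge0 => i _; exact: harmonic_ge0.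
rewrite a0 /= -[leRHS]mul1r ler_pdivlMr ?ltr_wpDr//.
by apply: le_trans (prod_le n); apply: ler_wpM2l.
Qed.

End Binomial_coefficients.

(** * The lazy walk *)

Section Walk.
Context {R : realType} {d : nat}.
Implicit Types (x y : Zd d) (f : Zd d -> R) (n : nat).

(* [adj f / (4 * d)] is the transition operator of the walk on [Zd d] that
   stays put with probability 1/2 and otherwise jumps to a uniform neighbour;
   [lap f = 4 * d * f - adj f]. *)
Definition adj f x : R :=
  \sum_(i < d) (2 * f x + f (x + unitv d i) + f (x - unitv d i)).

Definition walk n : Zd d -> R := iter n adj (ind0 d).

Arguments walk : simpl never.

Definition deg : R := 4 * d%:R.

Fact rw_key : unit. Proof. by []. Qed.

Definition rw n x : R := locked_with rw_key (walk n x / deg ^+ n).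

Lemma rwE n x : rw n x = walk n x / deg ^+ n.
Proof. by rewrite /rw unlock. Qed.

Lemma walkS n x : walk n.+1 x = adj (walk n) x.
Proof. by []. Qed.

Lemma walk_ge0 n x : 0 <= walk n x.
Proof.
elim: n x => [|n IH] x; first by rewrite /walk/= /ind0; case: ifP.
by rewrite walkS; apply: sumr_ge0 => i _; rewrite !addr_ge0// mulr_ge0.
Qed.

Lemma walkN n x : walk n (- x) = walk n x.
Proof.
elim: n x => [|n IH] x; first by rewrite /walk/= /ind0 oppr_eq0.
rewrite !walkS; apply: eq_bigr => i _.
have := IH (x + unitv d i); have := IH (x - unitv d i).
by rewrite !opprD opprK IH => -> ->; rewrite addrAC.
Qed.

Lemma lapE f x : lap d f x = deg * f x - adj f x.
Proof.
rewrite /lap /adj /deg.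
have -> : 4 * d%:R * f x = \sum_(i < d) (4 * f x).
  by rewrite sumr_const card_ord -[RHS]mulr_natl mulrA (mulrC 4).
by rewrite -sumrB; apply: eq_bigr => i _; ring.
Qed.

Lemma finite_walk n : finite_set [set x | walk n x != 0].
Proof.
elim: n => [|n IH].
  apply: (sub_finite_set _ (finite_set1 0)) => x /=.
  by rewrite /walk/= /ind0; case: (x =P 0) => // _ /eqP.
have finB (z : Zd d) : finite_set [set x | walk n (x + z) != 0].
  apply: (sub_finite_set _ (finite_image (fun y => y - z) IH)) => x /= xz.
  by exists (x + z) => //; rewrite addrK.
apply: (@sub_finite_set _ _ ([set x | walk n x != 0] `|`
  \bigcup_(i in [set: 'I_d]) ([set x | walk n (x + unitv d i) != 0] `|`
     [set x | walk n (x - unitv d i) != 0]))); last first.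
  rewrite finite_setU; split=> //; apply: bigcup_finite => //.
  by move=> i _; rewrite finite_setU.
move=> x /=; apply: contraPP => /not_orP[/negP/negPn/eqP x0 xi].
apply/negP/negPn/eqP; rewrite walkS /adj big1// => i _; rewrite x0 mulr0 add0r.
have z0 b : ~ (walk n b != 0) -> walk n b = 0 by move=> /negP/negPn/eqP.
have -> : walk n (x + unitv d i) = 0.
  by apply: z0 => h; apply: xi; exists i; [exact: I|left].
have -> : walk n (x - unitv d i) = 0.
  by apply: z0 => h; apply: xi; exists i; [exact: I|right].
exact: addr0.
Qed.

Lemma rw_ge0 n x : 0 <= rw n x.
Proof. by rewrite rwE divr_ge0 ?walk_ge0// exprn_ge0// mulr_ge0. Qed.

Lemma rwN n x : rw n (- x) = rw n x.
Proof. by rewrite !rwE walkN. Qed.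

Lemma rw0 x : rw 0 x = (x == 0)%:R.
Proof. by rewrite rwE expr0 divr1 /walk /= /ind0; case: eqP. Qed.

Lemma rwS n x : rw n.+1 x = adj (rw n) x / deg.
Proof.
rewrite rwE walkS exprSr invfM mulrA; congr (_ / _).
by rewrite mulr_suml; apply: eq_bigr => i _; rewrite !rwE; ring.
Qed.

Hypothesis d0 : (0 < d)%N.

Lemma deg_gt0 : 0 < deg.
Proof. by rewrite mulr_gt0// ltr0n. Qed.

(** Propagation of any nonnegative solution of the walk recursion. Taking [h = rw] gives the
    semigroup law, and the constant 1 gives conservation of mass. *)
Lemma esum_rw (h : nat -> Zd d -> R) n m x : (forall n x, 0 <= h n x) ->
  (forall n x, h n.+1 x = adj (h n) x / deg) ->
  (\esum_(y in [set: Zd d]) (rw n (x - y) * h m y)%:E = (h (n + m)%N x)%:E)%E.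
Proof.
move=> h0 hS; elim: n x => [|n IH] x.
  rewrite (@esum_eqx _ _ _ x); first by rewrite subrr rw0 eqxx mul1r.
    by move=> y; rewrite rw0 subr_eq0 eq_sym => /negPf ->; rewrite mul0r.
  by rewrite lee_fin mulr_ge0// rw_ge0.
have nn z y : (0 <= (rw n (z - y) * h m y)%:E)%E.
  by rewrite lee_fin mulr_ge0// rw_ge0.
have dg := deg_gt0.
transitivity ((deg^-1)%:E * \esum_(y in [set: Zd d]) \sum_(i < d)
   (2%:E * (rw n (x - y) * h m y)%:E + (rw n (x + unitv d i - y) * h m y)%:E +
     (rw n (x - unitv d i - y) * h m y)%:E))%E.
  rewrite -esumZ.
  - apply: eq_esum => y _; under eq_bigr do rewrite -EFinM -!EFinD.
    rewrite sumEFin -EFinM rwS /adj mulrAC mulrC mulr_suml; congr (_ * _)%:E.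
    apply: eq_bigr => i _; rewrite (addrAC x _ (- y)) (addrAC x _ (- y)).
    by ring.
  - by rewrite invr_ge0 ltW.
  - by move=> y; apply: sume_ge0 => i _; rewrite !adde_ge0// mule_ge0// lee_fin.
rewrite esum_sum; last first.
  by move=> y i _ _; rewrite !adde_ge0// mule_ge0// lee_fin.
rewrite addSn hS mulrC EFinM -sumEFin; congr (_ * _)%E; apply: eq_bigr => i _.
rewrite esumD; last 2 first.
- by move=> y _; rewrite !adde_ge0// mule_ge0// lee_fin.
- by move=> y _; exact: nn.
rewrite esumD; last 2 first.
- by move=> y _; rewrite mule_ge0// lee_fin.
- by move=> y _; exact: nn.
by rewrite esumZ// !IH -EFinM -!EFinD.
Qed.

Lemma rwD n m x :
  (\esum_(y in [set: Zd d]) (rw n (x - y) * rw m y)%:E = (rw (n + m)%N x)%:E)%E.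
Proof. by apply: esum_rw; [exact: rw_ge0 | exact: rwS]. Qed.

Lemma rw_sum1 n x : (\esum_(y in [set: Zd d]) (rw n (x - y))%:E = 1)%E.
Proof.
rewrite -[RHS](@esum_rw (fun _ _ => 1) n 0 x)//.
  by apply: eq_esum => y _; rewrite mulr1.
move=> _ z; rewrite /adj sumr_const card_ord -[X in X / _]mulr_natr /deg.
rewrite (_ : 2 * 1 + 1 + 1 = 4 :> R); last by ring.
by rewrite divff// gt_eqF// deg_gt0.
Qed.

End Walk.

(** * Exponential generating functions and the one-dimensional lazy walk *)

Section Binomial_convolution.
Context {R : realType}.
Implicit Types a b : nat -> R.

(** Product of exponential generating functions: [a] and [b] hold the derivatives at 0 of the
    factors, and [binconvS] is Leibniz' rule. *)
Definition binconv a b n : R := \sum_(k < n.+1) 'C(n, k)%:R * a k * b (n - k)%N.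

Lemma binconvS a b n :
  binconv a b n.+1 = binconv (a \o succn) b n + binconv a (b \o succn) n.
Proof.
rewrite /binconv big_ord_recl /= bin0.
transitivity (1 * a 0%N * b n.+1 + \sum_(i < n.+1)
  ('C(n, i)%:R * a i.+1 * b (n - i)%N + 'C(n, i.+1)%:R * a i.+1 * b (n - i)%N)).
  by congr (_ + _); apply: eq_bigr => i _; rewrite /bump/= add1n binS natrD subSS; ring.
rewrite big_split /= addrCA; congr (_ + _).
rewrite [in LHS]big_ord_recr [in RHS]big_ord_recl /= bin_small// !mul0r addr0 bin0 subn0.
congr (_ + _); apply: eq_bigr => i _; rewrite /bump/= add1n.
by rewrite subnSK.
Qed.

Lemma binconv_ge0 a b n : (forall n, 0 <= a n) -> (forall n, 0 <= b n) ->
  0 <= binconv a b n.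
Proof. by move=> a0 b0; apply: sumr_ge0 => k _; rewrite !mulr_ge0. Qed.

Lemma le_binconv a b a' b' n : (forall n, 0 <= a n) -> (forall n, 0 <= b n) ->
  (forall n, a n <= a' n) -> (forall n, b n <= b' n) ->
  binconv a b n <= binconv a' b' n.
Proof.
move=> a0 b0 aa bb; apply: ler_sum => k _.
by apply: ler_pM => //; [rewrite mulr_ge0|apply: ler_wpM2l].
Qed.

(* [walk1 k z / k!] is the coefficient of [t ^+ k] in the exponential
   generating function of the walk on [Zd 1]. *)
Definition walk1 k (z : int) : R := 'C(k.*2, k + `|z|%N)%:R.

Lemma walk1_ge0 k z : 0 <= walk1 k z.
Proof. by []. Qed.

(** Pascal's rule applied twice, one application per half-step. Positive [z] is treated directly,
    negative [z] by symmetry, and [z = 0] through [C(2k+1, k) = C(2k+1, k+1)]. *)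
Lemma walk1S k z :
  walk1 k.+1 z = 2 * walk1 k z + walk1 k (z + 1) + walk1 k (z - 1).
Proof.
have main m : walk1 k.+1 m.+1%:Z = 2 * walk1 k m.+1%:Z + walk1 k m.+2%:Z + walk1 k m%:Z.
  rewrite /walk1 /= doubleS !addnS !addSn !binS !natrD; ring.
case: z => [[|m]|m].
- rewrite add0r sub0r /walk1 /= doubleS !addn0 addn1 [in LHS]binS.
  rewrite -[X in (_ + X)%N]bin_sub; last by rewrite -addnn leqW// leq_addr.
  have -> : (k.*2.+1 - k = k.+1)%N by rewrite -addnn subSn ?leq_addr// addnK.
  by rewrite binS !natrD; ring.
- by rewrite main -[m.+2]addn1 PoszD -[m.+1 in X in _ = _ + X]addn1 PoszD addrK.
- have e l w : walk1 l (- w) = walk1 l w by rewrite /walk1 abszN.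
  rewrite NegzE e main e.
  have -> : walk1 k (- m.+1%:Z + 1) = walk1 k m%:Z.
    by rewrite -e opprD opprK -[m.+1]addn1 PoszD addrK.
  have -> : walk1 k (- m.+1%:Z - 1) = walk1 k m.+2%:Z.
    by rewrite -e opprD !opprK -PoszD addn1.
  by rewrite addrAC.
Qed.

Lemma walk1_le0 k z : walk1 k z <= walk1 k 0.
Proof.
rewrite /walk1 addn0 ler_nat; elim: `|z|%N => [|m]; first by rewrite addn0.
apply: leq_trans; rewrite addnS.
rewrite -(@leq_pmul2l (k + m).+1)// mul_bin_left leq_mul2r.
apply/orP; right; rewrite -addnn subnDl; apply: leq_trans (leq_subr _ _) _.
by rewrite -addnS leq_addr.
Qed.

End Binomial_convolution.

(** * Factorisation of the walk over coordinates *)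

Section Walk_product.
Context {R : realType} {d : nat}.
Implicit Types (x y : Zd d) (s : seq 'I_d) (n : nat).

Lemma eq_binconv (a b a' b' : nat -> R) n : a =1 a' -> b =1 b' ->
  binconv a b n = binconv a' b' n.
Proof. by move=> aa bb; apply: eq_bigr => k _; rewrite aa bb. Qed.

(* The walk on the coordinates in [s], the other ones being frozen. *)
Fixpoint walks s x : nat -> R :=
  if s is i :: s' then binconv (walk1 ^~ (x 0 i)) (walks s' x)
  else fun n => (n == 0%N)%:R.

Lemma walks_ge0 s x n : 0 <= walks s x n.
Proof.
by elim: s n => [|i s IH] n //=; apply: binconv_ge0 => // k; exact: walk1_ge0.
Qed.

Lemma eq_walks s x y : {in s, forall i, x 0 i = y 0 i} -> walks s x =1 walks s y.
Proof.
elim: s => [|i s IH] //= xy n; apply: eq_binconv => k.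
  by rewrite xy// mem_head.
by apply: IH => j js; apply: xy; rewrite inE js orbT.
Qed.

(** Leibniz' rule for the product of generating functions: each derivative moves one coordinate.
    Uniqueness of the list keeps the other factors unchanged when coordinate [i] moves. *)
Lemma walksS s x n : uniq s -> walks s x n.+1 = \sum_(i <- s)
  (2 * walks s x n + walks s (x + unitv d i) n + walks s (x - unitv d i) n).
Proof.
elim: s n x => [|i s IH] n x /=; first by rewrite big_nil.
move=> /andP[ni us]; rewrite binconvS big_cons; congr (_ + _).
  have e : walks s (x + unitv d i) =1 walks s x.
    apply: eq_walks => j js; rewrite !mxE eqxx /=.
    by case: eqP => [ji|]; rewrite ?addr0//; rewrite -ji js in ni.
  have e' : walks s (x - unitv d i) =1 walks s x.
    apply: eq_walks => j js; rewrite !mxE eqxx /=.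
    by case: eqP => [ji|]; rewrite ?oppr0 ?addr0//; rewrite -ji js in ni.
  rewrite (funext e) (funext e') /binconv mulr_sumr -!big_split.
  apply: eq_bigr => k _ /=; rewrite !mxE !eqxx /= walk1S; ring.
transitivity (binconv (walk1 ^~ (x 0 i)) (fun n => \sum_(j <- s)
    (2 * walks s x n + walks s (x + unitv d j) n + walks s (x - unitv d j) n)) n).
  by apply: eq_binconv => // k /=; rewrite IH.
rewrite [in LHS]/binconv; under [LHS]eq_bigr => k _ do rewrite /= mulr_sumr.
rewrite [LHS]exchange_big /= big_seq [RHS]big_seq; apply: eq_bigr => j js.
have ij : (i == j) = false by apply: contraNF ni => /eqP ->.
have e z : walk1 ^~ ((x + z *: unitv d j) 0 i) =1 @walk1 R ^~ (x 0 i).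
  by move=> k; rewrite !mxE eqxx/= ij mulr0 addr0.
have := e 1; have := e (-1); rewrite scaleN1r scale1r => e1 e2.
rewrite (funext e1) (funext e2).
by rewrite /binconv mulr_sumr -!big_split; apply: eq_bigr => k _ /=; ring.
Qed.

Lemma walks0 s x : walks s x 0 = \prod_(i <- s) (x 0 i == 0)%:R.
Proof.
elim: s => [|i s IH]; first by rewrite big_nil.
rewrite big_cons /= /binconv big_ord1 bin0 mul1r IH; congr (_ * _).
rewrite /walk1 double0 add0n; have [->|x0] := eqVneq; first by [].
by rewrite bin_small// lt0n absz_eq0.
Qed.

Lemma walkE n x : walk n x = walks (index_enum 'I_d) x n.
Proof.
elim: n x => [|n IH] x.
  rewrite walks0 /walk /= /ind0; have [->|x0] := eqVneq.
    by rewrite big1// => i _; rewrite mxE eqxx.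
  have [i xi] : exists i, x 0 i != 0.
    apply/existsP; apply: contraNT x0; rewrite negb_exists => /forallP h.
    by apply/eqP/rowP => i; rewrite mxE; have /negPn/eqP := h i.
  by rewrite (bigD1 i)//= (negPf xi) mul0r.
rewrite walksS; last exact: index_enum_uniq.
by rewrite walkS; apply: eq_bigr => i _; rewrite !IH.
Qed.

Fixpoint walk_return j : nat -> R :=
  if j is j'.+1 then binconv (walk1 ^~ 0) (walk_return j')
  else fun n => (n == 0%N)%:R.

Lemma walks_returnE s n : walks s 0 n = walk_return (size s) n.
Proof.
elim: s n => //= i s IH n; apply: eq_binconv => k; first by rewrite mxE.
exact: IH.
Qed.

Lemma walk_return_ge0 j n : 0 <= walk_return j n.
Proof.
by elim: j n => [|j IH] n //=; apply: binconv_ge0 => // k; exact: walk1_ge0.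
Qed.

Lemma walk_returnE n : walk n (0 : Zd d) = walk_return d n :> R.
Proof. by rewrite walkE walks_returnE -sum1_size sum_nat_const card_ord muln1. Qed.

(** Holds factor by factor, since a central binomial coefficient is the largest of its row. Laziness
    matters: the simple walk cannot return at odd times. *)
Lemma walk_le_return n x : walk n x <= walk n (0 : Zd d) :> R.
Proof.
rewrite !walkE; elim: (index_enum 'I_d) n => //= i s IH n; apply: le_binconv => //.
- by move=> k; exact: walks_ge0.
- by move=> k; rewrite mxE; exact: walk1_le0.
Qed.

End Walk_product.

(** * Two-sided bounds for the number of returns *)

Section Return_bounds.
Context {R : realType}.
Implicit Types (j n k : nat).

Lemma walk1_0S k :
  k.+1%:R * walk1 k.+1 0 = 2 * (2 * k%:R + 1) * walk1 k 0 :> R.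
Proof.
rewrite /walk1 !addn0 doubleS binS -[X in (_ + X)%N]bin_sub; last first.
  by rewrite -addnn leqW// leq_addr.
have -> : (k.*2.+1 - k = k.+1)%N by rewrite -addnn subSn ?leq_addr// addnK.
have e : (k.+1 * 'C(k.*2.+1, k.+1))%:R = (k.*2.+1 * 'C(k.*2, k))%:R :> R.
  by rewrite -mul_bin_diag.
move: e; rewrite !natrM natrD => e.
by rewrite mulrDr e -[k.*2.+1]addn1 natrD -mul2n natrM; ring.
Qed.

(** Non-asymptotic form of [C(2k, k) ~ 4^k / sqrt (pi k)], squared to stay rational, and proved by
    induction from the ratio of consecutive central coefficients. *)
Lemma walk1_bounds k :
  k.+1%:R * walk1 k 0 ^+ 2 <= 16 ^+ k :> R /\
  16 ^+ k <= (4 * k%:R + 1) * walk1 k 0 ^+ 2 :> R.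
Proof.
elim: k => [|k [IHu IHl]].
  have -> : walk1 0 0 = 1 :> R by [].
  by rewrite !expr0 expr1n !mulr1 mulr0 add0r.
have k0 : 0 <= k%:R :> R by [].
have k1 : 0 < k.+1%:R :> R by [].
set c : R := 2 * (2 * k%:R + 1) / k.+1%:R.
have e : walk1 k.+1 0 = c * walk1 k 0 :> R.
  by rewrite /c mulrAC -walk1_0S mulrC mulKf// gt_eqF.
have cu : k.+2%:R * c ^+ 2 <= 16 * k.+1%:R.
  rewrite /c expr_div_n mulrA ler_pdivrMr ?exprn_gt0// -!natr1; nra.
(* The constant in [4 k + 1] is tight for the induction: after clearing denominators it reads [4 (4k
   + 1)(k + 1)^2 + 1 = (4k + 5)(2k + 1)^2]. *)
have cl : 16 * (4 * k%:R + 1) <= (4 * k.+1%:R + 1) * c ^+ 2.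
  rewrite /c expr_div_n mulrA ler_pdivlMr ?exprn_gt0// -!natr1; nra.
have split_sqr a : a * walk1 k.+1 0 ^+ 2 = a * c ^+ 2 * walk1 k 0 ^+ 2 :> R.
  by rewrite e exprMn mulrA.
rewrite !split_sqr [16 ^+ k.+1]exprS; split.
  apply: (@le_trans _ _ (16 * k.+1%:R * walk1 k 0 ^+ 2)).
    by rewrite ler_wpM2r ?sqr_ge0.
  by rewrite -mulrA ler_wpM2l.
apply: (@le_trans _ _ (16 * (4 * k%:R + 1) * walk1 k 0 ^+ 2)).
  by rewrite -mulrA ler_wpM2l.
by rewrite ler_wpM2r ?sqr_ge0.
Qed.

(** Cauchy-Schwarz without square roots: only [x^2 <= y z] is assumed termwise, which is the form of
    the upper bound on squared central coefficients. *)
Lemma sqr_sum_le (I : Type) (s : seq I) (x y z : I -> R) :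
  (forall i, 0 <= x i) -> (forall i, 0 <= y i) -> (forall i, 0 <= z i) ->
  (forall i, x i ^+ 2 <= y i * z i) ->
  (\sum_(i <- s) x i) ^+ 2 <= (\sum_(i <- s) y i) * (\sum_(i <- s) z i).
Proof.
move=> x0 y0 z0 xyz; elim: s => [|i s IH].
  by rewrite !big_nil expr0n mul0r.
rewrite !big_cons.
have X0 : 0 <= \sum_(j <- s) x j by apply: sumr_ge0.
have Y0 : 0 <= \sum_(j <- s) y j by apply: sumr_ge0.
have Z0 : 0 <= \sum_(j <- s) z j by apply: sumr_ge0.
move: (\sum_(j <- s) x j) (\sum_(j <- s) y j) (\sum_(j <- s) z j) X0 Y0 Z0 IH.
move: (x i) (y i) (z i) (x0 i) (y0 i) (z0 i) (xyz i).
move=> a b c a0 b0 c0 abc X Y Z X0 Y0 Z0 XYZ.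
have : 2 * (a * X) <= b * Z + Y * c.
  rewrite -ler_sqr ?nnegrE; last 2 first.
  - by rewrite !mulr_ge0.
  - by rewrite addr_ge0// mulr_ge0.
  apply: (@le_trans _ _ (4 * (b * c * (Y * Z)))).
    rewrite (_ : (2 * (a * X)) ^+ 2 = 4 * (a ^+ 2 * X ^+ 2)); last by ring.
    by rewrite ler_wpM2l// ler_pM// sqr_ge0.
  rewrite -subr_ge0 (_ : _ - _ = (b * Z - Y * c) ^+ 2) ?sqr_ge0//; ring.
nra.
Qed.

(* [return_ub j n] bounds the expectation of [\prod_i (N_i + 1)^-1] for a
   multinomial vector [(N_1, ..., N_j)], up to normalisation. *)
Fixpoint return_ub j : nat -> R :=
  if j is j'.+1 then binconv (fun k => k.+1%:R^-1) (return_ub j')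
  else fun n => (n == 0%N)%:R.

Lemma return_ub_ge0 j n : 0 <= return_ub j n.
Proof. by elim: j n => [|j IH] n //=; apply: binconv_ge0. Qed.

(** Since [C(n, k) / (k + 1)] times [(n - k)! / (n - k + j)!] equals [C(n + 1 + j, k + 1)] up to the
    factor [n! / (n + 1 + j)!], the inductive sum is part of the binomial expansion of
    [(j + 1)^(n + 1 + j)]. *)
Lemma return_ub_le j n :
  return_ub j n <= j%:R ^+ (n + j) * n`!%:R / (n + j)`!%:R.
Proof.
elim: j n => [|j IH] n.
  rewrite /= addn0 mulfK ?pnatr_eq0 ?lt0n_neq0 ?fact_gt0//.
  by case: n => [|n]; rewrite ?expr0 ?exprS ?mul0r.
apply: (@le_trans _ _ (\sum_(k < n.+1) 'C(n, k)%:R * k.+1%:R^-1 *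
    (j%:R ^+ (n - k + j) * (n - k)`!%:R / (n - k + j)`!%:R))).
  by apply: ler_sum => k _; apply: ler_wpM2l => //; rewrite mulr_ge0.
have f0 m : m`!%:R != 0 :> R by rewrite pnatr_eq0 -lt0n fact_gt0.
rewrite ler_pdivlMr ?ltr0n ?fact_gt0//.
rewrite -natr1 exprDn -addSnnS [in leRHS]big_ord_recl [in leRHS]big_split_ord /=.
rewrite mulr_suml !mulrDl.
have term0 i : 0 <= j%:R ^+ (n.+1 + j - i) * 1 ^+ i *+ 'C(n.+1 + j, i) :> R.
  by rewrite mulrn_wge0// expr1n mulr1 exprn_ge0.
(* The terms of index 0 and of index above [n + 1] in that expansion are nonnegative and dropped. *)
rewrite addrCA -[leLHS]addr0; apply: lerD; last first.
  by rewrite addr_ge0// mulr_ge0// sumr_ge0.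
rewrite mulr_suml; apply: ler_sum => k _; rewrite /bump /= add1n.
have kn : (k <= n)%N by rewrite -ltnS.
have kN : (k.+1 <= n.+1 + j)%N by rewrite addSn ltnS (leq_trans kn)// leq_addr.
have Nk : (n.+1 + j - k.+1 = n - k + j)%N by rewrite addSn subSS addnBAC.
have e1 : (n.+1 + j)`!%:R = 'C(n.+1 + j, k.+1)%:R *
    (k.+1%:R * k`!%:R * (n - k + j)`!%:R) :> R.
  by rewrite -(bin_fact kN) Nk factS !natrM.
have e2 : n`!%:R = 'C(n, k)%:R * (k`!%:R * (n - k)`!%:R) :> R.
  by rewrite -(bin_fact kn) !natrM.
rewrite Nk expr1n mulr1 -mulr_natr e1 e2.
have := f0 (n - k + j)%N; move: ((n - k + j)`!%:R) => F F0.
have : k.+1%:R != 0 :> R by rewrite pnatr_eq0.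
move: k.+1%:R => K K0.
rewrite le_eqVlt; apply/orP; left; apply/eqP; field.
by rewrite F0 K0.
Qed.

(** Cauchy-Schwarz against the multinomial weights [C(n, k) j^(n - k)], which sum to [(j + 1)^n];
    the squared coefficients contribute [16^n] and the factors [1 / (k + 1)] collected in
    [return_ub]. *)
Lemma walk_return_ub j n :
  walk_return j n ^+ 2 <= 16 ^+ n * j%:R ^+ n * return_ub j n.
Proof.
elim: j n => [|j IH] n.
  by case: n => [|n] /=; rewrite ?expr0 ?mul1r ?expr1n// expr0n mulr0.
apply: le_trans (@sqr_sum_le _ _ _
  (fun k : 'I_n.+1 => 'C(n, k)%:R * j%:R ^+ (n - k))
  (fun k : 'I_n.+1 => 'C(n, k)%:R * (16 ^+ n * (k.+1%:R^-1 * return_ub j (n - k)))) _ _ _ _) _.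
- by move=> k; rewrite !mulr_ge0 ?walk1_ge0 ?walk_return_ge0.
- by move=> k; rewrite mulr_ge0.
- by move=> k; rewrite !mulr_ge0 ?invr_ge0 ?return_ub_ge0.
- move=> k.
  have kn : (k <= n)%N by rewrite -ltnS.
  have [w1 _] := walk1_bounds k.
  have {}w1 : walk1 k 0 ^+ 2 <= 16 ^+ k / k.+1%:R :> R by rewrite ler_pdivlMr// mulrC.
  rewrite /= !exprMn [leRHS](_ : _ = 'C(n, k)%:R ^+ 2 * (16 ^+ k / k.+1%:R) *
     (16 ^+ (n - k) * j%:R ^+ (n - k) * return_ub j (n - k))).
    apply: ler_pM (IH _); [by rewrite mulr_ge0 ?sqr_ge0|exact: sqr_ge0|].
    by rewrite ler_wpM2l ?sqr_ge0.
  have -> : 16 ^+ n = 16 ^+ k * 16 ^+ (n - k) :> R by rewrite -exprD subnKC.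
  by ring.
rewrite le_eqVlt; apply/orP; left; apply/eqP.
have -> : j.+1%:R ^+ n = \sum_(k < n.+1) 'C(n, k)%:R * j%:R ^+ (n - k) :> R.
  rewrite -natr1 exprDn; apply: eq_bigr => k _.
  by rewrite expr1n mulr1 mulr_natl.
rewrite mulrAC mulrC; congr (_ * _); rewrite /= /binconv mulr_sumr.
by apply: eq_bigr => k _; ring.
Qed.

(** For [k <= n] each central coefficient is at least [4^k / (2 sqrt (n + 1))]. With this uniform
    bound the convolution sums exactly, by the binomial theorem. *)
Lemma walk_return_lb j n :
  (4 * j%:R) ^+ n <= walk_return j n * (2 * Num.sqrt n.+1%:R) ^+ j :> R.
Proof.
elim: j n => [|j IH] n.
  by rewrite mulr0 expr0 mulr1 /=; case: n => [|n]; rewrite ?expr0// exprS mul0r.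
rewrite /= /binconv mulr_suml -[j.+1]addn1 natrD mulrDr exprDn.
apply: ler_sum => k _.
have kn : (k <= n)%N by rewrite -ltnS.
have [_ w1] := walk1_bounds k.
rewrite addn1 exprS.
have {}w1 : 4 ^+ k <= walk1 k 0 * (2 * Num.sqrt n.+1%:R) :> R.
  rewrite -ler_sqr ?nnegrE; last 2 first.
  - by rewrite exprn_ge0.
  - by rewrite !mulr_ge0 ?walk1_ge0 ?sqrtr_ge0.
  rewrite !exprMn sqr_sqrtr// -exprM mulnC exprM.
  apply: le_trans (_ : _ <= (4 * k%:R + 1) * walk1 k 0 ^+ 2) _.
    by apply: le_trans w1; rewrite (_ : 4 ^+ 2 = 16)//; ring.
  rewrite mulrC ler_wpM2l ?sqr_ge0//.
  have : k%:R <= n%:R :> R by rewrite ler_nat.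
  by rewrite -natr1; lra.
have {}IH : (4 * j%:R) ^+ (n - k) <=
    walk_return j (n - k) * (2 * Num.sqrt n.+1%:R) ^+ j :> R.
  apply: le_trans (IH _) _; rewrite ler_wpM2l ?walk_return_ge0//.
  rewrite lerXn2r ?nnegrE ?mulr_ge0 ?sqrtr_ge0// ler_wpM2l// ler_sqrt//.
  by rewrite ler_nat ltnS leq_subr.
rewrite mulr1 -mulr_natl [leRHS](_ : _ = 'C(n, k)%:R *
  ((walk_return j (n - k) * (2 * Num.sqrt n.+1%:R) ^+ j) *
   (walk1 k 0 * (2 * Num.sqrt n.+1%:R)))); last by ring.
by apply: ler_wpM2l => //; apply: ler_pM; rewrite ?exprn_ge0 ?mulr_ge0.
Qed.

End Return_bounds.

(** * Return probabilities *)

Section Return_asymptotics.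
Context {R : realType}.

(** Raabe's test: the assumption says [del * x n <= n x n - (n + 1) x (n + 1)], whose right side
    telescopes. *)
Lemma raabe (x : nat -> R) (del : R) N : (forall n, 0 <= x n) -> 0 < del ->
  (forall n, (N <= n)%N -> n.+1%:R * x n.+1 <= (n%:R - del) * x n) ->
  (\esum_(n in [set: nat]) (x n)%:E < +oo)%E.
Proof.
move=> x0 del0 xS.
have partial m : del * (\sum_(0 <= k < m) x (N + k)%N) + (N + m)%:R * x (N + m)%N
    <= N%:R * x N.
  elim: m => [|m IH]; first by rewrite big_geq// mulr0 add0r addn0.
  rewrite big_nat_recr//= addnS; apply: le_trans IH.
  by have := xS (N + m)%N (leq_addr _ _); lra.
rewrite -nneseries_esumT; last by move=> n; rewrite lee_fin.
rewrite (@nneseries_split _ _ 0 N); last by move=> k _; rewrite lee_fin.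
rewrite add0n sumEFin; apply: lte_add_pinfty; first exact: ltry.
apply: (@le_lt_trans _ _ (N%:R * x N / del)%:E); last exact: ltry.
rewrite -[X in (X <= _)%E](nneseries_addn (f := fun n => (x n)%:E)); last first.
  by move=> k; rewrite lee_fin.
apply: lime_le; first by apply: is_cvg_nneseries => k _ _; rewrite lee_fin.
apply: nearW => m; rewrite sumEFin lee_fin ler_pdivlMr// mulrC.
apply: le_trans (partial m); under eq_bigr do rewrite addnC.
by rewrite lerDl mulr_ge0.
Qed.

Variable d : nat.
Hypothesis d0 : (0 < d)%N.

(** Model of order [n^(-d)] for the squared return probability. Its ratio is explicit, so Raabe's
    test applies to it, whereas the bounds on [rw] say nothing about ratios. *)
Let y n : R := n`!%:R / (n + d)`!%:R.

Let y_gt0 n : 0 < y n.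
Proof. by rewrite divr_gt0 ?ltr0n ?fact_gt0. Qed.

Let yS n : y n.+1 = y n * (n.+1%:R / (n.+1%:R + d%:R)).
Proof.
rewrite /y addSn !factS !natrM -natrD addSn.
have : (n + d)`!%:R != 0 :> R by rewrite pnatr_eq0 -lt0n fact_gt0.
have : (n + d).+1%:R != 0 :> R by rewrite pnatr_eq0.
move: (n`!%:R) ((n + d)`!%:R) ((n + d).+1%:R) => a b c c0 b0.
by field; rewrite b0 c0.
Qed.

Lemma rw_return_ub n : rw n (0 : Zd d) ^+ 2 <= d%:R ^+ d * y n.
Proof.
rewrite rwE walk_returnE expr_div_n ler_pdivrMr ?exprn_gt0 ?deg_gt0//.
apply: le_trans (walk_return_ub d n) _.
apply: (@le_trans _ _ (16 ^+ n * d%:R ^+ n * (d%:R ^+ (n + d) * n`!%:R / (n + d)`!%:R))).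
  by apply: ler_wpM2l; [rewrite mulr_ge0|exact: return_ub_le].
rewrite /deg /y exprAC (_ : (4 * d%:R) ^+ 2 = 16 * (d%:R * d%:R) :> R); last by ring.
rewrite !exprMn exprD le_eqVlt; apply/orP; left; apply/eqP; ring.
Qed.

Lemma rw_return_lb n : y n <= 4 ^+ d * rw n (0 : Zd d) ^+ 2.
Proof.
rewrite rwE walk_returnE expr_div_n mulrA ler_pdivlMr ?exprn_gt0 ?deg_gt0//.
have lb := walk_return_lb (R := R) d n.
have {lb} : ((4 * d%:R) ^+ n) ^+ 2 <= walk_return d n ^+ 2 * 4 ^+ d * n.+1%:R ^+ d :> R.
  apply: (@le_trans _ _ ((walk_return d n * (2 * Num.sqrt n.+1%:R) ^+ d) ^+ 2)).
    by rewrite lerXn2r// nnegrE ?exprn_ge0 ?mulr_ge0 ?walk_return_ge0 ?exprn_ge0 ?mulr_ge0 ?sqrtr_ge0.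
  rewrite exprMn [X in _ * X]exprAC [(2 * _) ^+ 2]exprMn sqr_sqrtr// exprMn mulrA.
  by rewrite (_ : 2 ^+ 2 = 4 :> R)//; ring.
rewrite -/deg => lb.
have n1y : n.+1%:R ^+ d * y n <= 1.
  rewrite /y mulrA ler_pdivrMr ?ltr0n ?fact_gt0// mul1r -natrX -natrM ler_nat.
  elim: (d) => [|e IH]; first by rewrite expn0 mul1n addn0.
  rewrite addnS factS expnS -mulnA; apply: leq_mul => //.
  by rewrite ltnS leq_addr.
apply: (@le_trans _ _ (y n * (walk_return d n ^+ 2 * 4 ^+ d * n.+1%:R ^+ d))).
  exact: ler_wpM2l (ltW (y_gt0 n)) _ _ lb.
rewrite (_ : y n * _ = 4 ^+ d * walk_return d n ^+ 2 * (n.+1%:R ^+ d * y n)); last first.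
  by move: (y n) => yn; ring.
by rewrite ler_piMr// mulr_ge0 ?sqr_ge0// exprn_ge0.
Qed.

Let z n := Num.sqrt (y n).

Let z_ge0 n : 0 <= z n. Proof. exact: sqrtr_ge0. Qed.

Let zS n : z n.+1 ^+ 2 * (n.+1%:R + d%:R) = z n ^+ 2 * n.+1%:R.
Proof.
rewrite !sqr_sqrtr ?ltW// yS -!mulrA mulVf ?mulr1// gt_eqF//.
Qed.

Lemma rw_le_return n (x : Zd d) : rw n x <= rw n (0 : Zd d) :> R.
Proof.
by rewrite !rwE ler_pM2r ?walk_le_return// invr_gt0 exprn_gt0// deg_gt0.
Qed.

Lemma esum_bcoef_rw_lty (s : R) (x : Zd d) : 0 < s -> s < d%:R / 2 ->
  (\esum_(n in [set: nat]) (bcoef s n * rw n x)%:E < +oo)%E.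
Proof.
move=> s0 sd.
(* For [x n = bcoef s n * z n] the quotient [(n + 1) x (n + 1) / x n] is [n - (d / 2 - s) + o(1)];
   half of this gap serves as margin in Raabe's test. *)
pose del := (d%:R / 2 - s) / 2.
have del0 : 0 < del by rewrite divr_gt0// subr_gt0.
have dE : d%:R = 2 * s + 4 * del by rewrite /del; field.
have C0 : 0 <= Num.sqrt (d%:R ^+ d) :> R by exact: sqrtr_ge0.
apply: (@le_lt_trans _ _ (\esum_(n in [set: nat])
    ((Num.sqrt (d%:R ^+ d))%:E * (bcoef s n * z n)%:E))%E).
  apply: le_esum => n _; rewrite -EFinM lee_fin [leRHS]mulrCA.
  apply: ler_wpM2l; first exact/bcoef_ge0/ltW.
  apply: le_trans (rw_le_return _ _) _.
  rewrite -sqrtrM ?exprn_ge0// -[leLHS]ger0_norm ?rw_ge0// -sqrtr_sqr.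
  by apply: ler_wsqrtr; exact: rw_return_ub.
rewrite esumZ//; last by move=> n; rewrite lee_fin mulr_ge0// bcoef_ge0// ltW.
apply: lte_mul_pinfty; rewrite ?lee_fin//.
(* Threshold beyond which the squared Raabe inequality, cubic in [n], holds. The quotient lets the
   leading gap [2 del n^2] beat the linear terms; the doubled [s^2] also absorbs the constant [s^2],
   as [n >= 1]; and [del <= n] permits squaring. *)
pose M := 1 + del + (2 * s ^+ 2 + 2 * s + 2 * del * (1 + d%:R)) / (2 * del).
apply: (@raabe _ del (Num.truncn M).+1) => //.
  by move=> n; rewrite mulr_ge0// bcoef_ge0// ltW.
move=> n Mn; rewrite mulrA bcoefSr mulrAC mulrC [leRHS]mulrCA.
apply: ler_wpM2l; first exact/bcoef_ge0/ltW.
have {Mn}Mn : M <= n%:R.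
  by apply: ltW; apply: lt_le_trans (truncnS_gt _) _; rewrite ler_nat.
have q0 : 0 <= (2 * s ^+ 2 + 2 * s + 2 * del * (1 + d%:R)) / (2 * del).
  have : 0 <= d%:R :> R by []. move=> dd.
  by apply: divr_ge0; nra.
have n1 : 1 <= n%:R :> R by move: Mn; rewrite /M; lra.
have ndel : del <= n%:R by move: Mn; rewrite /M; lra.
have nq : 2 * s ^+ 2 + 2 * s + 2 * del * (1 + d%:R) <= n%:R * (2 * del).
  by rewrite -ler_pdivrMr ?mulr_gt0//; move: Mn; rewrite /M; lra.
rewrite -ler_sqr ?nnegrE; last 2 first.
- by rewrite mulr_ge0// addr_ge0// ltW.
- by rewrite mulr_ge0// subr_ge0.
rewrite !exprMn -(@ler_pM2r _ (n.+1%:R + d%:R)); last by rewrite ltr_pwDl.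
rewrite -mulrA zS; move: (z n ^+ 2) (sqr_ge0 (z n)) => p p0.
rewrite -natr1; move: (n%:R) n1 ndel nq => t n1 ndel nq.
rewrite dE in nq *; rewrite (_ : _ * (p * _) = p * ((s + t) ^+ 2 * (t + 1))); last by ring.
rewrite [leRHS](_ : _ = p * ((t - del) ^+ 2 * (t + 1 + (2 * s + 4 * del)))); last by ring.
apply: ler_wpM2l => //.
have h1 : 0 <= (t - 1) * s ^+ 2 by rewrite mulr_ge0 ?sqr_ge0// subr_ge0.
have h2 : 0 <= t * (t * (2 * del) - (2 * s ^+ 2 + 2 * s + 2 * del * (1 + (2 * s + 4 * del)))).
  by rewrite mulr_ge0 ?subr_ge0//; lra.
have h3 : 0 <= t * s ^+ 2 by rewrite mulr_ge0 ?sqr_ge0//; lra.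
have h4 : 0 <= t * del ^+ 2 by rewrite mulr_ge0 ?sqr_ge0//; lra.
have h5 : 0 <= del ^+ 2 * (1 + (2 * s + 4 * del)) by rewrite mulr_ge0 ?sqr_ge0//; lra.
nra.
Qed.

(** By monotonicity in [s] only the borderline [s = d / 2] matters. There [n] times the model term
    is nondecreasing, so the series dominates a multiple of the harmonic one. *)
Lemma esum_bcoef_rw_y (s : R) : d%:R / 2 <= s ->
  (\esum_(n in [set: nat]) (bcoef s n * rw n (0 : Zd d))%:E = +oo)%E.
Proof.
move=> sd.
have dd : 0 < d%:R / 2 :> R by rewrite divr_gt0// ltr0n.
have nn (t : R) n : 0 < t -> (0 <= (bcoef t n * rw n (0 : Zd d))%:E)%E.
  by move=> t0; rewrite lee_fin mulr_ge0 ?rw_ge0// bcoef_ge0// ltW.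
apply/eqP; rewrite -leye_eq; apply: (@le_trans _ _ (\esum_(n in [set: nat])
    (bcoef (d%:R / 2) n * rw n (0 : Zd d))%:E)); last first.
  apply: le_esum => n _; rewrite lee_fin ler_wpM2r ?rw_ge0//.
  by apply: le_bcoef => //; exact: ltW.
rewrite leye_eq; apply/eqP.
pose x n := bcoef (d%:R / 2) n * z n.
have x0 n : 0 <= x n by rewrite mulr_ge0// bcoef_ge0// ltW.
have x1 : 0 < x 1%N by rewrite mulr_gt0 ?bcoef_gt0// sqrtr_gt0.
have xmono n : x 1%N <= n.+1%:R * x n.+1.
  elim: n => [|n IH]; first by rewrite mul1r.
  apply: (le_trans IH); rewrite /x [leRHS]mulrA bcoefSr mulrCA -[leRHS]mulrA.
  rewrite [leRHS]mulrCA; apply: ler_wpM2l; first exact/bcoef_ge0/ltW.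
  rewrite -ler_sqr ?nnegrE ?mulr_ge0 ?addr_ge0 ?(ltW dd)//.
  rewrite !exprMn -(@ler_pM2r _ (n.+2%:R + d%:R)); last by rewrite ltr_pwDl.
  rewrite -[leRHS]mulrA zS -[n.+2%:R]natr1.
  move: (z n.+1 ^+ 2) (sqr_ge0 (z n.+1)) => p p0.
  have : 0 <= n.+1%:R :> R by [].
  have : 0 <= d%:R :> R by [].
  move: (n.+1%:R) (d%:R) => t D D0 t0.
  rewrite -subr_ge0 [leRHS](_ : _ = p * (t * (D + D ^+ 2 / 4) + D ^+ 2 / 4)); last by field.
  by apply: mulr_ge0 => //; nra.
apply/eqP; rewrite -leye_eq leNgt; apply/negP => fin.
(* [x 1] bounds [n * x n] from below, and [2 ^+ d] is the square root of the constant in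
   [rw_return_lb]. *)
pose c : R := x 1%N / 2 ^+ d.
have c0 : 0 < c by rewrite divr_gt0// exprn_gt0.
have harm N : ((c * series harmonic N)%:E <=
    \esum_(n in [set: nat]) (bcoef (d%:R / 2) n * rw n (0 : Zd d))%:E)%E.
  rewrite -nneseries_esumT; last by move=> n; exact: nn.
  apply: le_trans (nneseries_lim_ge N.+1 _); last by move=> k _ _; exact: nn.
  rewrite sumEFin lee_fin big_nat_recl//= ler_wpDl ?mulr_ge0 ?rw_ge0 ?bcoef_ge0 ?(ltW dd)//.
  rewrite /series /= mulr_sumr; apply: ler_sum => n _.
  apply: (@le_trans _ _ (x n.+1 / 2 ^+ d)).
    by rewrite /c mulrAC ler_wpM2r ?invr_ge0 ?exprn_ge0// ler_pdivrMr// mulrC.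
  rewrite /x -mulrA ler_wpM2l ?(bcoef_ge0 _ (ltW dd))// ler_pdivrMr ?exprn_gt0//.
  rewrite -ler_sqr ?nnegrE ?mulr_ge0 ?rw_ge0 ?exprn_ge0//.
  rewrite sqr_sqrtr ?(ltW (y_gt0 _))// exprMn exprAC (_ : 2 ^+ 2 = 4 :> R); last by ring.
  by rewrite mulrC; exact: rw_return_lb.
have hoo : series (@harmonic R) @ \oo --> +oo.
  apply: nondecreasing_dvgn_lt; last exact: dvg_harmonic.
  by apply: nondecreasing_series => n _ _; exact: harmonic_ge0.
move: fin harm; set S := (\esum_(n in _) _)%E => fin harm.
have S0 : (0 <= S)%E by apply: esum_ge0 => n _; exact: nn.
move: hoo => /cvgryPge /(_ ((fine S + 1) / c)) [N _ /(_ N (leqnn _)) /=].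
rewrite ler_pdivrMr// mulrC => h.
have := harm N; rewrite -(@fineK _ S) ?ge0_fin_numE// lee_fin; lra.
Qed.

End Return_asymptotics.

(** * The Gamma function *)

Section Gamma_function.
Context {R : realType}.
Notation mu := (@lebesgue_measure R).
Implicit Types (s c t a b : R).

Let pos_seq n : set R := `[n.+1%:R^-1, n.+1%:R]%classic.

Lemma pos_bigcup : \bigcup_n pos_seq n = `]0, +oo[%classic.
Proof.
apply/seteqP; split => [t [n _]|t]; rewrite /pos_seq /= !in_itv/= andbT.
  by move=> /andP[+ _]; apply: lt_le_trans; rewrite invr_gt0.
move=> t0; pose n := maxn (Num.truncn t) (Num.truncn t^-1).
exists n => //; rewrite /pos_seq/= in_itv/=.
have tn : t <= n.+1%:R.
  apply: ltW; apply: lt_le_trans (truncnS_gt _) _.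
  by rewrite ler_nat ltnS leq_maxl.
have tn' : t^-1 <= n.+1%:R.
  apply: ltW; apply: lt_le_trans (truncnS_gt _) _.
  by rewrite ler_nat ltnS leq_maxr.
by rewrite tn andbT invf_ple// posrE.
Qed.

Lemma cvg_integral_pos (f : R -> R) : measurable_fun setT f ->
  (forall t, 0 < t -> 0 <= f t) ->
  (\int[mu]_(t in pos_seq n) (f t)%:E @[n --> \oo] -->
   \int[mu]_(t in `]0%R, +oo[) (f t)%:E)%E.
Proof.
move=> mf f0; rewrite -pos_bigcup.
apply: ge0_nondecreasing_set_cvg_integral => //.
- apply/nondecreasing_seqP => n; rewrite subsetEset => t.
  rewrite /pos_seq /= !in_itv/= => /andP[h1 h2]; apply/andP; split.
    by apply: le_trans h1; rewrite lef_pV2 ?posrE// ler_nat.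
  by apply: le_trans h2 _; rewrite ler_nat.
- by move=> n; exact: measurable_itv.
- by move=> n; apply/measurable_EFinP; exact: measurable_funTS.
- move=> n t; rewrite /pos_seq/= in_itv/= => /andP[h _]; rewrite lee_fin f0//.
  by apply: lt_le_trans h; rewrite invr_gt0.
Qed.

Let integrand s c t : R := t `^ (s - 1) * expR (- (c * t)).

(** Euler's integral with a rate [c], kept because the heat kernel contributes the factor
    [expR (- (deg * t))]. *)
Definition gamma_int s c : \bar R :=
  (\int[mu]_(t in `]0%R, +oo[) (integrand s c t)%:E)%E.

Lemma integrand_ge0 s c t : 0 <= integrand s c t.
Proof. by rewrite mulr_ge0 ?powR_ge0 ?expR_ge0. Qed.

Lemma measurable_gamma_integrand s c :
  measurable_fun [set: R] (fun t => t `^ (s - 1) * expR (- (c * t))).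
Proof.
apply: measurable_funM; first exact: measurable_powR.
apply: measurableT_comp; first exact: measurable_expR.
by apply: measurableT_comp => //; exact: measurable_funM.
Qed.

Lemma cvg_gamma s c :
  (\int[mu]_(t in pos_seq n) (integrand s c t)%:E @[n --> \oo] -->
   gamma_int s c)%E.
Proof.
apply: cvg_integral_pos => [|t _]; last exact: integrand_ge0.
exact: measurable_gamma_integrand.
Qed.

Lemma is_derive_expRc c t : is_derive t 1 (fun t => expR (- (c * t))) (- c * expR (- (c * t))).
Proof.
have h : is_derive t 1 (fun t => - (c * t)) (- c).
  have -> : (fun t : R => - (c * t)) = (- c) \*: id.
    by apply/funext => u; rewrite /= -mulNr.
  by apply: is_derive_eq; rewrite /GRing.scale/= mulr1.
have := @is_derive1_comp _ expR (fun t => - (c * t)) t _ _ _ h.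
by move=> /(_ _ (is_derive_expR _)); rewrite mulrC; exact.
Qed.

Lemma oo_LR (F f : R -> R) a b : (forall t, 0 < t -> is_derive t 1 F (f t)) ->
  0 < a -> a < b -> derivable_oo_LRcontinuous F a b.
Proof.
move=> dF a0 ab; have cF t : 0 < t -> {for t, continuous F}.
  move=> t0; apply: differentiable_continuous; apply/derivable1_diffP.
  by apply: ex_derive; exact: dF.
split.
- move=> t; rewrite in_itv/= => /andP[at_ _].
  by apply: ex_derive; apply: dF; exact: lt_trans at_.
- exact/cvg_at_right_filter/cF.
- by apply/cvg_at_left_filter/cF; exact: lt_trans ab.
Qed.

Lemma within_cont (f : R -> R) a b : (forall t, 0 < t -> {for t, continuous f}) ->
  0 < a -> {within `[a, b], continuous f}.
Proof.
move=> cf a0; apply: continuous_in_subspaceT => t; rewrite inE/= in_itv/= => /andP[h _].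
by apply: cf; exact: lt_le_trans h.
Qed.

Lemma cont_expRc c t : {for t, continuous (fun t => expR (- (c * t)))}.
Proof.
apply: differentiable_continuous; apply/derivable1_diffP.
by apply: ex_derive; exact: is_derive_expRc.
Qed.

Lemma cont_powR s t : 0 < t -> {for t, continuous (fun t : R => t `^ s)}.
Proof.
move=> t0; apply: differentiable_continuous; apply/derivable1_diffP.
by apply: ex_derive; exact: is_derive1_powR.
Qed.

Lemma gamma_parts s c a b : 0 < s -> 0 < c -> 0 < a -> a < b ->
  (c%:E * \int[mu]_(t in `[a, b]) (integrand (s + 1) c t)%:E +
     (b `^ s * expR (- (c * b)))%:E =
   s%:E * \int[mu]_(t in `[a, b]) (integrand s c t)%:E +
     (a `^ s * expR (- (c * a)))%:E)%E.
Proof.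
move=> s0 c0 a0 ab.
have dP t : 0 < t -> is_derive t 1 (fun t : R => t `^ s) (s * t `^ (s - 1)).
  by move=> t0; exact: is_derive1_powR.
have dE t : 0 < t -> is_derive t 1 (fun t : R => - expR (- (c * t))) (c * expR (- (c * t))).
  move=> _; have := is_deriveN (is_derive_expRc c t).
  by rewrite mulNr opprK.
have parts := @integration_by_parts R (fun t => t `^ s) (fun t => - expR (- (c * t)))
  (fun t => s * t `^ (s - 1)) (fun t => c * expR (- (c * t))) a b ab.
have {parts} := parts _ _ _ _ _ _.
have -> : (\int[mu]_(x in `[a, b]) (x `^ s * (c * expR (- (c * x))))%:E =
    c%:E * \int[mu]_(t in `[a, b]) (integrand (s + 1) c t)%:E)%E.
  rewrite -ge0_integralZl_EFin ?(ltW c0)//; last 2 first.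
  - by move=> t _; rewrite lee_fin integrand_ge0.
  - by apply/measurable_EFinP/measurable_funTS; exact: measurable_gamma_integrand.
  by apply: eq_integral => t _; rewrite -EFinM /integrand addrK mulrCA.
have -> : (\int[mu]_(x in `[a, b]) (s * x `^ (s - 1) * - expR (- (c * x)))%:E =
    - (s%:E * \int[mu]_(t in `[a, b]) (integrand s c t)%:E))%E.
  rewrite -ge0_integralZl_EFin ?(ltW s0)//; last 2 first.
  - by move=> t _; rewrite lee_fin integrand_ge0.
  - by apply/measurable_EFinP/measurable_funTS; exact: measurable_gamma_integrand.
  rewrite -integral_ge0N; last first.
    by move=> t _; rewrite -EFinM lee_fin mulr_ge0 ?(ltW s0)// integrand_ge0.
  by apply: eq_integral => t _; rewrite -EFinM -EFinN /integrand mulrN mulrA.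
move=> parts; rewrite parts.
- rewrite oppeK addeAC -EFinD addeC; congr (_ + _)%E.
  by congr EFin; ring.
- apply: within_cont => // t t0; apply: cvgM; first exact: cvg_cst.
  exact: cont_powR.
- exact: oo_LR dP _ _.
- move=> t; rewrite in_itv/= => /andP[at_ _].
  by rewrite derive1E; apply: (@derive_val _ _ _ _ _ _ _ (dP t _)); exact: lt_trans at_.
- apply: within_cont => // t t0; apply: cvgM; first exact: cvg_cst.
  exact: cont_expRc.
- exact: oo_LR dE _ _.
- move=> t; rewrite in_itv/= => /andP[at_ _].
  by rewrite derive1E; apply: (@derive_val _ _ _ _ _ _ _ (dE t _)); exact: lt_trans at_.
Qed.

Lemma cvgS (T : ptopologicalType) (u : nat -> T) (l : T) :
  u @ \oo --> l -> u n.+1 @[n --> \oo] --> l.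
Proof. by move=> ul; rewrite (@cvg_shiftS _ u). Qed.

Lemma cvg_low s c : 0 < s -> 0 < c ->
  (n.+1%:R^-1 `^ s * expR (- (c * n.+1%:R^-1)) : R) @[n --> \oo] --> 0.
Proof.
move=> s0 c0.
have h : (n.+1%:R^-1 `^ s : R) @[n --> \oo] --> 0.
  have /cvg_at_rightP := @powR_cvg0 R s s0.
  by apply; split; [move=> n; rewrite invr_gt0|exact: cvg_harmonic].
apply: (squeeze_cvgr _ (cvg_cst 0) h); apply: nearW => n.
rewrite mulr_ge0 ?powR_ge0 ?expR_ge0//= ler_piMr ?powR_ge0// expR_le1 oppr_le0.
by rewrite mulr_ge0 ?(ltW c0)// invr_ge0.
Qed.

Lemma cvg_high s c : 0 < s -> 0 < c ->
  (n.+1%:R `^ s * expR (- (c * n.+1%:R)) : R) @[n --> \oo] --> 0.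
Proof.
move=> s0 c0; pose m := (Num.truncn s).+1.
pose C : R := m.+1`!%:R / c ^+ m.+1.
have h : (C * n.+1%:R^-1 : R) @[n --> \oo] --> 0.
  by rewrite -(mulr0 C); apply: cvgM; [exact: cvg_cst|exact: cvg_harmonic].
apply: (squeeze_cvgr _ (cvg_cst 0) h); apply: nearW => n.
rewrite mulr_ge0 ?powR_ge0 ?expR_ge0//=.
have n0 : 0 < n.+1%:R :> R by [].
have powle : n.+1%:R `^ s <= n.+1%:R ^+ m :> R.
  by rewrite -powR_mulrn// ler_powR ?ler1n// ltW// truncnS_gt.
have cn : 0 <= c * n.+1%:R by rewrite mulr_ge0 ?(ltW c0).
have e1 : (c * n.+1%:R) ^+ m.+1 / m.+1`!%:R <= expR (c * n.+1%:R).
  by apply: le_trans (expR_ge1Dxn m cn); rewrite lerDr.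
rewrite expRN ler_pdivrMr ?expR_gt0//; apply: le_trans powle _.
apply: (@le_trans _ _ (C / n.+1%:R * ((c * n.+1%:R) ^+ m.+1 / m.+1`!%:R))).
  rewrite /C exprMn [n.+1%:R ^+ m.+1]exprS le_eqVlt; apply/orP; left; apply/eqP.
  have : m.+1`!%:R != 0 :> R by rewrite pnatr_eq0 -lt0n fact_gt0.
  have : c ^+ m.+1 != 0 by rewrite expf_neq0// gt_eqF.
  have : n.+1%:R != 0 :> R by rewrite pnatr_eq0.
  move: (m.+1`!%:R) (c ^+ m.+1) (n.+1%:R) => x y z z0 y0 x0; field.
  by rewrite x0 y0 z0.
by apply: ler_wpM2l e1; rewrite !mulr_ge0 ?invr_ge0 ?exprn_ge0 ?(ltW c0).
Qed.

Lemma gamma_int_ge0 s c : (0 <= gamma_int s c)%E.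
Proof. by apply: integral_ge0 => t _; rewrite lee_fin integrand_ge0. Qed.

(** Integration by parts on compact intervals, whose boundary terms vanish in the limit. Stated in
    the extended reals because finiteness of the integrals is deduced from it. *)
Lemma gamma_intS s c : 0 < s -> 0 < c ->
  (c%:E * gamma_int (s + 1) c = s%:E * gamma_int s c)%E.
Proof.
move=> s0 c0.
(* The index is shifted because [pos_seq 0] is the single point 1, while integration by parts wants
   a proper interval. *)
have lhs : (c%:E * \int[mu]_(t in pos_seq n.+1) (integrand (s + 1) c t)%:E +
    (n.+2%:R `^ s * expR (- (c * n.+2%:R)))%:E @[n --> \oo] -->
    c%:E * gamma_int (s + 1) c + 0)%E.
  apply: cvgeD; first exact: fin_num_adde_defl.
    have := cvgeZl (y := c%:E) isT (@cvg_gamma (s + 1) c).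
    by exact: cvgS.
  apply: cvg_EFin; first exact: nearW.
  have := cvg_high s0 c0.
  by exact: cvgS.
have rhs : (s%:E * \int[mu]_(t in pos_seq n.+1) (integrand s c t)%:E +
    (n.+2%:R^-1 `^ s * expR (- (c * n.+2%:R^-1)))%:E @[n --> \oo] -->
    s%:E * gamma_int s c + 0)%E.
  apply: cvgeD; first exact: fin_num_adde_defl.
    have := cvgeZl (y := s%:E) isT (@cvg_gamma s c).
    by exact: cvgS.
  apply: cvg_EFin; first exact: nearW.
  have := cvg_low s0 c0.
  by exact: cvgS.
rewrite -[LHS]adde0 -[RHS]adde0; apply: cvg_unique lhs _ => //.
have e n : (c%:E * \int[mu]_(t in pos_seq n.+1) (integrand (s + 1) c t)%:E +
    (n.+2%:R `^ s * expR (- (c * n.+2%:R)))%:E =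
  s%:E * \int[mu]_(t in pos_seq n.+1) (integrand s c t)%:E +
    (n.+2%:R^-1 `^ s * expR (- (c * n.+2%:R^-1)))%:E)%E.
  apply: gamma_parts => //; apply: (@le_lt_trans _ _ 1); last by rewrite ltr1n.
  by rewrite invf_le1// ler1n.
by rewrite (funext e).
Qed.

Lemma gamma_int1 c : 0 < c -> gamma_int 1 c = (c^-1)%:E.
Proof.
move=> c0; rewrite /gamma_int.
transitivity (\int[mu]_(t in `[0%R, +oo[) (expR (- (c * t)))%:E)%E.
  rewrite -integral_itv_obnd_cbnd; last first.
    apply/measurable_EFinP/measurable_funTS.
    apply: measurableT_comp; first exact: measurable_expR.
    by apply: measurableT_comp => //; exact: measurable_funM.
  by apply: eq_integral => t _; rewrite /integrand subrr powRr0 mul1r.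
rewrite (@ge0_continuous_FTC2y _ _ (fun t => - c^-1 * expR (- (c * t))) _ 0).
- by rewrite mulr0 oppr0 expR0 mulr1 sub0e -EFinN opprK.
- by move=> t _; exact: expR_ge0.
- by apply: continuous_subspaceT => t; exact: cont_expRc.
- rewrite -(mulr0 (- c^-1)); apply: cvgM; first exact: cvg_cst.
  apply: (cvg_comp (fun t => c * t) (fun t => expR (- t)) _ (@cvgr_expR R)).
  exact: gt0_cvgMry.
- move=> t _; apply: derivableM => //; apply: ex_derive; exact: is_derive_expRc.
- apply: cvg_at_right_filter; apply: cvgM; first exact: cvg_cst.
  exact: cont_expRc.
- move=> t _; rewrite derive1E.
  have := is_deriveZ (- c^-1) (is_derive_expRc c t).
  move=> /(@derive_val _ _ _ _ _ _ _); rewrite /GRing.scale /= mulrA mulrNN.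
  by rewrite mulVf ?gt_eqF// mul1r.
Qed.

Lemma gamma_int_nat n c : 0 < c -> (gamma_int n.+1%:R c < +oo)%E.
Proof.
move=> c0; elim: n => [|n IH]; first by rewrite gamma_int1// ltry.
have := @gamma_intS n.+1%:R c (ltr0Sn _ _) c0; rewrite natr1 => e.
have : (c%:E * gamma_int n.+2%:R c < +oo)%E.
  by rewrite e; apply: lte_mul_pinfty; rewrite ?lee_fin.
rewrite -lte_pdivlMl//= mulry gtr0_sg ?invr_gt0// mul1e.
by [].
Qed.

(** The functional equation raises the exponent above 1; then [t^(s-1)] is at most [1 + t^n] for an
    integer [n], and integer exponents follow by induction from the exponential integral. *)
Lemma gamma_int_lty s c : 0 < s -> 0 < c -> (gamma_int s c < +oo)%E.
Proof.
move=> s0 c0.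
suff ge1 s' : 1 <= s' -> (gamma_int s' c < +oo)%E.
  have : (s%:E * gamma_int s c < +oo)%E.
    rewrite -gamma_intS//; apply: lte_mul_pinfty; rewrite ?lee_fin ?(ltW c0)//.
    by apply: ge1; rewrite lerDr ltW.
  by rewrite -lte_pdivlMl//= mulry gtr0_sg ?invr_gt0// mul1e.
move=> s1; pose n := Num.truncn s'.
apply: (@le_lt_trans _ _ (gamma_int 1 c + gamma_int n.+1%:R c)%E); last first.
  by apply: lte_add_pinfty; [rewrite gamma_int1// ltry|exact: gamma_int_nat].
have mI (u v : R) : measurable_fun `](0 : R), +oo[%classic (fun t => (integrand u v t)%:E).
  by apply/measurable_EFinP/measurable_funTS; exact: measurable_gamma_integrand.
have i0 (u v t : R) : (0 <= (integrand u v t)%:E)%E.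
  by rewrite lee_fin integrand_ge0.
rewrite /gamma_int -(ge0_integralD mu (measurable_itv _) (fun t _ => i0 1 c t)
  (mI 1 c) (fun t _ => i0 n.+1%:R c t) (mI n.+1%:R c)).
apply: ge0_le_integral => //.
- exact: mI.
- by apply: emeasurable_funD; exact: mI.
move=> t; rewrite /= in_itv/= andbT => t0.
rewrite -EFinD lee_fin /integrand -mulrDl ler_wpM2r ?expR_ge0//.
have [t1|t1] := leP t 1.
  apply: (@le_trans _ _ (t `^ (1 - 1))); last by rewrite lerDl powR_ge0.
  by apply: ger_powR; rewrite ?t0//; lra.
apply: (@le_trans _ _ (t `^ (n.+1%:R - 1))); last by rewrite lerDr powR_ge0.
by rewrite ler_powR ?(ltW t1)// lerD2r ltW// truncnS_gt.
Qed.

Lemma gamma_int_gt0 s c : 0 < s -> 0 < c -> (0 < gamma_int s c)%E.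
Proof.
move=> s0 c0.
(* Lower bound of the integrand on [[1, 2]], where [t^(s-1) >= 1 / t >= 1 / 2]. *)
pose k : R := 2^-1 * expR (- (c * 2)).
have k0 : 0 < k by rewrite mulr_gt0 ?expR_gt0.
apply: (@lt_le_trans _ _ (\int[mu]_(t in `[1%R, 2%R]) (cst k%:E t))%E).
  rewrite integral_cst//= lebesgue_measure_itv/= lte_fin.
  rewrite (_ : (1 < 2 :> R)); last by lra.
  by rewrite -EFinD -EFinM lte_fin mulr_gt0//; lra.
apply: (@le_trans _ _ (\int[mu]_(t in `[1%R, 2%R]) (integrand s c t)%:E)%E).
  apply: ge0_le_integral => //=.
  - by move=> t _; rewrite lee_fin ltW.
  - by apply/measurable_EFinP/measurable_funTS; exact: measurable_gamma_integrand.
  move=> t; rewrite in_itv/= => /andP[t1 t2]; rewrite lee_fin /k.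
  apply: ler_pM; rewrite ?expR_ge0 ?invr_ge0//.
    have tn0 : t != 0 by rewrite gt_eqF//; lra.
    rewrite powRB ?tn0 ?implybT// powRr1; last by lra.
    rewrite -[leLHS]mul1r; apply: ler_pM; rewrite ?invr_ge0//.
      by rewrite -(powRr0 t) ler_powR// ltW.
    by rewrite lef_pV2 ?posrE//; lra.
  by rewrite ler_expR lerN2 ler_wpM2l// ltW.
apply: ge0_subset_integral => //.
- by apply/measurable_EFinP/measurable_funTS; exact: measurable_gamma_integrand.
- by move=> t _; rewrite lee_fin integrand_ge0.
- by move=> t /=; rewrite !in_itv/= andbT => /andP[+ _]; apply: lt_le_trans.
Qed.

(** Substitution [t -> c t], carried out on half-lines away from 0, where the integrand is
    continuous. The endpoints [1 / (n + 1)] and [c / (n + 1)] correspond, and both families exhaust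
    the positive axis. *)
Lemma gamma_int_scale s c : 0 < s -> 0 < c ->
  gamma_int s 1 = ((c `^ s)%:E * gamma_int s c)%E.
Proof.
move=> s0 c0.
have cs0 : 0 < c `^ s by rewrite powR_gt0.
have union (k : R) : 0 < k ->
    \bigcup_n `[k * n.+1%:R^-1, +oo[%classic = `]0, +oo[%classic.
  move=> k0; apply/seteqP; split => [t [n _] /=|t /=]; rewrite !in_itv/= !andbT.
    by apply: lt_le_trans; rewrite mulr_gt0// invr_gt0.
  move=> t0; exists (Num.truncn (k / t)) => //=; rewrite in_itv/= andbT.
  rewrite ler_pdivrMr// mulrC -ler_pdivrMr//.
  exact/ltW/truncnS_gt.
have cvI (k : R) u v : 0 < k ->
    (\int[mu]_(t in `[(k * n.+1%:R^-1)%R, +oo[) (integrand u v t)%:E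
      @[n --> \oo] --> gamma_int u v)%E.
  move=> k0; rewrite /gamma_int -(union _ k0).
  apply: ge0_nondecreasing_set_cvg_integral => //.
  - apply/nondecreasing_seqP => n; rewrite subsetEset => t /=.
    rewrite !in_itv/= !andbT; apply: le_trans.
    by rewrite ler_pM2l// lef_pV2 ?posrE// ler_nat.
  - by move=> n; apply/measurable_EFinP/measurable_funTS; exact: measurable_gamma_integrand.
  - by move=> n t _; rewrite lee_fin integrand_ge0.
have lim1 := cvI c s 1 c0.
have lim2 : ((c `^ s)%:E * \int[mu]_(t in `[(1 * n.+1%:R^-1)%R, +oo[) (integrand s c t)%:E
      @[n --> \oo] --> (c `^ s)%:E * gamma_int s c)%E.
  by apply: cvgeZl => //; exact: cvI.
apply: cvg_unique lim1 _ => //.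
rewrite (_ : (fun n : nat => _) = (fun n => (c `^ s)%:E *
  \int[mu]_(t in `[(1 * n.+1%:R^-1)%R, +oo[) (integrand s c t)%:E)%E)//.
apply/funext => n; rewrite mul1r.
set a : R := n.+1%:R^-1.
have a0 : 0 < a by rewrite invr_gt0.
have dF t : is_derive t 1 (fun t => c * t) c.
  have -> : (fun t : R => c * t) = c \*: id by apply/funext => u.
  by apply: is_derive_eq; rewrite /GRing.scale/= mulr1.
have dFE : (fun t => c * t)^`()%classic = cst c.
  by apply/funext => t; rewrite derive1E; exact: derive_val.
have contI t : 0 < t -> {for t, continuous (integrand s 1)}.
  move=> t0; apply: cvgM; first exact: cont_powR.
  exact: cont_expRc.
rewrite (@increasing_ge0_integration_by_substitutiony R (fun t => c * t) (integrand s 1) a).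
- rewrite -ge0_integralZl_EFin ?powR_ge0//; last 2 first.
  - by move=> t _; rewrite lee_fin integrand_ge0.
  - by apply/measurable_EFinP/measurable_funTS; exact: measurable_gamma_integrand.
  apply: eq_integral => t; rewrite inE/= in_itv/= andbT => at_.
  have t0 : 0 < t by exact: lt_le_trans at_.
  transitivity ((integrand s 1 (c * t) * (fun t => c * t)^`()%classic t)%:E) => //.
  rewrite -EFinM; congr EFin; rewrite dFE /integrand /= mul1r powRM ?(ltW c0) ?(ltW t0)//.
  by rewrite mulrC !mulrA mulr_powRB1 ?(ltW c0).
- by move=> x y _ _ xy; rewrite ltr_pM2l.
- by move=> x _; rewrite dFE; exact: cvg_cst.
- by rewrite dFE; exact: is_cvg_cst.
- by rewrite dFE; exact: is_cvg_cst.
- split; first by move=> t _; apply: ex_derive; exact: dF.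
  apply: cvg_at_right_filter; apply: differentiable_continuous.
  by apply/derivable1_diffP; apply: ex_derive; exact: dF.
- exact: gt0_cvgMry.
- apply: continuous_in_subspaceT => t; rewrite inE/= in_itv/= andbT => h.
  by apply: contI; apply: lt_le_trans h; rewrite mulr_gt0.
- by move=> t _; exact: integrand_ge0.
Qed.

Lemma Gamma_posE s : Gamma_pos s = fine (gamma_int s 1).
Proof.
by rewrite /Gamma_pos /gamma_int; congr fine; apply: eq_integral => t _;
  rewrite /integrand mul1r.
Qed.

Lemma gamma_intE s c : 0 < s -> 0 < c ->
  gamma_int s c = (c `^ (- s) * Gamma_pos s)%:E.
Proof.
move=> s0 c0; rewrite Gamma_posE EFinM fineK; last first.
  by rewrite ge0_fin_numE ?gamma_int_ge0// gamma_int_lty.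
rewrite (@gamma_int_scale s c)// muleA -EFinM powRN mulVf ?mul1e//.
by rewrite gt_eqF// powR_gt0.
Qed.

Lemma Gamma_pos_gt0 s : 0 < s -> 0 < Gamma_pos s.
Proof.
by move=> s0; rewrite Gamma_posE fine_gt0// gamma_int_gt0// gamma_int_lty.
Qed.

Lemma Gamma_posD1 s : 0 < s -> Gamma_pos (s + 1) = s * Gamma_pos s.
Proof.
move=> s0; rewrite !Gamma_posE; have := @gamma_intS s 1 s0 ltr01.
by rewrite mul1e => ->; rewrite fineM// ge0_fin_numE ?gamma_int_ge0// gamma_int_lty.
Qed.

Lemma Gamma_posDn s n : 0 < s ->
  Gamma_pos (s + n%:R) = Gamma_pos s * n`!%:R * bcoef s n.
Proof.
move=> s0; elim: n => [|n IH]; first by rewrite addr0 bcoef0 !mulr1.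
rewrite -natr1 addrA Gamma_posD1 ?ltr_wpDr// IH factS natrM.
by rewrite mulrCA -bcoefSr; ring.
Qed.

End Gamma_function.

(** * The heat kernel *)

Section Series.
Context {R : realType}.
Implicit Types a b u : R^nat.

Lemma esum_series u (l : R) : (forall n, 0 <= u n) ->
  (\esum_(n in [set: nat]) (u n)%:E = l%:E)%E -> series u @ \oo --> l.
Proof.
move=> u0; rewrite -nneseries_esumT => [e|n]; last by rewrite lee_fin.
have : (fun n => \sum_(0 <= k < n) (u k)%:E)%E @ \oo --> l%:E.
  by rewrite -e; apply: is_cvg_nneseries => k _ _; rewrite lee_fin.
move=> /fine_cvgP[_]; by apply: cvg_trans; apply: near_eq_cvg; apply: nearW => n /=; rewrite sumEFin.
Qed.

Lemma series_esum u : (forall n, 0 <= u n) -> cvgn (series u) ->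
  (\esum_(n in [set: nat]) (u n)%:E = (limn (series u))%:E)%E.
Proof.
move=> u0 cu; rewrite -nneseries_esumT => [|n]; last by rewrite lee_fin.
rewrite -EFin_lim//; congr (limn _); apply/funext => n /=.
by rewrite sumEFin.
Qed.

Definition cauchy_product a b n : R := \sum_(k < n.+1) a k * b (n - k)%N.

Lemma cauchy_product_ge0 a b : (forall n, 0 <= a n) -> (forall n, 0 <= b n) ->
  cvgn (series a) -> cvgn (series b) ->
  series (cauchy_product a b) @ \oo --> limn (series a) * limn (series b).
Proof.
move=> a0 b0 ca cb; apply: esum_series.
  by move=> n; apply: sumr_ge0 => k _; exact: mulr_ge0.
rewrite /cauchy_product; under eq_esum do rewrite -sumEFin.
rewrite -(@esum_antidiag _ (fun n k => (a n * b k)%:E)); last first.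
  by move=> n k; rewrite lee_fin mulr_ge0.
transitivity (\esum_(n in [set: nat]) ((limn (series b))%:E * (a n)%:E))%E.
  by apply: eq_esum => n _; rewrite -series_esum// muleC -esumZ.
rewrite esumZ; first by rewrite series_esum// -EFinM mulrC.
  rewrite -lee_fin -series_esum//; apply: esum_ge0 => n _; by rewrite lee_fin.
by move=> n; rewrite lee_fin.
Qed.

(** Splitting [b] into positive and negative parts reduces to nonnegative families, where regrouping
    is free. *)
Lemma cauchy_product_cvg a b : (forall n, 0 <= a n) ->
  cvgn (series a) -> cvgn [normed series b] ->
  series (cauchy_product a b) @ \oo --> limn (series a) * limn (series b).
Proof.
move=> a0 ca nb.
pose bp n := Num.max (b n) 0; pose bm n := Num.max (- b n) 0.
have bE n : b n = bp n - bm n.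
  by rewrite /bp /bm; case: (leP (b n) 0) => h; case: (leP (- b n) 0) => h'; lra.
have bp0 n : 0 <= bp n by rewrite /bp le_max lexx orbT.
have bm0 n : 0 <= bm n by rewrite /bm le_max lexx orbT.
have cp : cvgn (series bp).
  apply: (series_le_cvg bp0 _ _ nb) => n //=.
  by rewrite /bp ge_max ler_norm normr_ge0.
have cm : cvgn (series bm).
  apply: (series_le_cvg bm0 _ _ nb) => n //=.
  by rewrite /bm ge_max -normrN ler_norm normr_ge0.
have -> : series (cauchy_product a b) =
    series (cauchy_product a bp) - series (cauchy_product a bm).
  apply/funext => n; rewrite /series /= fctE -sumrB; apply: eq_bigr => k _.
  rewrite /cauchy_product -sumrB; apply: eq_bigr => j _.
  by rewrite bE mulrBr.
have -> : limn (series b) = limn (series bp) - limn (series bm).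
  rewrite -lim_seriesB//; congr (limn (series _)); apply/funext => n.
  exact: bE.
by rewrite mulrBr; apply: cvgB; exact: cauchy_product_ge0.
Qed.

End Series.

Section Heat_kernel.
Context {R : realType} {d : nat}.
Hypothesis d0 : (0 < d)%N.
Implicit Types (x : Zd d) (t s : R).
Notation mu := (@lebesgue_measure R).

Lemma adj_sum (I : Type) (r : seq I) (c : I -> R) (f : I -> Zd d -> R) x :
  adj (fun x => \sum_(k <- r) c k * f k x) x = \sum_(k <- r) c k * adj (f k) x.
Proof.
under [RHS]eq_bigr do rewrite mulr_sumr.
rewrite exchange_big; apply: eq_bigr => i _ /=.
by rewrite mulr_sumr -!big_split; apply: eq_bigr => k _ /=; ring.
Qed.

Lemma iter_lapE n x : iter n (@lap R d) (ind0 d) x =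
  binconv (fun k => (-1) ^+ k * walk k x) (fun j => deg (d := d) ^+ j) n.
Proof.
elim: n x => [|n IH] x.
  by rewrite /binconv big_ord1 bin0 !expr0 !mul1r mulr1.
rewrite iterS lapE IH binconvS addrC; congr (_ + _); last first.
  by rewrite /binconv mulr_sumr; apply: eq_bigr => k _ /=; rewrite exprS; ring.
rewrite (funext IH) /binconv.
have -> : (fun x : Zd d => \sum_(k < n.+1) 'C(n, k)%:R * ((-1) ^+ k * walk k x) *
      deg (R := R) (d := d) ^+ (n - k)) =
    (fun x : Zd d => \sum_(k < n.+1) ('C(n, k)%:R * (-1) ^+ k *
      deg (R := R) (d := d) ^+ (n - k)) * walk k x).
  by apply/funext => z; apply: eq_bigr => k _; ring.
rewrite adj_sum -sumrN; apply: eq_bigr => k _ /=.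
by rewrite -walkS exprS; ring.
Qed.

Lemma rw_le1 n x : rw n x <= 1 :> R.
Proof.
have := @le_esum_term R (Zd d) (fun y => (rw n (x - y))%:E) 0.
by rewrite subr0 rw_sum1// lee_fin; apply=> y; rewrite lee_fin rw_ge0.
Qed.

(** With [Delta = deg - adj], [e^(-t Delta) = e^(-deg t) e^(t adj)]: the heat kernel is the lazy
    walk at a Poisson time. The alternating defining series is recognised as the Cauchy product of a
    nonnegative series with that of [e^(-deg t)]. *)
Lemma heatE t x : 0 <= t -> (heat d t x)%:E = (\esum_(k in [set: nat])
  (rw k x * deg (d := d) ^+ k / k`!%:R * (t ^+ k * expR (- (deg (d := d) * t))))%:E)%E.
Proof.
move=> t0; set D : R := deg.
have D0 : 0 <= D by rewrite ltW// deg_gt0.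
pose p k := rw k x * D ^+ k / k`!%:R * t ^+ k.
have p0 k : 0 <= p k by rewrite !mulr_ge0 ?rw_ge0 ?exprn_ge0.
have cp : cvgn (series p).
  apply: (series_le_cvg p0 _ _ (is_cvg_series_exp_coeff (D * t))).
    by move=> n; apply: exp_coeff_ge0; exact: mulr_ge0.
  move=> n; have -> : p n = rw n x * exp_coeff (D * t) n.
    have -> : exp_coeff (D * t) n = D ^+ n * t ^+ n / n`!%:R.
      by rewrite -exprMn.
    by rewrite /p -!mulrA [t ^+ n * _]mulrC.
  by rewrite ler_piMl ?rw_le1//; apply: exp_coeff_ge0; exact: mulr_ge0.
have nb : cvgn [normed series (exp_coeff (- (D * t)))].
  by rewrite normed_series_exp_coeff; exact: is_cvg_series_exp_coeff.
have termE : (fun n => (- t) ^+ n / n`!%:R * iter n (@lap R d) (ind0 d) x) =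
    cauchy_product p (exp_coeff (- (D * t))).
  apply/funext => n; rewrite iter_lapE /binconv mulr_sumr; apply: eq_bigr => k _.
  have kn : (k <= n)%N by rewrite -ltnS.
  rewrite /p /exp_coeff /= rwE -/D -(bin_fact kn) !natrM.
  have -> : (- t) ^+ n = (-1) ^+ k * t ^+ k * (- t) ^+ (n - k).
    by rewrite -exprMn mulN1r -exprD subnKC.
  rewrite -mulrN [(D * - t) ^+ _]exprMn.
  have f1 : k`!%:R != 0 :> R by rewrite pnatr_eq0 -lt0n fact_gt0.
  have f2 : (n - k)`!%:R != 0 :> R by rewrite pnatr_eq0 -lt0n fact_gt0.
  have f3 : 'C(n, k)%:R != 0 :> R by rewrite pnatr_eq0 -lt0n bin_gt0.
  have D1 : D ^+ k != 0 by rewrite expf_neq0// gt_eqF// deg_gt0.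
  have sq : (-1) ^+ k * (-1) ^+ k = 1 :> R by rewrite -exprMn mulrNN mulr1 expr1n.
  transitivity ((-1) ^+ k * (-1) ^+ k * (walk k x * t ^+ k / k`!%:R) *
      (D ^+ (n - k) * (- t) ^+ (n - k) / (n - k)`!%:R)); last first.
    rewrite sq mul1r; field.
    by rewrite f1 f2 D1.
  by rewrite -/D; field; rewrite f1 f2 f3.
have -> : heat d t x = limn (series p) * expR (- (D * t)).
  by rewrite /heat termE; apply: cvg_lim => //; exact: cauchy_product_cvg.
under eq_esum do rewrite mulrA -/(p _) mulrC EFinM.
rewrite esumZ ?expR_ge0//.
by rewrite series_esum// -EFinM mulrC.
Qed.

(** Each Poisson weight integrates to a Gamma value. Positivity of [s + k] is asked only where
    [rw k x] is nonzero: for [-1 < s < 0] off the origin, the divergent integral for [k = 0] carries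
    the factor 0. *)
Lemma integral_heat s x : (forall k, (rw k x : R) != 0 -> 0 < s + k%:R) ->
  (\int[mu]_(t in `]0%R, +oo[) (heat d t x * t `^ (s - 1))%:E =
   (deg (d := d) `^ (- s))%:E * \esum_(k in [set: nat])
     (rw k x * Gamma_pos (s + k%:R) / k`!%:R)%:E)%E.
Proof.
move=> pos; set D : R := deg.
have Dgt0 : 0 < D by rewrite deg_gt0.
have D0 := ltW Dgt0.
pose c k := rw k x * D ^+ k / k`!%:R.
have c0 k : 0 <= c k by rewrite !mulr_ge0 ?rw_ge0 ?exprn_ge0.
transitivity (\int[mu]_(t in `]0%R, +oo[) \sum_(k <oo)
   ((c k)%:E * (t `^ (s + k%:R - 1) * expR (- (D * t)))%:E))%E.
  apply: eq_integral => t; rewrite inE/= in_itv/= andbT => t0.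
  rewrite nneseries_esumT; last first.
    move=> k; apply: mule_ge0; rewrite lee_fin; first exact: c0.
  by rewrite mulr_ge0 ?powR_ge0 ?expR_ge0.
  rewrite EFinM heatE ?(ltW t0)// muleC -esumZ ?powR_ge0//; last first.
    by move=> k; rewrite lee_fin !mulr_ge0 ?rw_ge0 ?exprn_ge0 ?expR_ge0 ?(ltW t0).
  apply: eq_esum => k _; rewrite -!EFinM; congr EFin; rewrite -/D -/(c k).
  have -> : s + k%:R - 1 = s - 1 + k%:R by ring.
  rewrite [t `^ (s - 1 + _)]powRD; last by rewrite (gt_eqF t0) implybT.
  by rewrite powR_mulrn ?(ltW t0)//; ring.
have mI k : measurable_fun `](0 : R), +oo[%classic
    (fun t => (t `^ (s + k%:R - 1) * expR (- (D * t)))%:E).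
  by apply/measurable_EFinP/measurable_funTS; exact: measurable_gamma_integrand.
have i0 k (t : R) : (0 <= (t `^ (s + k%:R - 1) * expR (- (D * t)))%:E)%E.
  by rewrite lee_fin mulr_ge0 ?powR_ge0 ?expR_ge0.
rewrite integral_nneseries//; last 2 first.
- by move=> k; apply: measurable_funeM; exact: mI.
- by move=> k t _; apply: mule_ge0; [rewrite lee_fin; exact: c0|exact: i0].
rewrite nneseries_esumT; last first.
  by move=> k; apply: integral_ge0 => t _; apply: mule_ge0; [rewrite lee_fin; exact: c0|exact: i0].
rewrite -esumZ ?powR_ge0//; last first.
  move=> k; rewrite lee_fin; have [->|rk] := eqVneq (rw k x : R) 0; first by rewrite !mul0r.
  by rewrite !mulr_ge0 ?rw_ge0// ltW// Gamma_pos_gt0// pos.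
apply: eq_esum => k _; rewrite ge0_integralZl_EFin ?c0//; last exact: mI.
have [rk|rk] := eqVneq (rw k x : R) 0.
  by rewrite /c rk !mul0r mul0e mule0.
rewrite -[X in (_ * X)%E]/(gamma_int (s + k%:R) D) gamma_intE ?pos// -!EFinM.
congr EFin; rewrite /c opprD powRD; last by rewrite (gt_eqF Dgt0) implybT.
rewrite [D `^ (- k%:R)]powR_invn// .
have D1 : D ^+ k != 0 by rewrite expf_neq0// gt_eqF.
have f1 : k`!%:R != 0 :> R by rewrite pnatr_eq0 -lt0n fact_gt0.
by field; rewrite f1 D1.
Qed.

End Heat_kernel.

(** * Riesz kernels as potentials of the walk *)

Section Jump_coefficients.
Context {R : realType}.
Implicit Types s t : R.

(* For [0 < s <= 1] the numbers [jump s k] form a probability distribution: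
   [1 - (1 - z) `^ s] is its generating function. *)
Definition jump s k : R := if k is m.+1 then s / m.+1%:R * bcoef (1 - s) m else 0.

Lemma jump_ge0 s k : 0 <= s -> s <= 1 -> 0 <= jump s k.
Proof.
by move=> s0 s1; case: k => [|m] //=; rewrite mulr_ge0 ?divr_ge0 ?bcoef_ge0 ?subr_ge0.
Qed.

Lemma jump_bcoef s k : bcoef (- s) k = (k == 0%N)%:R - jump s k.
Proof.
case: k => [|m]; first by rewrite bcoef0 /= subr0.
rewrite /= sub0r; elim: m => [|m IH].
  by rewrite bcoefS !bcoef0 addr0; lra.
rewrite bcoefS IH bcoefS -!natr1 mulNr; congr (- _).
have h1 : m%:R + 1 != 0 :> R by rewrite natr1 pnatr_eq0.
have h2 : m%:R + 1 + 1 != 0 :> R by rewrite !natr1 pnatr_eq0.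
by field; rewrite h1 h2.
Qed.

Lemma sum_jump s n : \sum_(k < n.+1) jump s k = 1 - bcoef (1 - s) n.
Proof.
have := bcoef_sum (- s) n; rewrite [- s + 1]addrC => <-.
under [X in _ - X]eq_bigr do rewrite jump_bcoef.
have -> : \sum_(k < n.+1) ((k == 0%N :> nat)%:R - jump s k) =
    1 - \sum_(k < n.+1) jump s k.
  by rewrite sumrB; congr (_ - _); rewrite big_ord_recl big1 ?addr0.
by rewrite opprB addrC subrK.
Qed.

Lemma esum_jump s : 0 < s -> s <= 1 ->
  (\esum_(k in [set: nat]) (jump s k)%:E = 1)%E.
Proof.
move=> s0 s1; have j0 k := jump_ge0 k (ltW s0) s1.
have cv : series (jump s) @ \oo --> (1 : R).
  rewrite -(cvg_shiftS (series (jump s))).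
  have -> : (fun n => series (jump s) n.+1) = (fun n => 1 - bcoef (1 - s) n).
    by apply/funext => n; rewrite /series /= big_mkord sum_jump.
  have h : 1 - bcoef (1 - s) n @[n --> \oo] --> 1 - (0 : R).
    by apply: cvgB; [exact: cvg_cst|exact: bcoef_cvg0].
  by rewrite subr0 in h.
rewrite series_esum//; last exact: cvgP cv.
by rewrite (cvg_lim _ cv).
Qed.

Lemma cauchy_product_bcoef s t n :
  cauchy_product (bcoef s) (bcoef t) n = bcoef (s + t) n.
Proof. exact: bcoefD. Qed.

(** Coefficients of [(1 - (1 - z)^s) (1 - z)^(-t) = (1 - z)^(-t) - (1 - z)^(-(t - s))]; this is the
    relation between [u], [B] and [v]. *)
Lemma cauchy_product_jump s t n :
  cauchy_product (jump s) (bcoef t) n = bcoef t n - bcoef (t - s) n.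
Proof.
rewrite -[t - s]addrC -bcoefD /cauchy_product.
under [X in _ = _ - X]eq_bigr do rewrite jump_bcoef mulrBl.
have -> : \sum_(k < n.+1) ((k == 0%N :> nat)%:R * bcoef t (n - k) -
    jump s k * bcoef t (n - k)) =
    bcoef t n - \sum_(k < n.+1) jump s k * bcoef t (n - k).
  rewrite sumrB; congr (_ - _); rewrite big_ord_recl /= mul1r subn0.
  by rewrite big1 ?addr0// => i _; rewrite mul0r.
by rewrite opprB addrC subrK.
Qed.

End Jump_coefficients.

(** * Potentials of the walk: convolution and identification with the Riesz kernels *)

Section Potential.
Context {R : realType} {d : nat}.
Hypothesis d0 : (0 < d)%N.
Implicit Types (x y : Zd d) (s : R) (a b : nat -> R).

(** The kernel of the power series [a] evaluated at the transition operator. *)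
Definition pot a x : \bar R := (\esum_(n in [set: nat]) (a n * rw n x)%:E)%E.

Let term_ge0 a n x : (forall n, 0 <= a n) -> (0 <= (a n * rw n x)%:E)%E.
Proof. by move=> a0; rewrite lee_fin mulr_ge0 ?rw_ge0. Qed.

Lemma pot_ge0 a x : (forall n, 0 <= a n) -> (0 <= pot a x)%E.
Proof. by move=> a0; apply: esum_ge0 => n _; exact: term_ge0. Qed.

Lemma potN a x : pot a (- x) = pot a x.
Proof. by apply: eq_esum => n _; rewrite rwN. Qed.

Lemma eq_pot a b x : a =1 b -> pot a x = pot b x.
Proof. by move=> ab; apply: eq_esum => n _; rewrite ab. Qed.

Lemma pot_lty a x : (forall n, 0 <= a n) -> (pot a (0%R : Zd d) < +oo)%E ->
  (pot a x < +oo)%E.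
Proof.
move=> a0; apply: le_lt_trans; apply: le_esum => n _.
by rewrite lee_fin ler_wpM2l// rw_le_return.
Qed.

(** Multiplicativity of this functional calculus, from Tonelli and the semigroup law [rwD].
    Finiteness of [pot b] lets it be moved into the sum as a real scalar. *)
Lemma pot_conv a b x : (forall n, 0 <= a n) -> (forall n, 0 <= b n) ->
  (forall y, (pot b y < +oo)%E) ->
  (\esum_(y in [set: Zd d]) (pot a (x - y)%R * pot b y) =
   pot (cauchy_product a b) x)%E.
Proof.
move=> a0 b0 bfin.
have nn n m y : (0 <= (a n * b m * (rw n (x - y) * rw m y))%:E)%E.
  by rewrite lee_fin !mulr_ge0 ?rw_ge0.
transitivity (\esum_(y in [set: Zd d]) \esum_(n in [set: nat])
    \esum_(m in [set: nat]) (a n * b m * (rw n (x - y) * rw m y))%:E)%E.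
  apply: eq_esum => y _.
  have bE : pot b y = (fine (pot b y))%:E.
    by rewrite fineK// ge0_fin_numE ?pot_ge0.
  rewrite muleC bE -esumZ ?fine_ge0 ?pot_ge0//; last by move=> n; exact: term_ge0.
  apply: eq_esum => n _; rewrite -bE muleC -esumZ; last 2 first.
  - by rewrite mulr_ge0 ?rw_ge0.
  - by move=> m; exact: term_ge0.
  by apply: eq_esum => m _; rewrite -EFinM; congr EFin; ring.
rewrite exchange_esum; last by move=> y n; apply: esum_ge0.
under eq_esum do rewrite exchange_esum//.
transitivity (\esum_(n in [set: nat]) \esum_(m in [set: nat])
   (a n * b m * rw (n + m) x)%:E)%E.
  apply: eq_esum => n _; apply: eq_esum => m _.
  under eq_esum do rewrite EFinM.
  rewrite esumZ ?mulr_ge0//; last by move=> y; rewrite lee_fin mulr_ge0 ?rw_ge0.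
  by rewrite rwD// -EFinM.
rewrite esum_antidiag; last by move=> n m; rewrite lee_fin !mulr_ge0 ?rw_ge0.
apply: eq_esum => N _; rewrite sumEFin; congr EFin.
rewrite /cauchy_product mulr_suml; apply: eq_bigr => k _.
by rewrite subnKC// -ltnS.
Qed.

Lemma esum_pot_jump s x : 0 < s -> s <= 1 ->
  (\esum_(y in [set: Zd d]) pot (jump s) (x - y)%R = 1)%E.
Proof.
move=> s0 s1; have j0 k := jump_ge0 k (ltW s0) s1.
rewrite exchange_esum; last by move=> y n; exact: term_ge0.
rewrite -(esum_jump s0 s1); apply: eq_esum => n _.
under eq_esum do rewrite EFinM.
rewrite esumZ//; last by move=> y; rewrite lee_fin rw_ge0.
by rewrite rw_sum1// mule1.
Qed.

(** Also true for infinite [e], where [fine] is 0 on both sides; thus the kernel formulas below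
    carry no convergence assumption. *)
Lemma fine_mulr (c : R) (e : \bar R) : 0 < c -> fine (c%:E * e)%E = c * fine e.
Proof.
move=> c0; case: e => [r||] //=.
- by rewrite mulry gtr0_sg// mul1e /= mulr0.
- by rewrite mulrNy gtr0_sg// mul1e /= mulr0.
Qed.

Lemma kappaN s x : 0 < s ->
  kappa d (- s) x = deg (d := d) `^ (- s) * fine (pot (bcoef s) x).
Proof.
move=> s0; rewrite /kappa oppr_eq0 gt_eqF//.
have -> : (- s == 1) = false by apply/negP => /eqP; lra.
have -> : (0 < - s) = false by apply/negP => h; lra.
rewrite /= opprK /Gamma s0 [-1 + s]addrC.
rewrite integral_heat//; last by move=> k _; rewrite ltr_wpDr.
rewrite fine_mulr ?powR_gt0 ?deg_gt0// mulrCA; congr (_ * _).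
have G0 := Gamma_pos_gt0 s0.
transitivity ((Gamma_pos s)^-1 * fine ((Gamma_pos s)%:E * pot (bcoef s) x)%E).
  rewrite gtr0_norm//; congr (_ * fine _).
  rewrite -esumZ ?(ltW G0)//; last first.
    by move=> n; apply: term_ge0 => m; exact/bcoef_ge0/ltW.
  apply: eq_esum => k _; rewrite -EFinM; congr EFin.
  rewrite Gamma_posDn//.
  have f1 : k`!%:R != 0 :> R by rewrite pnatr_eq0 -lt0n fact_gt0.
  by field.
by rewrite fine_mulr// mulrA mulVf ?mul1r// gt_eqF.
Qed.

Lemma kappa1E x : x != 0 -> kappa d 1 x = deg (d := d) * rw 1 x :> R.
Proof.
move=> x0; rewrite rwE expr1 mulrC divfK; last by rewrite gt_eqF// deg_gt0.
rewrite /kappa oner_eq0 eqxx walkS /walk /= /adj.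
have -> : \sum_(i < d) (2 * ind0 d x + ind0 d (x + unitv d i) + ind0 d (x - unitv d i)) =
  \sum_(i < d) ((x == - unitv d i)%:R + (x == unitv d i)%:R) :> R.
  apply: eq_bigr => i _; rewrite /ind0 (negPf x0) mulr0 add0r addr_eq0 subr_eq0.
  by case: eqP; case: eqP.
have sq i (z : int) : z ^+ 2 = 1 -> sqnorm d (z *: unitv d i) = 1.
  move=> z2; rewrite /sqnorm (bigD1 i)//= !mxE !eqxx mulr1 z2 big1 ?addr0// => j ji.
  by rewrite !mxE eqxx (negPf ji) mulr0 expr0n.
case: eqP => [sq1|sqn1]; last first.
  rewrite big1// => i _; case: eqP => [xe|_].
    by case: sqn1; rewrite xe -scaleN1r sq.
  by case: eqP => [xe|_]; [case: sqn1; rewrite xe -[unitv d i]scale1r sq|rewrite addr0].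
have [i xi] : exists i, x 0 i != 0.
  apply/existsP; apply: contraNT x0; rewrite negb_exists => /forallP h.
  by apply/eqP/rowP => i; rewrite mxE; have /negPn/eqP := h i.
have sqge j : 0 <= x 0 j ^+ 2 by exact: sqr_ge0.
have xi1 : 1 <= x 0 i ^+ 2.
  have : 0 < x 0 i ^+ 2 by rewrite lt_def sqr_ge0 sqrf_eq0 xi.
  by [].
have rest : \sum_(j < d | j != i) x 0 j ^+ 2 = 0.
  have h : 0 <= \sum_(j < d | j != i) x 0 j ^+ 2 by apply: sumr_ge0.
  by move: sq1; rewrite /sqnorm (bigD1 i)//= => e; lra.
have xi2 : x 0 i ^+ 2 = 1.
  by move: sq1; rewrite /sqnorm (bigD1 i)//= rest addr0.
have xj j : j != i -> x 0 j = 0.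
  move=> ji; have /eqP := psumr_eq0P (fun j _ => sqge j) rest ji.
  by rewrite sqrf_eq0 => /eqP.
have xE : x = x 0 i *: unitv d i.
  apply/rowP => j; rewrite !mxE eqxx /=; have [->|ji] := eqVneq j i.
    by rewrite mulr1.
  by rewrite xj// mulr0.
rewrite (bigD1 i)//= big1 ?addr0 => [|j ji]; last first.
  have ne (z : int) : (x == z *: unitv d j) = false.
    apply/negP => /eqP /rowP /(_ i); rewrite !mxE eqxx eq_sym (negPf ji) mulr0 => h.
    by rewrite h eqxx in xi.
  by have := ne 1; have := ne (-1); rewrite scale1r scaleN1r => -> ->; rewrite addr0.
have : x 0 i == 1 \/ x 0 i == -1 by apply/orP; rewrite -sqrf_eq1 xi2.
have un : unitv d i != - unitv d i.
  by apply/negP => /eqP /rowP /(_ i); rewrite !mxE !eqxx.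
case=> /eqP e; rewrite xE e ?scale1r ?scaleN1r.
  by rewrite eqxx (negPf un) add0r.
by rewrite eqxx eq_sym (negPf un) addr0.
Qed.

(** For [s = 1] the law [jump] is concentrated at 1 and matches the indicator defining the kernel.
    For [s < 1], [Gamma (k + 1 - s)] against [|Gamma (-s)| = Gamma (1 - s) / s] produces [jump]. *)
Lemma kappa_pos s x : 0 < s -> s <= 1 -> x != 0 ->
  kappa d s x = deg (d := d) `^ s * fine (pot (jump s) x).
Proof.
move=> s0 s1 x0; have D0 := deg_gt0 (R := R) d0.
move: s1; rewrite le_eqVlt => /predU1P[->|s1].
  rewrite kappa1E// powRr1 ?(ltW D0)//; congr (_ * _).
  rewrite /pot (@esum_eqx _ _ _ 1%N) /=.
  - by rewrite subrr bcoef0 divr1 !mul1r.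
  - case=> [|[|n]] _ //=; first by rewrite mul0r.
    by rewrite subrr bcoef00 mulr0 mul0r.
  - by rewrite lee_fin subrr bcoef0 divr1 !mul1r rw_ge0.
rewrite /kappa gt_eqF// (lt_eqF s1) s0 s1 (negPf x0) /=.
have r0 : rw 0 x = 0 :> R by rewrite rw0 (negPf x0).
rewrite [- 1 - s]addrC integral_heat//; last first.
  case=> [|k _]; first by rewrite r0 eqxx.
  by rewrite -natr1; have : 0 <= k%:R :> R by []; lra.
rewrite opprK fine_mulr ?powR_gt0// mulrCA; congr (_ * _).
have s1' : 0 < 1 - s by rewrite subr_gt0.
have G0 := Gamma_pos_gt0 s1'.
have -> : `|Gamma (- s)| = Gamma_pos (1 - s) / s.
  have -> : Gamma (- s) = - (Gamma_pos (1 - s) / s).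
    rewrite /Gamma; have -> : (0 < - s) = false by apply/negP => h; lra.
    by rewrite [- s + 1]addrC invrN mulrN.
  by rewrite normrN gtr0_norm// divr_gt0.
have GS0 : 0 < Gamma_pos (1 - s) / s by rewrite divr_gt0.
transitivity ((Gamma_pos (1 - s) / s)^-1 *
    fine ((Gamma_pos (1 - s) / s)%:E * pot (jump s) x)%E).
  congr (_ * fine _).
  rewrite -esumZ ?(ltW GS0)//; last first.
    by move=> n; apply: term_ge0 => m; exact: jump_ge0 (ltW s0) (ltW s1).
  apply: eq_esum => -[|k] _; rewrite -EFinM; congr EFin; first by rewrite r0 !mulr0 !mul0r.
  rewrite (_ : - s + k.+1%:R = 1 - s + k%:R); last by rewrite -natr1; ring.
  rewrite Gamma_posDn// /= factS natrM.
  have f1 : k`!%:R != 0 :> R by rewrite pnatr_eq0 -lt0n fact_gt0.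
  have f2 : k.+1%:R != 0 :> R by rewrite pnatr_eq0.
  have f3 : s != 0 by rewrite gt_eqF.
  by move: (k.+1%:R) f2 => K K0; field; rewrite f1 K0 f3.
by rewrite fine_mulr// mulrA mulVf ?mul1r// gt_eqF.
Qed.

End Potential.

(** * Energy of truncated potentials *)

Section Finite_sums.
Context {R : realType}.
Local Open Scope ereal_scope.

Lemma esum_ord (F : nat -> \bar R) M : (forall n, 0 <= F n) ->
  \esum_(n in [set: nat]) (if (n < M)%N then F n else 0) = \sum_(n < M) F n.
Proof.
move=> F0; rewrite (fsbig_ord _ _ F) -esum_fset; [|exact: finite_II|by move=> *].
rewrite [RHS]esum_mkcond; apply: eq_esum => n _.
by case: ifPn => nM; [rewrite mem_set|rewrite memNset//; exact/negP].
Qed.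

Lemma sum_le_esum (F : nat -> \bar R) M : (forall n, 0 <= F n) ->
  \sum_(n < M) F n <= \esum_(n in [set: nat]) F n.
Proof.
by move=> F0; rewrite -esum_ord//; apply: le_esum => n _; case: ifP.
Qed.

Lemma esum_le_ord (F : nat -> \bar R) (C : \bar R) : (forall n, 0 <= F n) ->
  (forall M, \sum_(n < M) F n <= C) -> \esum_(n in [set: nat]) F n <= C.
Proof.
move=> F0 FC; rewrite -nneseries_esumT//.
apply: lime_le; first exact: is_cvg_nneseries.
by apply: nearW => M; rewrite big_mkord.
Qed.

End Finite_sums.

Section Kernel.
Context {R : realType} {d : nat}.
Variable B : Zd d -> R.
Hypotheses (B_ge0 : forall x, 0 <= B x) (BN : forall x, B (- x) = B x).
Hypothesis B_sum1 :
  forall x, (\esum_(y in [set: Zd d]) (B (x - y)%R)%:E = 1)%E.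

Lemma kernel_sum1 (g : Zd d -> R) : (forall x, 0 <= g x) ->
  (\esum_(p in [set: Zd d * Zd d]) (B (p.1 - p.2) * g p.1)%:E =
   \esum_(x in [set: Zd d]) (g x)%:E)%E.
Proof.
move=> g0; rewrite (@esum_pair _ _ _ (fun x y => (B (x - y) * g x)%:E)); last first.
  by move=> x y; rewrite lee_fin mulr_ge0.
apply: eq_esum => x _; under eq_esum do rewrite mulrC EFinM.
by rewrite esumZ// ?B_sum1 ?mule1// => y; rewrite lee_fin.
Qed.

Lemma kernel_swap (F : Zd d -> Zd d -> R) :
  (\esum_(p in [set: Zd d * Zd d]) (B (p.1 - p.2) * F p.1 p.2)%:E =
   \esum_(p in [set: Zd d * Zd d]) (B (p.1 - p.2) * F p.2 p.1)%:E)%E.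
Proof.
rewrite (@reindex_esumT _ _ _ (fun p => (p.2, p.1)) (fun p => (p.2, p.1))) => [|[]|[]]//.
by apply: eq_esum => -[x y] _ /=; rewrite -BN opprB.
Qed.

End Kernel.

Section Energy.
Context {R : realType} {d : nat}.
Hypothesis d0 : (0 < d)%N.
Variable s : R.
Hypotheses (s0 : 0 < s) (s1 : s <= 1).
Implicit Types (x y : Zd d) (a : nat -> R).

Let r j : R := rw j (0 : Zd d).
Let D j : R := r j - r j.+1.
(** By [sum_jump] and [esum_jump] this is the tail probability of a jump larger than [i]. *)
Let tau i : R := bcoef (1 - s) i.

Let r_ge0 j : 0 <= r j. Proof. exact: rw_ge0. Qed.

Let tau_ge0 i : 0 <= tau i.
Proof. by rewrite bcoef_ge0// subr_ge0. Qed.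

Let jp_ge0 k : 0 <= jump s k.
Proof. exact: jump_ge0 (ltW s0) s1. Qed.

(** One step averages [rw j] over the origin and its neighbours, and the origin carries the
    maximum. *)
Let D_ge0 j : 0 <= D j.
Proof.
rewrite subr_ge0 /r rwS ler_pdivrMr ?deg_gt0//.
apply: (@le_trans _ _ (\sum_(i < d) 4 * rw j (0 : Zd d))).
  apply: ler_sum => i _.
  have h1 := rw_le_return d0 j (0 + unitv d i) (R := R).
  have h2 := rw_le_return d0 j (0 - unitv d i) (R := R).
  by lra.
by rewrite sumr_const card_ord -mulr_natr /deg le_eqVlt; apply/orP; left; apply/eqP; ring.
Qed.

(** Summation by parts: [jump s n.+1] is the decrement of [tau], and [D] that of [r]. *)
Let abel j n : \sum_(i < n.+1) tau i * D (j + i)%N + \sum_(k < n.+1) jump s k * r (j + k)%N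
  + tau n * r (j + n).+1 = r j.
Proof.
elim: n => [|n IH].
  by rewrite !big_ord1 /tau bcoef0 /D addn0 /=; ring.
rewrite big_ord_recr [X in _ + X + _]big_ord_recr /=.
have e : tau n.+1 + jump s n.+1 = tau n.
  have := bcoefD1 (- s) n; rewrite [- s + 1]addrC -/(tau _) -/(tau _).
  by rewrite jump_bcoef sub0r => e; lra.
by move: e => /= e; rewrite -[RHS]IH -e /D addnS; ring.
Qed.

(** Nonnegative series for [r j - \sum_k jump s k * r (j + k)], the value at the origin of
    [(1 - P)^s P^j 1_0]. *)
Definition dissip j : \bar R := (\esum_(i in [set: nat]) (tau i * D (j + i))%:E)%E.

Let dissip_term i j : (0 <= (tau i * D (j + i))%:E)%E.
Proof. by rewrite lee_fin mulr_ge0. Qed.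

Lemma dissip_ge0 j : (0 <= dissip j)%E.
Proof. by apply: esum_ge0 => i _; exact: dissip_term. Qed.

(** Limit of [abel]: its remainder is at most [tau n], which tends to 0. *)
Lemma return_le_dissip j : ((r j)%:E <=
  dissip j + \esum_(k in [set: nat]) (jump s k * r (j + k))%:E)%E.
Proof.
have jr k : (0 <= (jump s k * r (j + k))%:E)%E by rewrite lee_fin mulr_ge0.
apply/lee_addgt0Pr => e e0.
have [n _ /(_ n (leqnn n)) tn] := cvgr_lt 0 (bcoef_cvg0 s0 s1) e e0.
rewrite -(abel j n) !EFinD; apply: leeD; first apply: leeD.
- rewrite -sumEFin; apply: (@sum_le_esum _ (fun i => (tau i * D (j + i))%:E)) => i.
  exact: dissip_term.
- rewrite -sumEFin; exact: (@sum_le_esum _ (fun k => (jump s k * r (j + k))%:E)).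
- rewrite lee_fin; apply: le_trans (ltW tn); apply: ler_piMr; first exact: tau_ge0.
  exact: rw_le1.
Qed.

(** Regrouping gives [\sum_m bcoef (t - s + 1) m * D m], because [tau] has order [1 - s]. The same
    series arises from [bcoef (t - s)] paired with the telescoping tails of [D], each at most a
    return probability. This lowers the order from [t] to [t - s]. *)
Lemma esum_dissip_lty t : s < t -> t - s < d%:R / 2 ->
  (\esum_(j in [set: nat]) ((bcoef t j)%:E * dissip j) < +oo)%E.
Proof.
move=> st td; have ts0 : 0 < t - s by rewrite subr_gt0.
have t0 : 0 < t by exact: lt_trans st.
have bt0 j : 0 <= bcoef t j by exact/bcoef_ge0/ltW.
have bts0 j : 0 <= bcoef (t - s) j by exact/bcoef_ge0/ltW.
have tele k : (\esum_(i in [set: nat]) (D (k + i))%:E <= (r k)%:E)%E.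
  apply: esum_le_ord => [i|M]; first by rewrite lee_fin.
  rewrite sumEFin lee_fin.
  have -> : \sum_(n < M) D (k + n)%N = r k - r (k + M)%N.
    elim: M => [|M IH]; first by rewrite big_ord0 addn0 subrr.
    by rewrite big_ord_recr /= IH /D addnS; ring.
  by rewrite lerBlDr lerDl.
apply: (@le_lt_trans _ _ (\esum_(k in [set: nat]) (bcoef (t - s) k * r k)%:E)%E); last first.
  exact: esum_bcoef_rw_lty.
apply: (@le_trans _ _ (\esum_(k in [set: nat])
    ((bcoef (t - s) k)%:E * \esum_(i in [set: nat]) (D (k + i))%:E))%E); last first.
  apply: le_esum => k _; rewrite EFinM; apply: lee_wpmul2l; first by rewrite lee_fin.
  exact: tele.
have lhs : (\esum_(j in [set: nat]) ((bcoef t j)%:E * dissip j) =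
    \esum_(m in [set: nat]) (bcoef (t - s + 1) m * D m)%:E)%E.
  transitivity (\esum_(j in [set: nat]) \esum_(i in [set: nat])
      (bcoef t j * (tau i * D (j + i)%N))%:E)%E.
    apply: eq_esum => j _; rewrite -esumZ; [|exact: bt0|by move=> i; exact: dissip_term].
    by apply: eq_esum => i _; rewrite EFinM.
  rewrite esum_antidiag; last by move=> j i; rewrite lee_fin !mulr_ge0.
  apply: eq_esum => m _; rewrite sumEFin; congr EFin.
  rewrite (_ : t - s + 1 = t + (1 - s)); last by ring.
  rewrite -bcoefD mulr_suml; apply: eq_bigr => k _.
  by rewrite subnKC ?mulrA// -ltnS.
have rhs : (\esum_(k in [set: nat])
    ((bcoef (t - s) k)%:E * \esum_(i in [set: nat]) (D (k + i))%:E) =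
    \esum_(m in [set: nat]) (bcoef (t - s + 1) m * D m)%:E)%E.
  transitivity (\esum_(j in [set: nat]) \esum_(i in [set: nat])
      (bcoef (t - s) j * D (j + i)%N)%:E)%E.
    apply: eq_esum => j _; rewrite -esumZ; [|exact: bts0|by move=> i; rewrite lee_fin].
    by apply: eq_esum => i _; rewrite EFinM.
  rewrite esum_antidiag; last by move=> j i; rewrite lee_fin !mulr_ge0.
  apply: eq_esum => m _; rewrite sumEFin; congr EFin.
  rewrite -bcoef_sum mulr_suml; apply: eq_bigr => k _.
  by rewrite subnKC// -ltnS.
by rewrite lhs rhs.
Qed.

Let B x : R := fine (pot (jump s) x).

Lemma pot_jump_fin x : pot (jump s) x = (B x)%:E.
Proof.
rewrite fineK// ge0_fin_numE ?pot_ge0//; apply: (@le_lt_trans _ _ 1%E); last exact: ltry.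
rewrite -(esum_jump s0 s1); apply: le_esum => n _; rewrite lee_fin ler_piMr//.
exact: rw_le1.
Qed.

Let B_ge0 x : 0 <= B x. Proof. by rewrite fine_ge0// pot_ge0. Qed.

Let BN x : B (- x) = B x. Proof. by rewrite /B potN. Qed.

Lemma esum_B x : (\esum_(y in [set: Zd d]) (B (x - y))%:E = 1)%E.
Proof.
by under eq_esum do rewrite -pot_jump_fin; exact: esum_pot_jump.
Qed.

(* The truncations [\sum_(N <= n < M) bcoef al n * rw n x] approximate the
   ground state; their energy is controlled by a tail of a convergent series. *)
Definition trunc a N M n : R := if (N <= n < M)%N then a n else 0.

(** With [g] the Cauchy square of the truncated coefficients, [\sum f^2] and the kernel term both
    become series in [g] and the return probabilities; half the energy is their difference, hence at
    most [\sum_j g j * dissip j]. Here [g] vanishes below [N] and is dominated by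
    [bcoef (2 * al)]. *)
Lemma energy_trunc al N M (f : Zd d -> R) : 0 < al ->
  (forall x, pot (trunc (bcoef al) N M) x = (f x)%:E) ->
  finite_set [set x | f x != 0] ->
  (\esum_(p in [set: Zd d * Zd d]) (B (p.1 - p.2) * (f p.1 - f p.2) ^+ 2)%:E <=
   2%:E * \esum_(j in [set: nat])
     (if (j < N)%N then 0 else (bcoef (2 * al) j)%:E * dissip j))%E.
Proof.
move=> al0 fE fin; set aI := trunc (bcoef al) N M in fE.
have ba0 n : 0 <= bcoef al n by exact/bcoef_ge0/ltW.
have aI0 n : 0 <= aI n by rewrite /aI /trunc; case: ifP.
have f0 x : 0 <= f x by rewrite -lee_fin -fE pot_ge0.
pose g := cauchy_product aI aI.
have g0 n : 0 <= g n by apply: sumr_ge0 => k _; exact: mulr_ge0.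
have fN x : f (- x) = f x by apply: EFin_inj; rewrite -!fE potN.
have ptfin y : (pot aI y < +oo)%E by rewrite fE ltry.
have Yfin : (\esum_(x in [set: Zd d]) (f x ^+ 2)%:E < +oo)%E.
  apply: esum_fin_lt => [x|]; first exact: sqr_ge0.
  by apply: (sub_finite_set _ fin) => x /=; rewrite sqrf_eq0.
have conv z : (\esum_(y in [set: Zd d]) (f (z + y) * f y)%:E = pot g z)%E.
  rewrite -potN -(pot_conv d0 _ aI0 aI0 ptfin); apply: eq_esum => y _.
  by rewrite !fE -EFinM -opprD fN.
have gfin (z : Zd d) : (pot g z < +oo)%E.
  apply: (pot_lty d0 _ g0); rewrite -conv; apply: le_lt_trans Yfin.
  by apply: le_esum => y _; rewrite add0r expr2.
have YE : (\esum_(x in [set: Zd d]) (f x ^+ 2)%:E = pot g (0%R : Zd d))%E.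
  by rewrite -conv; apply: eq_esum => y _; rewrite add0r expr2.
have XE : (\esum_(p in [set: Zd d * Zd d]) (B (p.1 - p.2) * (f p.1 * f p.2))%:E =
    \esum_(j in [set: nat]) ((g j)%:E * \esum_(k in [set: nat]) (jump s k * r (j + k))%:E))%E.
  rewrite (@reindex_esumT _ (Zd d * Zd d)%type _
    (fun p : Zd d * Zd d => (p.1 + p.2, p.2)) (fun p => (p.1 - p.2, p.2))); last 2 first.
  - by move=> [x y] /=; rewrite addrK.
  - by move=> [x y] /=; rewrite subrK.
  rewrite (@esum_pair _ _ _ (fun z y => (B (z + y - y) * (f (z + y) * f y))%:E)); last first.
    by move=> z y; rewrite lee_fin !mulr_ge0.
  transitivity (\esum_(z in [set: Zd d]) (pot (jump s) (0 - z)%R * pot g z))%E.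
    apply: eq_esum => z _; under eq_esum do rewrite addrK EFinM.
    rewrite esumZ//; last by move=> y; rewrite lee_fin mulr_ge0.
    by rewrite conv sub0r potN pot_jump_fin.
  rewrite pot_conv// /pot.
  transitivity (\esum_(k in [set: nat]) \esum_(j in [set: nat])
      (jump s k * g j * r (k + j))%:E)%E.
    rewrite esum_antidiag; last by move=> k j; rewrite lee_fin !mulr_ge0.
    apply: eq_esum => m _; rewrite sumEFin; congr EFin.
    rewrite /cauchy_product mulr_suml; apply: eq_bigr => k _.
    by rewrite subnKC// -ltnS.
  rewrite exchange_esum; last by move=> k j; rewrite lee_fin !mulr_ge0.
  apply: eq_esum => j _; rewrite -esumZ; [|exact: g0|by move=> k; rewrite lee_fin mulr_ge0].
  by apply: eq_esum => k _; rewrite -EFinM; congr EFin; rewrite addnC; ring.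
set X := (\esum_(p in _) (B _ * (f _ * f _))%:E)%E in XE.
set Q := (\esum_(p in _) _)%E; set Y := (\esum_(x in _) _)%E in Yfin YE.
have X0 : (0 <= X)%E by apply: esum_ge0 => p _; rewrite lee_fin !mulr_ge0.
have Q0 : (0 <= Q)%E by apply: esum_ge0 => p _; rewrite lee_fin mulr_ge0// sqr_ge0.
(* Expanded square with the cross term moved to the left; it is cancelled only after finite support
   has shown [X] finite. *)
have id : (Q + 2%:E * X = 2%:E * Y)%E.
  have e1 := kernel_sum1 B_ge0 esum_B (fun x => sqr_ge0 (f x)).
  have e2 : (\esum_(p in [set: Zd d * Zd d]) (B (p.1 - p.2) * f p.2 ^+ 2)%:E = Y)%E.
    by rewrite (kernel_swap BN (fun x y => f y ^+ 2)) e1.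
  rewrite -[in LHS]esumZ//; last by move=> p; rewrite lee_fin !mulr_ge0.
  rewrite -esumD; last 2 first.
  - by move=> p _; rewrite lee_fin mulr_ge0// sqr_ge0.
  - by move=> p _; rewrite -EFinM lee_fin !mulr_ge0.
  rewrite (_ : (2%:E * Y = Y + Y)%E); last first.
    by rewrite (_ : 2 = 1 + 1 :> R)// EFinD ge0_muleDl ?lee_fin// mul1e.
  rewrite -[X in (_ = X + _)%E]e1 -[X in (_ = _ + X)%E]e2 -esumD; last 2 first.
  - by move=> p _; rewrite lee_fin mulr_ge0// sqr_ge0.
  - by move=> p _; rewrite lee_fin mulr_ge0// sqr_ge0.
  by apply: eq_esum => p _; rewrite -EFinM -!EFinD; congr EFin; ring.
have g_le j : g j <= bcoef (2 * al) j.
  rewrite (_ : 2 * al = al + al); last by ring.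
  rewrite -bcoefD; apply: ler_sum => k _; rewrite /aI /trunc.
  by case: ifP; case: ifP => _ _; rewrite ?mul0r ?mulr0 ?mulr_ge0.
have g_lt j : (j < N)%N -> g j = 0.
  move=> jN; rewrite /g /cauchy_product big1// => k _; rewrite /aI /trunc.
  rewrite (_ : (N <= k < M)%N = false) ?mul0r//.
  by apply/negP => /andP[Nk _]; have := leq_ltn_trans Nk (ltn_ord k); rewrite ltnS leqNgt jN.
have YX : (Y <= \esum_(j in [set: nat]) ((g j)%:E * dissip j) + X)%E.
  rewrite YE XE -esumD; last 2 first.
  - by move=> j _; apply: mule_ge0; rewrite ?lee_fin ?dissip_ge0.
  - move=> j _; apply: mule_ge0; rewrite ?lee_fin//.
    by apply: esum_ge0 => k _; rewrite lee_fin mulr_ge0.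
  apply: le_esum => j _; rewrite EFinM -ge0_muleDr ?dissip_ge0//; last first.
    by apply: esum_ge0 => k _; rewrite lee_fin mulr_ge0.
  by apply: lee_wpmul2l; [rewrite lee_fin|exact: return_le_dissip].
have gC : (\esum_(j in [set: nat]) ((g j)%:E * dissip j) <= \esum_(j in [set: nat])
     (if (j < N)%N then 0 else (bcoef (2 * al) j)%:E * dissip j))%E.
  apply: le_esum => j _; case: ifPn => [jN|_]; first by rewrite g_lt// mul0e.
  by apply: lee_wpmul2r; rewrite ?dissip_ge0// lee_fin.
have Xfin : X \is a fin_num.
  rewrite ge0_fin_numE//; apply: le_lt_trans Yfin.
  have : (2%:E * X <= 2%:E * Y)%E by rewrite -id leeDr.
  by rewrite lee_pmul2l.
apply: (@le_trans _ _ (2%:E * \esum_(j in [set: nat]) ((g j)%:E * dissip j))%E); last first.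
  exact: lee_wpmul2l.
rewrite -(@leeD2rE _ (2%:E * X)%E); last by rewrite fin_numM.
by rewrite id -ge0_muleDr//; [apply: lee_wpmul2l|apply: esum_ge0 => j _; apply: mule_ge0;
  rewrite ?lee_fin ?dissip_ge0].
Qed.

End Energy.

(** * Ground state transform *)

Lemma Zd_ind d (P : Zd d -> Prop) : P 0 ->
  (forall x i, P x -> P (x + unitv d i) /\ P (x - unitv d i)) ->
  forall x, P x.
Proof.
move=> P0 PS x.
have step i (z : int) y : P y -> P (y + z *: unitv d i).
  elim/int_ind: z y => [|n IH|n IH] y Py; first by rewrite scale0r addr0.
    by rewrite intS scalerDl scale1r addrA; apply: IH; apply: (PS _ _ _).1.
  by rewrite intS opprD scalerDl scaleN1r addrA; apply: IH; apply: (PS _ _ _).2.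
have -> : x = \sum_i x 0 i *: unitv d i by exact: row_sum_delta.
elim: (index_enum _) => [|i s IH]; first by rewrite big_nil.
by rewrite big_cons addrC; exact: step.
Qed.

Section Ground_state.
Context {R : realType} {d : nat}.
Variables (B u v : Zd d -> R).
Hypotheses (B_ge0 : forall x, 0 <= B x) (BN : forall x, B (- x) = B x).
Hypothesis B_sum1 :
  forall x, (\esum_(y in [set: Zd d]) (B (x - y)%R)%:E = 1)%E.
Hypotheses (u_gt0 : forall x, 0 < u x) (v_ge0 : forall x, 0 <= v x).
Hypothesis Buv : forall x,
  (\esum_(y in [set: Zd d]) (B (x - y)%R * u y)%:E + (v x)%:E = (u x)%:E)%E.
Implicit Types (x y : Zd d) (f g : Zd d -> R).

Definition energy f : \bar R :=
  (\esum_(p in [set: Zd d * Zd d]) (B (p.1 - p.2)%R * (f p.1 - f p.2) ^+ 2)%:E)%E.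

Definition gs_term f (p : Zd d * Zd d) : R :=
  B (p.1 - p.2) * (u p.1 * u p.2 * (f p.1 / u p.1 - f p.2 / u p.2) ^+ 2).

Definition gs_energy f : \bar R :=
  (\esum_(p in [set: Zd d * Zd d]) (gs_term f p)%:E)%E.

Lemma energy_term_ge0 f (p : Zd d * Zd d) :
  0 <= B (p.1 - p.2) * (f p.1 - f p.2) ^+ 2.
Proof. by rewrite mulr_ge0// sqr_ge0. Qed.

Lemma gs_term_ge0 f p : 0 <= gs_term f p.
Proof. by rewrite mulr_ge0// mulr_ge0 ?sqr_ge0// mulr_ge0// ltW. Qed.

Lemma energy_ge0 f : (0 <= energy f)%E.
Proof. by apply: esum_ge0 => p _; rewrite lee_fin energy_term_ge0. Qed.

Lemma gs_energy_ge0 f : (0 <= gs_energy f)%E.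
Proof. by apply: esum_ge0 => p _; rewrite lee_fin gs_term_ge0. Qed.

Lemma kernel_u x : (\esum_(y in [set: Zd d]) (B (x - y)%R * u y)%:E = (u x - v x)%:E)%E.
Proof.
by have := Buv x => /(congr1 (fun e => e - (v x)%:E)%E); rewrite addeK.
Qed.

Lemma v_le_u x : v x <= u x.
Proof.
rewrite -subr_ge0 -lee_fin -kernel_u; apply: esum_ge0 => y _.
by rewrite lee_fin mulr_ge0// ltW.
Qed.

Let q x := v x / u x.

Let q_ge0 x : 0 <= q x. Proof. by rewrite divr_ge0// ltW. Qed.

Let q_le1 x : 0 <= 1 - q x.
Proof. by rewrite subr_ge0 ler_pdivrMr// mul1r v_le_u. Qed.

(* Pointwise this is [(a - b)^2 + a^2 (u_y / u_x) + b^2 (u_x / u_y)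
   = u_x u_y (a / u_x - b / u_y)^2 + a^2 + b^2], all terms being nonnegative. *)
Lemma ground_state_identity f :
  (energy f + 2%:E * (\esum_(x in [set: Zd d]) (f x ^+ 2 * (1 - v x / u x))%:E) =
   gs_energy f + 2%:E * \esum_(x in [set: Zd d]) (f x ^+ 2)%:E)%E.
Proof.
pose F x y : R := f x ^+ 2 * (u y / u x).
have F0 x y : 0 <= F x y by rewrite mulr_ge0 ?sqr_ge0// divr_ge0// ltW.
have S1 : (\esum_(p in [set: Zd d * Zd d]) (B (p.1 - p.2)%R * F p.1 p.2)%:E =
    \esum_(x in [set: Zd d]) (f x ^+ 2 * (1 - v x / u x))%:E)%E.
  rewrite (@esum_pair _ _ _ (fun x y => (B (x - y)%R * F x y)%:E)); last first.
    by move=> x y; rewrite lee_fin mulr_ge0.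
  apply: eq_esum => x _; have un0 : u x != 0 by rewrite gt_eqF.
  transitivity (\esum_(y in [set: Zd d]) ((f x ^+ 2 / u x)%:E * (B (x - y)%R * u y)%:E))%E.
    by apply: eq_esum => y _; rewrite -EFinM; congr EFin; rewrite /F; ring.
  rewrite esumZ; last 2 first.
  - by rewrite divr_ge0 ?sqr_ge0// ltW.
  - by move=> y; rewrite lee_fin mulr_ge0// ltW.
  by rewrite kernel_u -EFinM; congr EFin; field.
have S2 := S1; rewrite (kernel_swap BN F) in S2.
have T1 := kernel_sum1 B_ge0 B_sum1 (fun x => sqr_ge0 (f x)).
have T2 := T1; rewrite (kernel_swap BN (fun x y => f x ^+ 2)) /= in T2.
have two (e : \bar R) : (0 <= e -> 2%:E * e = e + e)%E.
  by move=> e0; rewrite (_ : 2 = 1 + 1 :> R)// EFinD ge0_muleDl ?lee_fin// mul1e.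
rewrite !two; last 2 first.
- by apply: esum_ge0 => x _; rewrite lee_fin sqr_ge0.
- by apply: esum_ge0 => x _; rewrite lee_fin mulr_ge0 ?sqr_ge0 ?q_le1.
rewrite -[X in (_ + (X + _) = _)%E]S1 -[X in (_ + (_ + X) = _)%E]S2.
rewrite -[X in (_ = _ + (X + _))%E]T1 -[X in (_ = _ + (_ + X))%E]T2.
have BF p : (0 <= (B (p.1 - p.2)%R * F p.1 p.2)%:E)%E by rewrite lee_fin mulr_ge0.
have BF' p : (0 <= (B (p.1 - p.2)%R * F p.2 p.1)%:E)%E by rewrite lee_fin mulr_ge0.
have Bf (p : Zd d * Zd d) x : (0 <= (B (p.1 - p.2)%R * f x ^+ 2)%:E)%E.
  by rewrite lee_fin mulr_ge0// sqr_ge0.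
rewrite -esumD; [|by move=> p _; exact: BF|by move=> p _; exact: BF'].
rewrite -esumD; [|by move=> p _; rewrite lee_fin energy_term_ge0|
  by move=> p _; apply: adde_ge0; [exact: BF|exact: BF']].
rewrite -esumD; [|by move=> p _; exact: Bf|by move=> p _; exact: Bf].
rewrite -esumD; [|by move=> p _; rewrite lee_fin gs_term_ge0|
  by move=> p _; apply: adde_ge0; exact: Bf].
apply: eq_esum => p _; rewrite -!EFinD; congr EFin; rewrite /gs_term /F.
have un1 : u p.1 != 0 by rewrite gt_eqF.
have un2 : u p.2 != 0 by rewrite gt_eqF.
by field; rewrite un1 un2.
Qed.

(** Finite support makes the common part of both sides of [ground_state_identity] finite, so that it
    cancels. *)
Lemma energy_Cc f : Cc d f ->
  energy f = (gs_energy f + 2%:E * \esum_(x in [set: Zd d]) (f x ^+ 2 * (v x / u x))%:E)%E.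
Proof.
move=> fC; have ffin : (\esum_(x in [set: Zd d]) (f x ^+ 2)%:E < +oo)%E.
  apply: esum_fin_lt => [x|]; first exact: sqr_ge0.
  by apply: (sub_finite_set _ fC) => x /=; rewrite sqrf_eq0.
have := ground_state_identity f.
set T := (\esum_(x in _) (f x ^+ 2 * (1 - v x / u x))%:E)%E.
set W := (\esum_(x in _) (f x ^+ 2 * (v x / u x))%:E)%E.
have T0 : (0 <= T)%E.
  by apply: esum_ge0 => x _; rewrite lee_fin mulr_ge0 ?sqr_ge0 ?q_le1.
have W0 : (0 <= W)%E.
  by apply: esum_ge0 => x _; rewrite lee_fin mulr_ge0 ?sqr_ge0 ?q_ge0.
have -> : (\esum_(x in [set: Zd d]) (f x ^+ 2)%:E = W + T)%E.
  rewrite -esumD; [|by move=> x _; rewrite lee_fin mulr_ge0 ?sqr_ge0 ?q_ge0|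
    by move=> x _; rewrite lee_fin mulr_ge0 ?sqr_ge0 ?q_le1].
  by apply: eq_esum => x _; rewrite -EFinD; congr EFin; ring.
have Tfin : (2%:E * T \is a fin_num)%E.
  rewrite fin_numM// ge0_fin_numE//; apply: le_lt_trans ffin.
  apply: le_esum => x _; rewrite lee_fin ler_piMr ?sqr_ge0//.
  by rewrite lerBlDr lerDl q_ge0.
rewrite ge0_muleDr// addeA => /(congr1 (fun e => e - 2%:E * T)%E).
by rewrite !addeK.
Qed.

(** Young's inequality in each term. It stands in for the triangle inequality of the seminorm and
    stays with squares; [e] is sent to 0 later. *)
Lemma energy_quasi_triangle f g e : 0 < e -> (energy g <=
  (1 + e)%:E * energy f + (1 + e^-1)%:E * energy (fun x => (g x - f x)%R))%E.
Proof.
move=> e0; have e1 : 0 <= 1 + e by rewrite addr_ge0// ltW.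
have e2 : 0 <= 1 + e^-1 by rewrite addr_ge0// invr_ge0 ltW.
rewrite -!esumZ//; [|by move=> p; rewrite lee_fin (energy_term_ge0 (fun x => g x - f x))|
  by move=> p; rewrite lee_fin energy_term_ge0].
rewrite -esumD; [|by move=> p _; rewrite -EFinM lee_fin mulr_ge0 ?energy_term_ge0|
  by move=> p _; rewrite -EFinM lee_fin mulr_ge0 ?(energy_term_ge0 (fun x => g x - f x))].
apply: le_esum => p _; rewrite -!EFinM -EFinD lee_fin.
rewrite [leRHS](_ : _ = B (p.1 - p.2) * ((1 + e) * (f p.1 - f p.2) ^+ 2 +
  (1 + e^-1) * (g p.1 - f p.1 - (g p.2 - f p.2)) ^+ 2)); last by ring.
apply: ler_wpM2l => //; move: (f p.1) (f p.2) (g p.1) (g p.2) => a b a' b'.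
rewrite -subr_ge0 [leRHS](_ : _ = e^-1 * (e * (a - b) - ((a' - a) - (b' - b))) ^+ 2).
  by rewrite mulr_ge0 ?sqr_ge0// invr_ge0 ltW.
by field; rewrite gt_eqF.
Qed.

Hypothesis B_nbr : forall i, 0 < B (unitv d i).

(** Point evaluations are bounded in the form norm, by induction along a lattice path from 0. Hence
    convergence in the form norm implies pointwise convergence. *)
Lemma point_bound x : exists2 K, 0 < K & forall f,
  ((f x ^+ 2)%:E <= K%:E * (energy f + (f 0 ^+ 2)%:E))%E.
Proof.
have tot0 f : (0 <= energy f + (f 0%R ^+ 2)%:E)%E.
  by rewrite adde_ge0 ?energy_ge0// lee_fin sqr_ge0.
have nbr y z k : 0 < k -> B (z - y) = k -> (exists2 K, 0 < K & forall f,
    ((f y ^+ 2)%:E <= K%:E * (energy f + (f 0%R ^+ 2)%:E))%E) ->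
    exists2 K, 0 < K & forall f,
    ((f z ^+ 2)%:E <= K%:E * (energy f + (f 0%R ^+ 2)%:E))%E.
  (* From [f z ^+ 2 <= 2 f y ^+ 2 + 2 (f z - f y) ^+ 2]: the energy contains the single term
     [k (f z - f y) ^+ 2]. *)
  move=> k0 Bk [K K0 KP]; exists (2 * K + 2 / k).
    by rewrite addr_gt0 ?mulr_gt0 ?invr_gt0.
  move=> f; have tn := tot0 f.
  rewrite EFinD ge0_muleDl ?lee_fin ?mulr_ge0 ?invr_ge0 ?(ltW k0) ?(ltW K0)//.
  apply: (@le_trans _ _ (2%:E * (f y ^+ 2)%:E + (2 / k)%:E * (k * (f z - f y) ^+ 2)%:E)%E).
    rewrite -!EFinM -EFinD lee_fin.
    rewrite [leRHS](_ : _ = 2 * f y ^+ 2 + 2 * (f z - f y) ^+ 2); last first.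
      by field; rewrite gt_eqF.
    have := sqr_ge0 (f z - 2 * f y); move: (f z) (f y) => a b; rewrite !expr2 => h; lra.
  apply: leeD.
    by rewrite [(2 * K)%:E]EFinM -muleA; apply: lee_wpmul2l => //; exact: KP.
  apply: lee_wpmul2l; first by rewrite lee_fin divr_ge0// ltW.
  apply: (@le_trans _ _ (energy f)); last by rewrite leeDl// lee_fin sqr_ge0.
  have := @le_esum_term R (Zd d * Zd d)%type
    (fun p => (B (p.1 - p.2)%R * (f p.1 - f p.2) ^+ 2)%:E) (z, y).
  by rewrite /= Bk; apply => p; rewrite lee_fin energy_term_ge0.
elim/Zd_ind: x => [|x i IH].
  by exists 1 => // f; rewrite mul1e leeDr// energy_ge0.
split; apply: (nbr _ _ _ (B_nbr i)) IH; first by rewrite addrC addKr.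
by rewrite -BN opprB opprB addrC subrK.
Qed.

(** * The Hardy inequality and its extension to the form domain *)

Variables (sigma c : R) (w : Zd d -> R).
Hypothesis c_gt0 : 0 < c.
Hypothesis kappaE : forall x, x != 0 -> kappa d sigma x = c * B x.
Hypothesis wE : forall x, w x = c * (v x / u x).

(** [kappaE] excludes the origin, where the jump kernel is positive in the application but [kappa]
    vanishes. Diagonal differences are 0, so the forms still agree. *)
Lemma QformE f : Qform d sigma f = ((c / 2)%:E * energy f)%E.
Proof.
rewrite /Qform; have -> : (\esum_(p in [set: Zd d * Zd d])
    (kappa d sigma (p.1 - p.2)%R * (f p.1 - f p.2) ^+ 2)%:E = c%:E * energy f)%E.
  rewrite -esumZ; [|exact: ltW|by move=> p; rewrite lee_fin energy_term_ge0].
  apply: eq_esum => -[x y] _ /=; rewrite -EFinM; congr EFin.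
  have [->|xy] := eqVneq x y; first by rewrite (subrr (f y)) expr0n /= !mulr0.
  by rewrite kappaE ?subr_eq0// -mulrA.
by rewrite muleA -EFinM mulrC.
Qed.

Lemma wsumE f : wsum d w f =
  (c%:E * \esum_(x in [set: Zd d]) (f x ^+ 2 * (v x / u x))%:E)%E.
Proof.
rewrite -esumZ ?(ltW c_gt0)//; last first.
  by move=> x; rewrite lee_fin mulr_ge0 ?sqr_ge0 ?q_ge0.
by apply: eq_esum => x _; rewrite -EFinM wE; congr EFin; ring.
Qed.

Lemma w_ge0 x : 0 <= w x.
Proof. by rewrite wE mulr_ge0 ?(ltW c_gt0) ?q_ge0. Qed.

Lemma wsum_ge0 f : (0 <= wsum d w f)%E.
Proof. by apply: esum_ge0 => x _; rewrite lee_fin mulr_ge0 ?sqr_ge0 ?w_ge0. Qed.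

Lemma Qform_Cc f : Cc d f ->
  Qform d sigma f = ((c / 2)%:E * gs_energy f + wsum d w f)%E.
Proof.
move=> fC; rewrite QformE energy_Cc// ge0_muleDr ?gs_energy_ge0//; last first.
  apply: mule_ge0 => //; apply: esum_ge0 => x _.
  by rewrite lee_fin mulr_ge0 ?sqr_ge0 ?q_ge0.
by rewrite wsumE muleA -EFinM divfK.
Qed.

Lemma ground_state_hardy : hardy_weight d sigma w.
Proof.
split=> [x|f fC]; first exact: w_ge0.
rewrite Qform_Cc// leeDr// mule_ge0 ?gs_energy_ge0// lee_fin.
by rewrite divr_ge0// ltW.
Qed.

Lemma Qform_ge0 f : (0 <= Qform d sigma f)%E.
Proof. by rewrite QformE mule_ge0 ?energy_ge0// lee_fin divr_ge0// ltW. Qed.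

Lemma energy_Cc_lty f : Cc d f -> (energy f < +oo)%E.
Proof.
move=> fC; have ffin : (\esum_(x in [set: Zd d]) (f x ^+ 2)%:E < +oo)%E.
  apply: esum_fin_lt => [x|]; first exact: sqr_ge0.
  by apply: (sub_finite_set _ fC) => x /=; rewrite sqrf_eq0.
have T1 := kernel_sum1 B_ge0 B_sum1 (fun x => sqr_ge0 (f x)).
have T2 := T1; rewrite (kernel_swap BN (fun x y => f x ^+ 2)) /= in T2.
have Bf (p : Zd d * Zd d) x : (0 <= (B (p.1 - p.2)%R * f x ^+ 2)%:E)%E.
  by rewrite lee_fin mulr_ge0// sqr_ge0.
apply: (@le_lt_trans _ _ (2%:E * (\esum_(p in [set: Zd d * Zd d])
   ((B (p.1 - p.2)%R * f p.1 ^+ 2)%:E + (B (p.1 - p.2)%R * f p.2 ^+ 2)%:E)))%E).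
  rewrite -esumZ//; last by move=> p; apply: adde_ge0.
  apply: le_esum => p _; rewrite -EFinD -EFinM lee_fin.
  rewrite [leRHS](_ : _ = B (p.1 - p.2) * (2 * (f p.1 ^+ 2 + f p.2 ^+ 2))); last by ring.
  apply: ler_wpM2l => //; have := sqr_ge0 (f p.1 + f p.2); rewrite !expr2.
  by move: (f p.1) (f p.2) => a b h; lra.
rewrite esumD; [|by move=> p _; exact: Bf|by move=> p _; exact: Bf].
rewrite T1 T2; apply: lte_mul_pinfty => //; exact: lte_add_pinfty.
Qed.

Lemma D0_lty f : D0 d sigma f -> (Qform d sigma f < +oo)%E.
Proof.
move=> /(_ 1 ltr01)[phi [phiC phiQ]].
have c2 : (0 <= (c / 2)%:E)%E by rewrite lee_fin divr_ge0// ltW.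
have Qphi : (Qform d sigma (fun x => phi x - f x)%R < +oo)%E.
  apply: lt_trans (ltry 1); apply: le_lt_trans phiQ.
  by rewrite leeDl// lee_fin sqr_ge0.
have sym : energy (fun x => (f x - phi x)%R) = energy (fun x => (phi x - f x)%R).
  by apply: eq_esum => p _; congr EFin; ring.
rewrite QformE; apply: (@le_lt_trans _ _ ((c / 2)%:E * ((1 + 1)%:E * energy phi +
    (1 + 1^-1)%:E * energy (fun x => (f x - phi x)%R)))%E).
  by apply: lee_wpmul2l => //; exact: energy_quasi_triangle.
rewrite ge0_muleDr; [|by rewrite mule_ge0 ?energy_ge0// lee_fin addr_ge0 ?invr_ge0..].
apply: lte_add_pinfty; rewrite muleCA; apply: lte_mul_pinfty => //.
- by apply: lte_mul_pinfty => //; exact: energy_Cc_lty.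
- by rewrite sym -QformE.
Qed.

Lemma D0_approx f : D0 d sigma f -> exists phi : nat -> Zd d -> R,
  [/\ forall n, Cc d (phi n),
      forall n, (Qform d sigma (fun x => phi n x - f x)%R <= (n.+1%:R^-1)%:E)%E &
      forall x, phi n x @[n --> \oo] --> f x].
Proof.
move=> fD; have /choice[phi phiP] : forall n : nat, exists phi : Zd d -> R, Cc d phi /\
    (Qform d sigma (fun x => phi x - f x)%R + ((phi 0 - f 0) ^+ 2)%R%:E <
      (n.+1%:R^-1)%:E)%E.
  by move=> n; apply: fD; rewrite invr_gt0.
exists phi; split=> [n|n|x]; first by case: (phiP n).
  case: (phiP n) => _ /ltW; apply: le_trans; rewrite leeDl// lee_fin.
  exact: sqr_ge0.
have [K K0 KP] := point_bound x.
have c2 : 0 < c / 2 by rewrite divr_gt0.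
pose K' := K * (2 / c + 1).
have K'0 : 0 < K' by rewrite mulr_gt0// addr_gt0// divr_gt0.
have bnd n : (phi n x - f x) ^+ 2 <= K' * n.+1%:R^-1.
  rewrite -lee_fin; apply: le_trans (KP (fun x => phi n x - f x)) _.
  rewrite (_ : K' * _ = K * ((2 / c + 1) * n.+1%:R^-1)); last by rewrite mulrA.
  rewrite [(K * _)%:E]EFinM; apply: lee_wpmul2l; first by rewrite lee_fin ltW.
  case: (phiP n) => _ /ltW h.
  rewrite mulrDl mul1r EFinD; apply: leeD.
    rewrite EFinM -[X in (X <= _)%E]mul1e.
    have -> : (1 = (2 / c)%:E * (c / 2)%:E :> \bar R)%E.
      by rewrite -EFinM; congr EFin; field; rewrite gt_eqF.
    rewrite -muleA -QformE; apply: lee_wpmul2l; first by rewrite lee_fin divr_ge0// ltW.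
    by apply: le_trans h; rewrite leeDl// lee_fin sqr_ge0.
  by apply: le_trans h; rewrite leeDr// Qform_ge0.
have sq0 : (phi n x - f x) ^+ 2 @[n --> \oo] --> 0.
  have h : K' * n.+1%:R^-1 @[n --> \oo] --> 0.
    by rewrite -(mulr0 K'); apply: cvgM; [exact: cvg_cst|exact: cvg_harmonic].
  by apply: (squeeze_cvgr _ (cvg_cst 0) h); apply: nearW => n; rewrite sqr_ge0 bnd.
apply/cvgrPdist_lt => e e0.
have [N _ NP] := cvgr_lt 0 sq0 (e ^+ 2) (exprn_gt0 2 e0).
exists N => // n /= /NP h; rewrite distrC -ltr_sqr ?nnegrE ?(ltW e0)//.
by rewrite real_normK ?num_real.
Qed.

(** Approximants converge pointwise, and their form exceeds [(1 + e)] times that of [f] by a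
    vanishing error. Letting first [n] and then [e] go to the limit gives the bound. *)
Lemma D0_extend (Psi : (Zd d -> R) -> R) :
  (forall (phi : nat -> Zd d -> R) f, (forall x, phi n x @[n --> \oo] --> f x) ->
    Psi (phi n) @[n --> \oo] --> Psi f) ->
  (forall f, Cc d f -> ((Psi f)%:E <= Qform d sigma f)%E) ->
  forall f, D0 d sigma f -> ((Psi f)%:E <= Qform d sigma f)%E.
Proof.
move=> Psi_cont Psi_le f /D0_approx[phi [phiC phiQ phif]].
have [fy|] := eqVneq (Qform d sigma f) +oo%E; first by rewrite fy leey.
rewrite -ltey => ffin; have fE : Qform d sigma f = (fine (Qform d sigma f))%:E.
  by rewrite fineK// ge0_fin_numE// Qform_ge0.
set Qf := fine _ in fE; rewrite fE.
have Qf0 : 0 <= Qf by rewrite fine_ge0// Qform_ge0.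
have c20 : 0 <= c / 2 by rewrite divr_ge0// ltW.
have key e : 0 < e -> Psi f <= (1 + e) * Qf.
  move=> e0; have bnd n : Psi (phi n) <= (1 + e) * Qf + (1 + e^-1) * n.+1%:R^-1.
    have e1 : 0 <= 1 + e by rewrite addr_ge0// ltW.
    have e2 : 0 <= 1 + e^-1 by rewrite addr_ge0// invr_ge0 ltW.
    rewrite -lee_fin; apply: le_trans (Psi_le _ (phiC n)) _.
    rewrite QformE; apply: le_trans (lee_wpmul2l _ (energy_quasi_triangle f (phi n) e0)) _.
      by rewrite lee_fin.
    rewrite ge0_muleDr; [|by rewrite mule_ge0 ?energy_ge0// lee_fin..].
    rewrite muleCA -QformE [X in (_ + X)%E]muleCA -QformE fE -EFinM.
    rewrite [((1 + e) * Qf + _)%:E]EFinD.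
    apply: leeD => //; rewrite [((1 + e^-1) * _)%:E]EFinM; apply: lee_wpmul2l; first by rewrite lee_fin.
    exact: phiQ.
  have lim : (1 + e) * Qf + (1 + e^-1) * n.+1%:R^-1 @[n --> \oo] -->
      (1 + e) * Qf + (1 + e^-1) * 0.
    apply: cvgD; first exact: cvg_cst.
    by apply: cvgM; [exact: cvg_cst|exact: cvg_harmonic].
  rewrite mulr0 addr0 in lim.
  by apply: (ler_cvg_to (Psi_cont _ _ phif) lim); exact: nearW.
rewrite lee_fin; apply/ler_addgt0Pr => e e0.
(* The [+ 1] covers [Qf = 0]; the error is then [e * Qf / (Qf + 1) <= e]. *)
have e'0 : 0 < e / (Qf + 1) by rewrite divr_gt0// ltr_wpDl.
apply: le_trans (key _ e'0) _; rewrite mulrDl mul1r lerD2l.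
by rewrite mulrAC ler_pdivrMr ?ltr_wpDl// ler_wpM2l ?(ltW e0)// lerDl.
Qed.

(** Finite partial sums are pointwise continuous, so [D0_extend] applies to each before the supremum
    is taken. *)
Lemma D0_hardy w' f : hardy_weight d sigma w' -> D0 d sigma f ->
  (wsum d w' f <= Qform d sigma f)%E.
Proof.
move=> [w'0 w'H] fD; apply: ge_ereal_sup => _ [X [finX _] <-].
rewrite fsbig_finite//= sumEFin.
pose Psi (g : Zd d -> R) := \sum_(x <- finmap.enum_fset (fset_set X)) w' x * g x ^+ 2.
apply: (@D0_extend Psi) => // [phi g phig|g gC].
  apply: cvg_sumr => x; apply: cvgM; first exact: cvg_cst.
  by rewrite expr2; under eq_fun do rewrite expr2; apply: cvgM; exact: phig.
apply: le_trans (w'H _ gC); rewrite /Psi -sumEFin -fsbig_finite//.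
by apply: esum_ge; exists X.
Qed.

(** The functional passed to [D0_extend] is a finite part of the weighted sum plus one ground state
    term. Equality in the Hardy inequality, with a finite value, leaves no room for that term. *)
Lemma D0_ground_state f p : D0 d sigma f ->
  Qform d sigma f = wsum d w f -> (wsum d w f < +oo)%E -> gs_term f p = 0.
Proof.
move=> fD Qw wfin.
have wEf : wsum d w f = (fine (wsum d w f))%:E.
  by rewrite fineK// ge0_fin_numE// wsum_ge0.
set q0 := fine _ in wEf.
suff : (wsum d w f <= (q0 - c / 2 * gs_term f p)%:E)%E.
  rewrite wEf lee_fin => h; apply/eqP; rewrite eq_le gs_term_ge0 andbT.
  by rewrite -(@pmulr_rle0 _ (c / 2)) ?divr_gt0//; lra.
apply: ge_ereal_sup => _ [X [finX _] <-].
rewrite fsbig_finite//= sumEFin.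
pose Psi (g : Zd d -> R) := \sum_(x <- finmap.enum_fset (fset_set X)) w x * g x ^+ 2 +
  c / 2 * gs_term g p.
suff : ((Psi f)%:E <= Qform d sigma f)%E.
  by rewrite Qw wEf !lee_fin /Psi => h; lra.
apply: (@D0_extend Psi) => // [phi g phig|g gC].
  apply: cvgD.
    apply: cvg_sumr => x; apply: cvgM; first exact: cvg_cst.
    by rewrite expr2; under eq_fun do rewrite expr2; apply: cvgM; exact: phig.
  apply: cvgM; first exact: cvg_cst.
  rewrite /gs_term; apply: cvgM; first exact: cvg_cst.
  apply: cvgM; first exact: cvg_cst.
  rewrite expr2; under eq_fun do rewrite expr2.
  have h : phi n p.1 / u p.1 - phi n p.2 / u p.2 @[n --> \oo] -->
      g p.1 / u p.1 - g p.2 / u p.2.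
    by apply: cvgB; (apply: cvgM; [exact: phig|exact: cvg_cst]).
  exact: cvgM.
rewrite Qform_Cc// addeC /Psi EFinD; apply: leeD.
  rewrite -sumEFin -fsbig_finite//.
  by apply: esum_ge; exists X.
rewrite EFinM; apply: lee_wpmul2l; first by rewrite lee_fin divr_ge0// ltW.
apply: (@le_esum_term _ _ (fun p => (gs_term g p)%:E)) => q'.
by rewrite lee_fin gs_term_ge0.
Qed.

Lemma D0_proportional f : D0 d sigma f -> Qform d sigma f = wsum d w f ->
  (wsum d w f < +oo)%E -> forall x, f x = f 0 / u 0 * u x.
Proof.
move=> fD Qw wfin x; suff h : f x / u x = f 0 / u 0 by rewrite -h divfK// gt_eqF.
have nbr y z : 0 < B (z - y) -> f y / u y = f 0 / u 0 -> f z / u z = f 0 / u 0.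
  move=> Bzy <-; have := D0_ground_state (z, y) fD Qw wfin; rewrite /gs_term /=.
  move=> /eqP; rewrite mulf_eq0 (gt_eqF Bzy) /= mulf_eq0.
  by rewrite (gt_eqF (mulr_gt0 (u_gt0 z) (u_gt0 y))) /= sqrf_eq0 subr_eq0 => /eqP.
elim/Zd_ind: x => [//|x i IH]; split; apply: nbr IH; first by rewrite addrC addKr.
by rewrite -BN opprB opprB addrC subrK.
Qed.

End Ground_state.

(** * Criticality *)

Section Critical_weight.
Context {R : realType} {d : nat}.
Hypothesis d0 : (0 < d)%N.
Variables s al : R.
Hypotheses (s0 : 0 < s) (s1 : s <= 1) (sal : s < al) (ald : al < d%:R / 2).
Implicit Types (x y : Zd d) (n N M : nat).

Let B x : R := fine (pot (jump s) x).
Let u x : R := fine (pot (bcoef al) x).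
Let v x : R := fine (pot (bcoef (al - s)) x).
Let c : R := deg (R := R) (d := d) `^ s.

Let al0 : 0 < al. Proof. exact: lt_trans sal. Qed.
Let als0 : 0 < al - s. Proof. by rewrite subr_gt0. Qed.
Let ba_ge0 n : 0 <= bcoef al n. Proof. exact/bcoef_ge0/ltW. Qed.
Let bas_ge0 n : 0 <= bcoef (al - s) n. Proof. exact/bcoef_ge0/ltW. Qed.
Let jp_ge0 n : 0 <= jump s n. Proof. exact: jump_ge0 (ltW s0) s1. Qed.

Let potuE x : pot (bcoef al) x = (u x)%:E.
Proof.
by rewrite fineK// ge0_fin_numE ?pot_ge0//; exact: esum_bcoef_rw_lty.
Qed.

Let potvE x : pot (bcoef (al - s)) x = (v x)%:E.
Proof.
rewrite fineK// ge0_fin_numE ?pot_ge0//; apply: esum_bcoef_rw_lty => //.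
by move: s0 ald; lra.
Qed.

Let potBE x : pot (jump s) x = (B x)%:E.
Proof. exact: pot_jump_fin. Qed.

Lemma rw_nbr n x i : 0 < rw n x :> R ->
  0 < rw n.+1 (x + unitv d i) :> R /\ 0 < rw n.+1 (x - unitv d i) :> R.
Proof.
move=> nx; split; rewrite rwS divr_gt0 ?deg_gt0// /adj (bigD1 i)//=.
  apply: ltr_pwDl; last by apply: sumr_ge0 => j _; rewrite !addr_ge0 ?mulr_ge0 ?rw_ge0.
  by rewrite addrK ltr_wpDl// addr_ge0 ?mulr_ge0 ?rw_ge0.
apply: ltr_pwDl; last by apply: sumr_ge0 => j _; rewrite !addr_ge0 ?mulr_ge0 ?rw_ge0.
by rewrite subrK ltr_wpDr ?rw_ge0// ltr_wpDl// mulr_ge0 ?rw_ge0.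
Qed.

Let pot_gt0 (a : nat -> R) n x : (forall k, 0 <= a k) -> 0 < a n -> 0 < rw n x :> R ->
  (0 < pot a x)%E.
Proof.
move=> a0 an rn; apply: (@lt_le_trans _ _ (a n * rw n x)%:E).
  by rewrite lte_fin mulr_gt0.
apply: (@le_esum_term _ _ (fun n => (a n * rw n x)%:E)) => k.
by rewrite lee_fin mulr_ge0 ?rw_ge0.
Qed.

Let rw00 : 0 < rw 0 (0 : Zd d) :> R. Proof. by rewrite rw0 eqxx. Qed.

Let u_gt0 x : 0 < u x.
Proof.
rewrite -lte_fin -potuE; have [n rn] : exists n, 0 < rw n x :> R.
  elim/Zd_ind: x => [|x i [n rn]]; first by exists 0%N.
  by split; exists n.+1; have [] := rw_nbr i rn.
by apply: (pot_gt0 _ _ rn) => //; exact: bcoef_gt0.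
Qed.

Let v_ge0 x : 0 <= v x. Proof. by rewrite fine_ge0// pot_ge0. Qed.

Let B_ge0 x : 0 <= B x. Proof. by rewrite fine_ge0// pot_ge0. Qed.

Let BN x : B (- x) = B x. Proof. by rewrite /B potN. Qed.

Let B_nbr i : 0 < B (unitv d i).
Proof.
rewrite -lte_fin -potBE; have [r1 _] := rw_nbr i rw00; rewrite add0r in r1.
by apply: (pot_gt0 _ _ r1) => //=; rewrite bcoef0 divr1 mulr1.
Qed.

Let B_sum1 x : (\esum_(y in [set: Zd d]) (B (x - y)%R)%:E = 1)%E.
Proof. exact: esum_B. Qed.

Let Buv x : (\esum_(y in [set: Zd d]) (B (x - y)%R * u y)%:E + (v x)%:E = (u x)%:E)%E.
Proof.
have ufin y : (pot (bcoef al) y < +oo)%E by rewrite potuE ltry.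
transitivity (pot (cauchy_product (jump s) (bcoef al)) x + pot (bcoef (al - s)) x)%E.
  rewrite -potvE -(pot_conv d0 _ jp_ge0 ba_ge0 ufin); congr (_ + _)%E.
  by apply: eq_esum => y _; rewrite potBE potuE.
have cj n : 0 <= cauchy_product (jump s) (bcoef al) n.
  by apply: sumr_ge0 => k _; exact: mulr_ge0.
rewrite -potuE -esumD; [|by move=> n _; rewrite lee_fin mulr_ge0 ?rw_ge0
  |by move=> n _; rewrite lee_fin mulr_ge0 ?rw_ge0].
apply: eq_esum => n _; rewrite -EFinD -mulrDl cauchy_product_jump.
by rewrite subrK.
Qed.

Let esum_uv : (\esum_(x in [set: Zd d]) (u x * v x)%:E = pot (bcoef (2 * al - s)) (0%R : Zd d))%E.
Proof.
have vfin y : (pot (bcoef (al - s)) y < +oo)%E by rewrite potvE ltry.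
transitivity (pot (cauchy_product (bcoef al) (bcoef (al - s))) (0%R : Zd d)).
  rewrite -(pot_conv d0 _ ba_ge0 bas_ge0 vfin); apply: eq_esum => y _.
  by rewrite sub0r potN potuE potvE.
apply: eq_pot => n; rewrite cauchy_product_bcoef; congr bcoef; ring.
Qed.

Let c_gt0 : 0 < c. Proof. exact/powR_gt0/deg_gt0. Qed.

Let kappaE x : x != 0 -> kappa d s x = c * B x.
Proof. exact: kappa_pos. Qed.

Let wE x : w_sa d s al x = c * (v x / u x).
Proof.
have D0 := deg_gt0 (R := R) d0.
rewrite /w_sa (_ : s - al = - (al - s)); last by rewrite opprB.
rewrite !kappaN// -/(u x) -/(v x) opprB.
have -> : deg (R := R) (d := d) `^ (s - al) = c * deg (R := R) (d := d) `^ (- al).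
  by rewrite powRD// (gt_eqF D0) implybT.
have p0 : deg (R := R) (d := d) `^ (- al) != 0 by rewrite gt_eqF// powR_gt0.
have un0 : u x != 0 by rewrite gt_eqF.
by move: (deg `^ (- al)) p0 => p p0; field; rewrite un0 p0.
Qed.

Let wsum_u : (wsum d (w_sa d s al) u =
  c%:E * \esum_(x in [set: Zd d]) (u x * v x)%:E)%E.
Proof.
rewrite (wsumE u_gt0 v_ge0 c_gt0 wE); congr (_ * _)%E; apply: eq_esum => x _.
by congr EFin; have un0 : u x != 0 by [rewrite gt_eqF]; field.
Qed.

(** An optimiser has finite form and is a nonzero multiple of [u], which would make [\sum u v]
    finite; at or above the threshold this sum is a divergent series of order at least [d / 2]. *)
Lemma positive_critical_lt : positive_critical d s (w_sa d s al) ->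
  al < (d%:R / 2 + s) / 2.
Proof.
move=> [_ [f [fD [f0 fQ]]]]; rewrite ltNge; apply/negP => al_ge.
have Qfin := D0_lty B_ge0 BN B_sum1 c_gt0 kappaE fD.
have wfin : (wsum d (w_sa d s al) f < +oo)%E by rewrite -fQ.
have prop := D0_proportional B_ge0 BN B_sum1 u_gt0 v_ge0 Buv B_nbr c_gt0 kappaE wE fD fQ wfin.
set l := f 0 / u 0 in prop.
have l0 : l != 0.
  apply/eqP => l0; apply: f0; apply/funext => x.
  by rewrite prop l0 mul0r.
have : (wsum d (w_sa d s al) f = (l ^+ 2)%:E * wsum d (w_sa d s al) u)%E.
  rewrite -esumZ ?sqr_ge0//; last first.
    by move=> x; rewrite lee_fin mulr_ge0 ?sqr_ge0// (w_ge0 u_gt0 v_ge0 c_gt0 wE).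
  by apply: eq_esum => x _; rewrite -EFinM; congr EFin; rewrite prop; ring.
rewrite wsum_u esum_uv => wf.
have l2 : 0 < l ^+ 2 by rewrite lt_def sqr_ge0 sqrf_eq0 l0.
move: wfin; rewrite wf; have -> : pot (bcoef (2 * al - s)) (0%R : Zd d) = +oo%E.
  by apply: esum_bcoef_rw_y => //; lra.
by rewrite mulry gtr0_sg// mul1e mulry gtr0_sg// mul1e ltxx.
Qed.

(** * Below the threshold: approximation of the ground state and criticality *)

Hypothesis al_lt : al < (d%:R / 2 + s) / 2.

Let U N x : R := \sum_(n < N) bcoef al n * rw n x.

Let tail N : \bar R := (\esum_(j in [set: nat])
  (if (j < N)%N then 0 else (bcoef (2 * al) j)%:E * dissip (d := d) s j))%E.

Let pot_trunc0 N x : pot (trunc (bcoef al) 0 N) x = (U N x)%:E.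
Proof.
rewrite -sumEFin -(@esum_ord _ (fun n => (bcoef al n * rw n x)%:E)); last first.
  by move=> n; rewrite lee_fin mulr_ge0 ?rw_ge0.
by apply: eq_esum => n _; rewrite /trunc /=; case: ifP; rewrite ?mul0r.
Qed.

Let pot_truncE N M x : (N <= M)%N ->
  pot (trunc (bcoef al) N M) x = (U M x - U N x)%:E.
Proof.
move=> NM; have t0 K L n : 0 <= trunc (bcoef al) K L n by rewrite /trunc; case: ifP.
have : (pot (trunc (bcoef al) N M) x + (U N x)%:E = (U M x)%:E)%E.
  rewrite -!pot_trunc0 -esumD; [|by move=> n _; rewrite lee_fin mulr_ge0 ?rw_ge0
    |by move=> n _; rewrite lee_fin mulr_ge0 ?rw_ge0].
  apply: eq_esum => n _; rewrite -EFinD -mulrDl; congr (_ * _)%:E; rewrite /trunc /=.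
  case: (leqP N n) => nN /=; first by rewrite addr0.
  by rewrite (leq_trans nN NM) add0r.
by move=> /(congr1 (fun e => e - (U N x)%:E)%E); rewrite addeK.
Qed.

Let U_cvg x : U N x @[N --> \oo] --> u x.
Proof.
have := @esum_series _ (fun n => bcoef al n * rw n x) (u x) _ (potuE x).
rewrite /series /=; under eq_fun do rewrite big_mkord; apply => n.
by rewrite mulr_ge0 ?rw_ge0.
Qed.

Let U_le N x : U N x <= u x.
Proof.
rewrite -lee_fin -potuE -sumEFin; apply: (@sum_le_esum _ (fun n => (bcoef al n * rw n x)%:E)) => n.
by rewrite lee_fin mulr_ge0 ?rw_ge0.
Qed.

Let U_ge0 N x : 0 <= U N x.
Proof. by apply: sumr_ge0 => n _; rewrite mulr_ge0 ?rw_ge0. Qed.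

Let U_Cc N : Cc d (U N).
Proof.
apply: (@sub_finite_set _ _ (\bigcup_(n in `I_N) [set x | walk n x != 0 :> R])); last first.
  by apply: bigcup_finite => [|n _]; [exact: finite_II|exact: finite_walk].
move=> x /=; apply: contraPP => nx; apply/negP/negPn/eqP.
rewrite /U big1// => n _; rewrite rwE.
have -> : walk n x = 0 :> R.
  by apply/eqP/negPn/negP => h; apply: nx; exists n => //=.
by rewrite mul0r mulr0.
Qed.

Let UB_Cc N M : Cc d (fun x => U M x - U N x).
Proof.
apply: (@sub_finite_set _ _ ([set x | U M x != 0] `|` [set x | U N x != 0])); last first.
  by rewrite finite_setU; split; exact: U_Cc.
move=> x /=; apply: contraPP => /not_orP[/negP/negPn/eqP -> /negP/negPn/eqP ->].
by rewrite subrr eqxx.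
Qed.

Let energy_UB N M : (N <= M)%N ->
  (energy B (fun x => (U M x - U N x)%R) <= 2%:E * tail N)%E.
Proof.
move=> NM; apply: (@energy_trunc _ _ d0 _ s0 s1 al N M) => //; last exact: UB_Cc.
by move=> x; exact: pot_truncE.
Qed.

Let energy_uB N : (energy B (fun x => (U N x - u x)%R) <= 2%:E * tail N)%E.
Proof.
apply: (@esum_le_cvg _ _ (fun M (p : Zd d * Zd d) => B (p.1 - p.2) *
    ((U N p.1 - U M p.1) - (U N p.2 - U M p.2)) ^+ 2)).
- by move=> M p; rewrite mulr_ge0// sqr_ge0.
- move=> p; apply: cvgM; first exact: cvg_cst.
  have h : (U N p.1 - U M p.1) - (U N p.2 - U M p.2) @[M --> \oo] -->
      (U N p.1 - u p.1) - (U N p.2 - u p.2).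
    by apply: cvgB; (apply: cvgB; [exact: cvg_cst|exact: U_cvg]).
  by rewrite expr2; under eq_fun do rewrite expr2; exact: cvgM.
- exists N => // M /= NM; apply: le_trans (energy_UB NM).
  by apply: le_esum => p _; rewrite lee_fin le_eqVlt; apply/orP; left; apply/eqP; ring.
Qed.

(** The transform annihilates [u], so [U N] has the ground state terms of [u - U N]. These are
    limits of those of the finitely supported [U M - U N], whose ground state energy is at most the
    energy. *)
Let gs_energy_U N : (gs_energy B u (U N) <= 2%:E * tail N)%E.
Proof.
apply: (@esum_le_cvg _ _ (fun M p => gs_term B u (fun x => U M x - U N x) p)).
- by move=> M p; exact: (gs_term_ge0 B_ge0 u_gt0).
- move=> p; rewrite /gs_term; apply: cvgM; first exact: cvg_cst.
  apply: cvgM; first exact: cvg_cst.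
  have un x : u x != 0 by rewrite gt_eqF.
  have h : (U M p.1 - U N p.1) / u p.1 - (U M p.2 - U N p.2) / u p.2 @[M --> \oo] -->
      (u p.1 - U N p.1) / u p.1 - (u p.2 - U N p.2) / u p.2.
    by apply: cvgB; (apply: cvgM; [apply: cvgB; [exact: U_cvg|exact: cvg_cst]|exact: cvg_cst]).
  rewrite (_ : (U N p.1 / u p.1 - U N p.2 / u p.2) ^+ 2 =
    ((u p.1 - U N p.1) / u p.1 - (u p.2 - U N p.2) / u p.2) ^+ 2); last first.
    by field; rewrite !un.
  by rewrite expr2; under eq_fun do rewrite expr2; exact: cvgM.
- exists N => // M /= NM; apply: le_trans (energy_UB NM).
  rewrite (energy_Cc B_ge0 BN B_sum1 u_gt0 v_ge0 Buv (UB_Cc N M)) leeDl//.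
  apply: mule_ge0 => //; apply: esum_ge0 => x _.
  by rewrite lee_fin mulr_ge0 ?sqr_ge0// divr_ge0// ltW.
Qed.

Let tail_small e : 0 < e -> exists N, (tail N < e%:E)%E.
Proof.
move=> e0; apply: esum_nat_tail => //.
- move=> j; apply: mule_ge0; last exact: dissip_ge0.
  by rewrite lee_fin bcoef_ge0// mulr_ge0// ltW.
- by apply: esum_dissip_lty => //; move: s0 sal al_lt; lra.
Qed.

Let tail_le N M : (N <= M)%N -> (tail M <= tail N)%E.
Proof.
move=> NM; apply: le_esum => j _; case: (ltnP j N) => jN.
  by rewrite (leq_trans jN NM).
case: ifP => // _; apply: mule_ge0; last exact: dissip_ge0.
by rewrite lee_fin bcoef_ge0// mulr_ge0// ltW.
Qed.

Let c2 : 0 < c / 2. Proof. by rewrite divr_gt0. Qed.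

Lemma ground_state_D0 : D0 d s u.
Proof.
(* The form of [U N - u] is at most [c * tail N], so this choice uses half of [e]; the value at 0
   uses the other half. *)
move=> e e0; have e2 : 0 < e / (2 * c) by rewrite divr_gt0// mulr_gt0.
have [N1 tN1] := tail_small e2.
have sq0 : (U N 0 - u 0) ^+ 2 @[N --> \oo] --> (0 : R).
  have h : U N 0 - u 0 @[N --> \oo] --> u 0 - u 0.
    by apply: cvgB; [exact: U_cvg|exact: cvg_cst].
  rewrite subrr in h; rewrite -(mulr0 (0 : R)); under eq_fun do rewrite expr2.
  exact: cvgM.
have e4 : 0 < e / 2 by rewrite divr_gt0.
have [N2 _ N2P] := cvgr_lt 0 sq0 (e / 2) e4.
pose N := maxn N1 N2; exists (U N); split; first exact: U_Cc.
rewrite (splitr e) EFinD; apply: lte_leD => //.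
  rewrite (QformE B_ge0 c_gt0 kappaE).
  apply: (@le_lt_trans _ _ ((c / 2)%:E * (2%:E * tail N))%E).
    by apply: lee_wpmul2l; [rewrite lee_fin ltW|exact: energy_uB].
  rewrite muleA -EFinM divfK//.
  apply: (@le_lt_trans _ _ (c%:E * tail N1)%E).
    by apply: lee_wpmul2l; [rewrite lee_fin ltW|exact/tail_le/leq_maxl].
  rewrite -lte_pdivlMl// -EFinM; apply: lt_le_trans tN1 _.
  rewrite lee_fin le_eqVlt; apply/orP; left; apply/eqP; field.
  by rewrite gt_eqF.
by rewrite lee_fin; apply/ltW/N2P => /=; exact: leq_maxr.
Qed.

Let hardy := ground_state_hardy B_ge0 BN B_sum1 u_gt0 v_ge0 Buv c_gt0 kappaE wE.

(** One inequality is the extended Hardy inequality. For the other, the energy of [U M] is its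
    ground state energy, at most twice a tail, plus twice [\sum (U M)^2 v / u <= \sum u v]; Fatou
    passes to [u]. *)
Lemma Qform_ground_state : Qform d s u = wsum d (w_sa d s al) u.
Proof.
apply/eqP; rewrite eq_le; apply/andP; split; last first.
  exact: (D0_hardy B_ge0 BN B_nbr c_gt0 kappaE hardy ground_state_D0).
apply/lee_addgt0Pr => e e0; have ec : 0 < e / c by rewrite divr_gt0.
have [N tN] := tail_small ec.
rewrite (QformE B_ge0 c_gt0 kappaE) wsum_u.
set S := (\esum_(x in _) _)%E.
have uUE : (energy B u <= 2%:E * (e / c)%:E + 2%:E * S)%E.
  apply: (@esum_le_cvg _ _ (fun M (p : Zd d * Zd d) => B (p.1 - p.2) *
      (U M p.1 - U M p.2) ^+ 2)).
  - by move=> M p; rewrite mulr_ge0// sqr_ge0.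
  - move=> p; apply: cvgM; first exact: cvg_cst.
    have h : U M p.1 - U M p.2 @[M --> \oo] --> u p.1 - u p.2.
      by apply: cvgB; exact: U_cvg.
    by rewrite expr2; under eq_fun do rewrite expr2; exact: cvgM.
  - exists N => // M /= NM; rewrite -/(energy B (U M)).
    rewrite (energy_Cc B_ge0 BN B_sum1 u_gt0 v_ge0 Buv (U_Cc M)).
    apply: leeD.
      apply: le_trans (gs_energy_U M) _; apply: lee_wpmul2l => //.
      exact: le_trans (tail_le NM) (ltW tN).
    apply: lee_wpmul2l => //; apply: le_esum => x _; rewrite lee_fin.
    have -> : u x * v x = u x ^+ 2 * (v x / u x).
      by have un : u x != 0 by [rewrite gt_eqF]; field.
    have ux := ltW (u_gt0 x); apply: ler_wpM2r; first exact: divr_ge0.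
    apply: lerXn2r; [exact: U_ge0|exact: ux|exact: U_le].
apply: le_trans (lee_wpmul2l _ uUE) _; first by rewrite lee_fin ltW.
have S0 : (0 <= S)%E.
  by apply: esum_ge0 => x _; rewrite lee_fin mulr_ge0// ltW.
rewrite ge0_muleDr; [|by rewrite mule_ge0// lee_fin ltW|by rewrite mule_ge0].
rewrite addeC muleA -EFinM divfK// leeD2l//.
rewrite -!EFinM lee_fin le_eqVlt; apply/orP; left; apply/eqP; field.
by rewrite gt_eqF.
Qed.

(** Testing a larger Hardy weight on [u] gives [\sum w' u^2 <= \sum w u^2], which is finite; since
    [u] is positive everywhere, the weights coincide. *)
Lemma lt_positive_critical : positive_critical d s (w_sa d s al).
Proof.
have wfin : (wsum d (w_sa d s al) u < +oo)%E.
  rewrite wsum_u esum_uv; apply: lte_mul_pinfty; rewrite ?lee_fin ?(ltW c_gt0)//.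
  by apply: esum_bcoef_rw_lty => //; move: s0 sal al_lt; lra.
split; last first.
  exists u; split; first exact: ground_state_D0.
  split; last exact: Qform_ground_state.
  by move=> /(congr1 (fun f => f 0)); apply/eqP; rewrite gt_eqF.
split; first exact: hardy.
move=> w' w'H ww'.
have w'u := D0_hardy B_ge0 BN B_nbr c_gt0 kappaE w'H ground_state_D0.
rewrite Qform_ground_state in w'u.
apply/funext => x; apply/eqP; rewrite eq_le ww' andbT leNgt; apply/negP => wx.
have d0' y : 0 <= (w' y - w_sa d s al y) * u y ^+ 2.
  by rewrite mulr_ge0 ?sqr_ge0// subr_ge0.
have w0 y : 0 <= w_sa d s al y * u y ^+ 2.
  by rewrite mulr_ge0 ?sqr_ge0// (w_ge0 u_gt0 v_ge0 c_gt0 wE).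
have e : (wsum d w' u = wsum d (w_sa d s al) u +
    \esum_(y in [set: Zd d]) ((w' y - w_sa d s al y) * u y ^+ 2)%:E)%E.
  rewrite -esumD; [|by move=> y _; rewrite lee_fin|by move=> y _; rewrite lee_fin].
  by apply: eq_esum => y _; rewrite -EFinD; congr EFin; ring.
move: w'u; rewrite e leNgt => /negP; apply.
rewrite lteDl; last by rewrite ge0_fin_numE//; apply: esum_ge0 => y _; rewrite lee_fin.
apply: (@lt_le_trans _ _ ((w' x - w_sa d s al x) * u x ^+ 2)%:E).
  by rewrite lte_fin mulr_gt0 ?exprn_gt0// subr_gt0.
apply: (@le_esum_term _ _ (fun y => ((w' y - w_sa d s al y) * u y ^+ 2)%:E)) => y.
by rewrite lee_fin.
Qed.

End Critical_weight.

Theorem theorem3p2 (R : realType) (d : nat) (sigma alpha : R) :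
  0 < sigma -> sigma <= 1 ->
  ((d = 1)%N \/ (d = 2)%N -> sigma < d%:R / 2) ->
  sigma < alpha -> alpha < d%:R / 2 ->
  positive_critical d sigma (w_sa d sigma alpha) <->
  alpha < (d%:R / 2 + sigma) / 2.
Proof.
move=> s0 s1 _ sa ad.
have d0 : (0 < d)%N.
  (* In dimension 0 the conditions would force [0 < alpha < 0]. *)
  by case: d ad => // ad; exfalso; move: s0 sa ad; rewrite mul0r; lra.
split; first exact: positive_critical_lt.
exact: lt_positive_critical.
Qed.
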